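(* Let $R$ be a domain of characteristic $0$, let $F$ be a one-dimensional commutative formal group law over $R$, let $A$ be a generalized Cartan matrix and $\Lambda$ a Demazure lattice for its root datum. For each $w\in W$ fix a reduced sequence $I_w$. For $u,v\in W$ we have in $\mathbf{D}_F^*$ $$Y_{I_u}^*\cdot Y_{I_v}^*=\sum_{w\ge u,v}p^{I_w}_{I_u,I_v}Y_{I_w}^*$$ (a possibly infinite formal sum), where the coefficients $p^{I_w}_{I_u,I_v}$ satisfy $$p^{I_w}_{I_u,I_v}=\frac{1}{b^Y_{w,I_w}}\Big(b^Y_{w,I_u}b^Y_{w,I_v}-\sum_{u,v\le t<w}p^{I_t}_{I_u,I_v}\,b^Y_{w,I_t}\Big).$$ Here $\le$ is the Bruhat order on $W$.
   Context: Root datum: $A=(a_{ij})_{1\le i,j\le n}$ is an integer matrix with $a_{ii}=2$, $-a_{ij}\in\mathbb{Z}_{\ge 0}$ for $i\ne j$, and $a_{ij}=0\Leftrightarrow a_{ji}=0$. Let $\mathfrak{h}$ be a complex vector space of dimension $2n-\mathrm{rank}\,A$ with linearly independent subsets $\{\alpha_1,\dots,\alpha_n\}\subset\mathfrak{h}^*$ (simple roots) and $\{\alpha_1^\vee,\dots,\alpha_n^\vee\}\subset\mathfrak{h}$ (simple coroots) with $a_{ij}=\langle\alpha_j,\alpha_i^\vee\rangle$. The Weyl group $W$ is generated by $s_i(\lambda)=\lambda-\langle\lambda,\alpha_i^\vee\rangle\alpha_i$ on $\mathfrak{h}^*$; $\ell$ is its length function. The set of (real) roots is $\Phi=\{w(\alpha_i)\}$;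 $\Phi_+=\Phi\cap\sum_i\mathbb{Z}_{\ge0}\alpha_i$, $\Phi_-=-\Phi_+$, $\Phi=\Phi_+\amalg\Phi_-$. For $\alpha=w(\alpha_i)$, $s_\alpha=ws_iw^{-1}$. For $w\in W$, $\Phi_w=\{\alpha\in\Phi_+\mid w^{-1}(\alpha)\in\Phi_-\}$. Demazure lattice: a finitely generated free abelian subgroup $\Lambda$ of $\mathfrak{h}^*$ containing the simple roots, with $\langle\Lambda,\alpha_i^\vee\rangle\subset\mathbb{Z}$ for all $i$, such that every simple root can be extended to a $\mathbb{Z}$-basis of $\Lambda$. It is $W$-invariant. Formal group algebra: $S=R[[\Lambda]]_F=R[[x_\lambda\mid\lambda\in\Lambda]]/J$, where $R[[x_\lambda\mid\lambda\in\Lambda]]$ is the completion of the polynomial ring at the kernel of $x_\lambda\mapsto0$, and $J$ is the closure of the ideal generated by $x_0$ and $x_{\lambda+\mu}-F(x_\lambda,x_\mu)$, $\lambda,\mu\in\Lambda$. $W$ acts on $S$ by $w(x_\lambda)=x_{w(\lambda)}$. Twisted group algebra: $Q=S[\frac1{x_\alpha}\mid\alpha\in\Phi_+]$; $Q_W$ is the left $Q$-module with basis $\{\delta_w\}_{w\in W}$ and product $q\delta_w\cdot q'\delta_{w'}=qw(q')\delta_{ww'}$. Set $X_\alpha=\frac1{x_\alpha}(1-\delta_{s_\alpha})$ and $Y_\alpha=\frac1{x_{-\alpha}}+\frac1{x_\alpha}\delta_{s_\alpha}=\kappa_\alpha-X_\alpha$ with $\kappa_\alpha=\frac1{x_\alpha}+\frac1{x_{-\alpha}}\in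 S$; $Y_i=Y_{\alpha_i}$, $Y_I=Y_{i_1}\cdots Y_{i_l}$ for $I=(i_1,\dots,i_l)$, $Y_\emptyset=1$. A reduced sequence of $w$ is $(i_1,\dots,i_l)$ with $w=s_{i_1}\cdots s_{i_l}$ and $l=\ell(w)$. The formal affine Demazure algebra $\mathbf{D}_F$ is the $R$-subalgebra of $Q_W$ generated by $S$ and all $X_\alpha$, $\alpha\in\Phi$. The $\{Y_{I_w}\}_{w\in W}$ form a basis of $Q_W$ as a left $Q$-module, and $\delta_w=\sum_{v\le w}b^Y_{w,I_v}Y_{I_v}$ with $b^Y_{w,I_v}\in S$ and $b^Y_{w,I_w}=\prod_{\alpha\in\Phi_w}x_\alpha$; set $b^Y_{w,I_v}=0$ if $v\not\le w$. The elements $Y^*_{I_w}$ are defined by $Y^*_{I_w}(Y_{I_v})=1$ if $v=w$ and $0$ otherwise. Dual: $\mathbf{D}_F^*=\mathrm{Hom}_S(\mathbf{D}_F,S)$ ($\mathbf{D}_F$ as a left $S$-module), identified with $\{f\in\mathrm{Hom}_Q(Q_W,Q)\mid f(\mathbf{D}_F)\subseteq S\}$; its product is dual to the coproduct $q\delta_w\mapsto q\delta_w\otimes\delta_w$, i.e. $(fg)(\delta_w)=f(\delta_w)g(\delta_w)$ for all $w\in W$. *)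

(* Defs.v *)
From HB Require Import structures.
From mathcomp Require Import all_boot all_order all_algebra all_fingroup.
From mathcomp Require Import generic_quotient ring_quotient.
From mathcomp Require Import finmap boolp classical_sets cardinality fsbigop.
From mathcomp Require Import reals complex.
From mathcomp Require Import monalg ring.

Set Implicit Arguments.
Unset Strict Implicit.
Unset Printing Implicit Defensive.

Import GRing.Theory.

Local Open Scope ring_scope.
Local Notation "1" := (@mone _) : monom_scope.
Local Notation "x * y" := (mmul x y) : monom_scope.

Section Decompositions.
Variable I : choiceType.
Implicit Types (m a b c : {cmonom I}) (i : I).

Lemma mulcmI a b c : (a * b)%M = (a * c)%M -> b = c.
Proof.
move=> E; apply/eqP/cmP => i; move: (congr1 (fun m : {cmonom I} => m i) E).
by rewrite !cmM => /addnI.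
Qed.

Lemma cm_split m i : m i != 0%N -> m = (ucm i * divcm m (ucm i))%M.
Proof.
move=> mi; apply/eqP/cmP => j; rewrite cmM divcmE ucmE.
by case: eqVneq => [<-|]; rewrite ?subn0 // subnKC // lt0n.
Qed.

Lemma finite_decs m :
  finite_set [set p : {cmonom I} * {cmonom I} | (p.1 * p.2)%M = m]%classic.
Proof.
move: {2}(mdeg m) (erefl (mdeg m)) => d; elim: d m => [|d IH] m dm.
  rewrite (mdeg_eq0I dm); apply: (sub_finite_set _ (finite_set1 (1%M, 1%M))).
  by move=> [a b] /= /unitm[-> ->].
have [i mi] : exists i, m i != 0%N.
  apply: contrapT => Nm; have m1 : m = 1%M.
    apply/eqP/cmP => i; rewrite cm1; case: (eqVneq (m i) 0%N) => // mi.
    by case: Nm; exists i.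
  by move: dm; rewrite m1 mdeg1.
pose m' := divcm m (ucm i); have Em : m = (ucm i * m')%M by apply: cm_split.
have dm' : mdeg m' = d by move: dm; rewrite Em mdegM mdegU => -[].
have Fin := IH _ dm'.
pose l (p : {cmonom I} * {cmonom I}) := ((ucm i * p.1)%M, p.2).
pose r (p : {cmonom I} * {cmonom I}) := (p.1, (ucm i * p.2)%M).
have FU := conj (finite_image l Fin) (finite_image r Fin).
rewrite -finite_setU in FU; apply: sub_finite_set FU => -[a b] /= Eab.
have : (a i + b i)%N != 0%N by rewrite -cmM Eab.
rewrite addn_eq0 negb_and => /orP[] /cm_split E; [left|right].
- exists (divcm a (ucm i), b); last by rewrite /l -E.
  by apply: (@mulcmI (ucm i)); rewrite /= mulmA -E -Em.
- exists (a, divcm b (ucm i)); last by rewrite /r -E.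
  by apply: (@mulcmI (ucm i)); rewrite /= mulmA (mulmC (ucm i)) -(mulmA) -E -Em.
Qed.

Definition decs m : {fset {cmonom I} * {cmonom I}} :=
  fset_set [set p : {cmonom I} * {cmonom I} | (p.1 * p.2)%M = m]%classic.

Lemma in_decs m p : (p \in decs m) = ((p.1 * p.2)%M == m).
Proof.
by rewrite /decs in_fset_set; [apply/idP/eqP; rewrite inE | exact: finite_decs].
Qed.

End Decompositions.

(* The completion of R[x_i | i in I] at the kernel of x_i |-> 0. For the
   grading by total degree this kernel is the ideal of polynomials without
   constant term, so an element of the completion is a family of coefficients,
   indexed by the monomials, with finitely many nonzero ones in each degree.
   The set I of variables may be infinite. *)
Section PowerSeries.
Variables (R : comNzRingType) (I : choiceType).
Implicit Types (d : nat) (m : {cmonom I}).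

Definition degwise_finite (f : {cmonom I} -> R) :=
  forall d, finite_set [set m | mdeg m = d /\ f m != 0]%classic.

Record pseries := PSeries {
  pscoef :> {cmonom I} -> R;
  _ : `[< degwise_finite pscoef >] }.
Implicit Types f g h : pseries.

HB.instance Definition _ := gen_eqMixin pseries.
HB.instance Definition _ := gen_choiceMixin pseries.

Lemma pscoefP f : degwise_finite f.
Proof. by case: f => f /= /asboolP. Qed.

Definition mk_pseries (f : {cmonom I} -> R) (Hf : degwise_finite f) : pseries :=
  PSeries (asboolT Hf).

Lemma pseriesP f g : (forall m, f m = g m) <-> f = g.
Proof.
split=> [|-> //]; case: f g => f Hf [g Hg] /= fg.
have E : f = g by apply/funext.
by rewrite E in Hf *; rewrite (bool_irrelevance Hf Hg).
Qed.

Fact ps0_subproof : degwise_finite (fun=> 0).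
Proof.
by move=> d; apply: sub_finite_set (finite_set0 _) => m /= [_ /eqP].
Qed.
Definition ps0 := mk_pseries ps0_subproof.

Fact psD_subproof f g : degwise_finite (fun m => f m + g m).
Proof.
move=> d; have := conj (pscoefP f d) (pscoefP g d); rewrite -finite_setU.
apply: sub_finite_set => m /= [dm nz].
have [f0|nf] := eqVneq (f m) 0; last by left.
by right; split=> //; move: nz; rewrite f0 add0r.
Qed.
Definition psD f g := mk_pseries (@psD_subproof f g).

Fact psN_subproof f : degwise_finite (fun m => - f m).
Proof.
by move=> d; apply: sub_finite_set (pscoefP f d) => m /=; rewrite oppr_eq0.
Qed.
Definition psN f := mk_pseries (@psN_subproof f).

Lemma degwise_finite1 (m0 : {cmonom I}) : degwise_finite (fun m => (m == m0)%:R).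
Proof.
move=> d; apply: sub_finite_set (finite_set1 m0) => m /= [_].
by case: (eqVneq m m0) => // _ /eqP.
Qed.
Definition ps1 := mk_pseries (degwise_finite1 1%M).

Fact psM_subproof f g :
  degwise_finite (fun m => \sum_(p <- decs m) f p.1 * g p.2).
Proof.
move=> d; pose S (h : pseries) e := [set m | mdeg m = e /\ h m != 0]%classic.
pose T e := [set (a * b)%M | a in S f e & b in S g (d - e)%N]%classic.
have FT : finite_set (\bigcup_(e in `I_d.+1) T e)%classic.
  apply: bigcup_finite => [|e _]; first exact: finite_II.
  by apply: finite_image2; apply: pscoefP.
apply: sub_finite_set FT => m /= [dm nz].
have [[a b] pm pnz] : exists2 p, p \in decs m & f p.1 * g p.2 != 0.
  apply: contrapT => N; move/eqP: nz; apply; rewrite big_seq big1 // => p pm.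
  by have [//|np] := eqVneq (f p.1 * g p.2) 0; case: N; exists p.
move: pm; rewrite in_decs /= => /eqP Em.
have dab : d = (mdeg a + mdeg b)%N by rewrite -mdegM Em.
exists (mdeg a); first by rewrite /= dab ltnS leq_addr.
exists a; first by split=> //; apply: contra_neq pnz => /= ->; rewrite mul0r.
exists b; last by [].
by rewrite /S /= dab addKn; split=> //; apply: contra_neq pnz => /= ->; rewrite mulr0.
Qed.
Definition psM f g := mk_pseries (@psM_subproof f g).

Fact psDA : associative psD.
Proof. by move=> f g h; apply/pseriesP => m /=; rewrite addrA. Qed.
Fact psDC : commutative psD.
Proof. by move=> f g; apply/pseriesP => m /=; rewrite addrC. Qed.
Fact ps0D : left_id ps0 psD.
Proof. by move=> f; apply/pseriesP => m /=; rewrite add0r. Qed.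
Fact psNf : left_inverse ps0 psN psD.
Proof. by move=> f; apply/pseriesP => m /=; rewrite addNr. Qed.

HB.instance Definition _ := GRing.isZmodule.Build pseries psDA psDC ps0D psNf.

Fact psMC : commutative psM.
Proof.
move=> f g; apply/pseriesP => m /=.
pose sw (p : {cmonom I} * {cmonom I}) := (p.2, p.1).
have P : perm_eq (decs m) (map sw (decs m)).
  apply: uniq_perm; rewrite ?map_inj_uniq ?fset_uniq //; first by case=> ? ? [? ?] [-> ->].
  move=> [a b]; apply/idP/mapP => [|[[c e] ce [-> ->]]].
    by rewrite in_decs => /= /eqP E; exists (b, a); rewrite // in_decs mulmC E.
  by move: ce; rewrite !in_decs mulmC.
by rewrite (perm_big _ P) big_map; apply: eq_bigr => p _; rewrite mulrC.
Qed.

Fact psMA : associative psM.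
Proof.
move=> f g h; apply/pseriesP => m /=.
pose G (t : {cmonom I} * {cmonom I} * {cmonom I}) := f t.1.1 * g t.1.2 * h t.2.
pose l := [seq (p.1, q.1, q.2) | p <- enum_fset (decs m), q <- enum_fset (decs p.2)].
pose r := [seq (q.1, q.2, p.2) | p <- enum_fset (decs m), q <- enum_fset (decs p.1)].
have ml t : (t \in l) = ((t.1.1 * t.1.2 * t.2)%M == m).
  apply/allpairsPdep/eqP => [[p [q []]]|Et].
    by rewrite !in_decs => /eqP pm /eqP qp ->; rewrite /= -(mulmA) qp pm.
  exists (t.1.1, (t.1.2 * t.2)%M), (t.1.2, t.2).
  by rewrite !in_decs /= mulmA Et; split=> //; case: t {Et} => [[]].
have mr t : (t \in r) = ((t.1.1 * t.1.2 * t.2)%M == m).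
  apply/allpairsPdep/eqP => [[p [q []]]|Et].
    by rewrite !in_decs => /eqP pm /eqP qp ->; rewrite /= qp pm.
  exists ((t.1.1 * t.1.2)%M, t.2), (t.1.1, t.1.2).
  by rewrite !in_decs /= Et; split=> //; case: t {Et} => [[]].
have P : perm_eq l r.
  apply: uniq_perm; last by move=> t; rewrite ml mr.
    apply: allpairs_uniq_dep => [|p _|]; rewrite ?fset_uniq //.
    move=> _ _ /allpairsPdep[p [q [_ qp ->]]] /allpairsPdep[p' [q' [_ qp' ->]]] /=.
    case=> E1 E2 E3; have Eq : q = q' by case: q q' E2 E3 {qp qp'} => ? ? [? ?] /= -> ->.
    have Ep : p = p'.
      move: qp qp'; rewrite !in_decs Eq => /eqP E /eqP; rewrite E.
      by case: p p' E1 {E} => ? ? [? ?] /= -> ->.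
    by rewrite Ep Eq.
  apply: allpairs_uniq_dep => [|p _|]; rewrite ?fset_uniq //.
  move=> _ _ /allpairsPdep[p [q [_ qp ->]]] /allpairsPdep[p' [q' [_ qp' ->]]] /=.
  case=> E1 E2 E3; have Eq : q = q' by case: q q' E1 E2 {qp qp'} => ? ? [? ?] /= -> ->.
  have Ep : p = p'.
    move: qp qp'; rewrite !in_decs Eq => /eqP E /eqP; rewrite E.
    by case: p p' E3 {E} => ? ? [? ?] /= -> ->.
  by rewrite Ep Eq.
transitivity (\sum_(t <- l) G t).
  rewrite big_allpairs_dep; apply: eq_bigr => p _; rewrite big_distrr /=.
  by apply: eq_bigr => q _; rewrite /G mulrA.
rewrite (perm_big _ P) big_allpairs_dep; apply: eq_bigr => p _.
by rewrite big_distrl.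
Qed.

Fact ps1M : left_id ps1 psM.
Proof.
move=> f; apply/pseriesP => m /=.
rewrite (big_rem (1%M, m)) /=; last by rewrite in_decs mul1m.
rewrite eqxx mul1r big_seq big1 ?addr0 // => -[a b].
rewrite mem_rem_uniq ?fset_uniq // inE in_decs /= => /andP[nab /eqP Em].
have [a1|] := eqVneq a 1%M; last by rewrite mul0r.
by move: nab; rewrite -Em a1 mul1m eqxx.
Qed.

Fact psMDl : left_distributive psM psD.
Proof.
move=> f g h; apply/pseriesP => m /=; rewrite -big_split.
by apply: eq_bigr => p _; rewrite mulrDl.
Qed.

Fact ps1_neq0 : ps1 != ps0.
Proof. by apply/eqP => /pseriesP/(_ 1%M)/eqP; rewrite /= eqxx oner_eq0. Qed.

HB.instance Definition _ :=
  GRing.Zmodule_isComNzRing.Build pseries psMA psMC ps1M psMDl ps1_neq0.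

Lemma pscoefD f g m : (f + g) m = f m + g m. Proof. by []. Qed.
Lemma pscoefN f m : (- f) m = - f m. Proof. by []. Qed.
Lemma pscoefM f g m : (f * g) m = \sum_(p <- decs m) f p.1 * g p.2.
Proof. by []. Qed.

Definition psX (i : I) := mk_pseries (degwise_finite1 (ucm i)).

(* F(f, g) for the bivariate power series F = sum_ij c i j x^i y^j. When f and
   g have no constant term, which is the only case where this is used, f^i g^j
   has no term of degree < i + j, so the truncated sums below are exact. *)
Fact subst2_subproof (c : nat -> nat -> R) f g :
  degwise_finite (fun m => \sum_(i < (mdeg m).+1) \sum_(j < (mdeg m).+1)
                             c i j * (f ^+ i * g ^+ j) m).
Proof.
move=> d; pose S i j := [set m | mdeg m = d /\ (f ^+ i * g ^+ j) m != 0]%classic.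
have FS : finite_set (\bigcup_(i in `I_d.+1) \bigcup_(j in `I_d.+1) S i j)%classic.
  apply: bigcup_finite => [|i _]; first exact: finite_II.
  by apply: bigcup_finite => [|j _]; [exact: finite_II | exact: pscoefP].
apply: sub_finite_set FS => m [dm nz]; rewrite dm in nz.
apply: contrapT => N; move/eqP: nz; apply.
rewrite big1 // => i _; rewrite big1 // => j _.
suff -> : (f ^+ i * g ^+ j) m = 0 by rewrite mulr0.
have [//|nz] := eqVneq ((f ^+ i * g ^+ j) m) 0; case: N.
by exists i; [exact: ltn_ord | exists j; [exact: ltn_ord | split]].
Qed.
Definition subst2 c f g := mk_pseries (@subst2_subproof c f g).

Lemma subst2E c f g m :
  subst2 c f g m = \sum_(i < (mdeg m).+1) \sum_(j < (mdeg m).+1)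
                     c i j * (f ^+ i * g ^+ j) m.
Proof. by []. Qed.

End PowerSeries.

Arguments psX R {I} i.

(* One-dimensional commutative formal group laws
   F(x, y) = sum_ij fgl_coef i j x^i y^j. *)
Record fgl (R : comNzRingType) := FGL {
  fgl_coef :> nat -> nat -> R;
  fgl_unit : forall i, fgl_coef i 0 = (i == 1)%:R;
  fgl_comm : forall i j, fgl_coef i j = fgl_coef j i;
  fgl_assoc : let x k := psX R (inord k : 'I_3) in
    subst2 fgl_coef (x 0) (subst2 fgl_coef (x 1) (x 2)) =
    subst2 fgl_coef (subst2 fgl_coef (x 0) (x 1)) (x 2) }.

(* fga is R[[M]]_F: the quotient of the completion by the closure of the ideal
   generated by x_0 and the x_(a + b) - F(x_a, x_b). *)
Section FormalGroupAlgebra.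
Variables (R : comNzRingType) (F : fgl R) (M : zmodType).
Notation P := (pseries R M).
Implicit Types (f g r : P) (m : {cmonom M}) (a b : M).

Definition fga_relator r :=
  r = psX R 0 \/ exists a b, r = psX R (a + b) - subst2 F (psX R a) (psX R b).

Inductive fga_ideal0 : P -> Prop :=
| fga_ideal0_0 : fga_ideal0 0
| fga_ideal0_D f r g : fga_relator r -> fga_ideal0 g -> fga_ideal0 (f * r + g).

(* Closure for the topology of the completion: two series are d-close when they
   agree on the monomials of degree < d. *)
Definition fga_ideal : {pred P} := fun f =>
  `[< forall d, exists2 g, fga_ideal0 g &
        forall m, (mdeg m < d)%N -> f m = g m >].

Lemma fga_idealP f : reflect
  (forall d, exists2 g, fga_ideal0 g & forall m, (mdeg m < d)%N -> f m = g m)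
  (f \in fga_ideal).
Proof. exact: asboolP. Qed.

Lemma fga_ideal0_add f g : fga_ideal0 f -> fga_ideal0 g -> fga_ideal0 (f + g).
Proof.
by elim=> [|a r h Hr _ IH] Hg; [rewrite add0r | rewrite -addrA; constructor; auto].
Qed.

Lemma fga_ideal0_mull h f : fga_ideal0 f -> fga_ideal0 (h * f).
Proof.
elim=> [|b r g Hr _ IH]; first by rewrite mulr0; constructor.
by rewrite mulrDr mulrA; constructor.
Qed.

Lemma fga_relator_cst r : fga_relator r -> r 1%M = 0.
Proof.
have X1 a : psX R a 1%M = 0 by rewrite /= eq_sym cm1_eq1.
case=> [->|[a [b ->]]]; first exact: X1.
rewrite pscoefD pscoefN X1 /= mdeg1 !big_ord1 fgl_unit mul0r oppr0 addr0 //.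
Qed.

Lemma pscoefM1 f g : (f * g) 1%M = f 1%M * g 1%M.
Proof.
rewrite pscoefM (big_rem (1%M, 1%M)) /=; last by rewrite in_decs mul1m.
rewrite big_seq big1 ?addr0 // => -[a b].
rewrite mem_rem_uniq ?fset_uniq // inE in_decs /= => /andP[nab].
by move=> /eqP/unitm[a1 b1]; move: nab; rewrite a1 b1 eqxx.
Qed.

Lemma fga_ideal0_cst f : fga_ideal0 f -> f 1%M = 0.
Proof.
elim=> [|a r h /fga_relator_cst r0 _ h0] //.
by rewrite pscoefD pscoefM1 r0 mulr0 h0 addr0.
Qed.

Fact fga_ideal_closed : idealr_closed fga_ideal.
Proof.
split.
- by apply/fga_idealP => d; exists 0 => //; constructor.
- apply/fga_idealP => /(_ 1)[g /fga_ideal0_cst g0 /(_ 1%M)].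
  by rewrite mdeg1 g0 /= eqxx => /(_ isT)/eqP; rewrite oner_eq0.
- move=> a f g /fga_idealP Hf /fga_idealP Hg; apply/fga_idealP => d.
  have [f' If' ff'] := Hf d; have [g' Ig' gg'] := Hg d.
  exists (a * f' + g'); first by apply/fga_ideal0_add/Ig'/fga_ideal0_mull.
  move=> m lt; rewrite !pscoefD gg' // !pscoefM; congr (_ + _).
  rewrite !big_seq; apply: eq_bigr => p; rewrite in_decs => /eqP Em.
  by rewrite ff' // (leq_ltn_trans _ lt) // -Em mdegM leq_addl.
Qed.

HB.instance Definition _ := isIdealr.Build P fga_ideal fga_ideal_closed.

Definition fga := {ideal_quot fga_ideal}.
HB.instance Definition _ := GRing.ComNzRing.on fga.
HB.instance Definition _ := EqQuotient.on fga.

Definition fga_x a : fga := \pi_fga%qT (psX R a).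

Lemma fga_piE f g : (\pi_fga%qT f = \pi_fga%qT g) <-> (f - g \in fga_ideal).
Proof. by rewrite Quotient.idealrBE; split=> [/eqP|/eqP]. Qed.

End FormalGroupAlgebra.

Record zmod_aut (M : zmodType) := ZmodAut {
  aut_fun :> M -> M;
  aut_inv : M -> M;
  aut_funK : cancel aut_fun aut_inv;
  aut_invK : cancel aut_inv aut_fun;
  aut_funD : {morph aut_fun : a b / a + b} }.

(* The action of an automorphism w of M on R[[M]]_F by x_a |-> x_(w a). *)
Section Action.
Variables (R : comNzRingType) (F : fgl R) (M : zmodType) (w : zmod_aut M).
Notation P := (pseries R M).
Implicit Types (f g : P) (m : {cmonom M}).

(* The coefficient of w(f) at m is the coefficient of f at m o w: the exponent
   of x_a in w^-1(m) is that of x_(w a) in m. *)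
Definition cm_act m : {cmonom M} :=
  [cmonom m (w i) | i in [fset aut_inv w j | j in finsupp m]%fset]%M.

Lemma cm_actE m i : cm_act m i = m (w i).
Proof.
rewrite cmE fsfun_fun; case: ifP => // /negbT N.
apply/esym/eqP; rewrite cmE_eq0; apply: contra N => wi.
by apply/imfsetP; exists (w i); rewrite // aut_funK.
Qed.

Lemma cm_actM m1 m2 : cm_act (m1 * m2)%M = (cm_act m1 * cm_act m2)%M.
Proof. by apply/eqP/cmP => i; rewrite !(cm_actE, cmM). Qed.

Lemma cm_act_inj : injective cm_act.
Proof.
move=> m1 m2 E; apply/eqP/cmP => i.
by rewrite -(aut_invK w i) -!cm_actE E.
Qed.

Lemma mdeg_act m : mdeg (cm_act m) = mdeg m.
Proof.
rewrite (@mdegEw _ _ [fset aut_inv w j | j in finsupp m]%fset); last first.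
  apply/fsubsetP => i; rewrite -cmE_neq0 cm_actE cmE_neq0 => wi.
  by apply/imfsetP; exists (w i); rewrite // aut_funK.
rewrite big_imfset /=; last by move=> i j _ _; apply: (can_inj (aut_invK w)).
by apply: eq_bigr => i _; rewrite cm_actE aut_invK.
Qed.

Fact ps_act_subproof f : degwise_finite (fun m => f (cm_act m)).
Proof.
move=> d; have := pscoefP f d.
move=> /(finite_preimage (f := cm_act)) H.
apply: sub_finite_set (H _) => [m /=|]; first by rewrite mdeg_act.
by move=> x y _ _; apply: cm_act_inj.
Qed.
Definition ps_act f := mk_pseries (@ps_act_subproof f).

Definition cm_inv m : {cmonom M} :=
  [cmonom m (aut_inv w i) | i in [fset w j | j in finsupp m]%fset]%M.

Lemma cm_invK m : cm_act (cm_inv m) = m.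
Proof.
apply/eqP/cmP => i; rewrite cm_actE cmE fsfun_fun aut_funK; case: ifP => //.
move/negbT => N; apply/esym/eqP; rewrite cmE_eq0; apply: contra N => mi.
by apply/imfsetP; exists i.
Qed.

Lemma ps_act_zmod : zmod_morphism ps_act.
Proof. by move=> f g; apply/pseriesP => m. Qed.

Lemma ps_act_monoid : monoid_morphism ps_act.
Proof.
split=> [|f g]; apply/pseriesP => m.
  have E : (cm_act m == 1%M) = (m == 1%M) by rewrite -!mdeg_eq0 mdeg_act.
  by rewrite /= E.
rewrite pscoefM [LHS]/= /=.
pose a2 (p : {cmonom M} * {cmonom M}) := (cm_act p.1, cm_act p.2).
have P2 : perm_eq (decs (cm_act m)) (map a2 (decs m)).
  apply: uniq_perm; rewrite ?map_inj_uniq ?fset_uniq //.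
    by move=> [a b] [a' b'] [/cm_act_inj -> /cm_act_inj ->].
  move=> [a b]; apply/idP/mapP => [|[[c e] ce [-> ->]]]; last first.
    by move: ce; rewrite !in_decs /= -cm_actM => /eqP ->.
  rewrite in_decs /= => /eqP E; exists (cm_inv a, cm_inv b); last first.
    by rewrite /a2 /= !cm_invK.
  by rewrite in_decs /=; apply/eqP/cm_act_inj; rewrite cm_actM !cm_invK.
by rewrite (perm_big _ P2) big_map.
Qed.

HB.instance Definition _ := GRing.isZmodMorphism.Build P P ps_act ps_act_zmod.
HB.instance Definition _ := GRing.isMonoidMorphism.Build P P ps_act ps_act_monoid.

Lemma ps_actX a : ps_act (psX R a) = psX R (w a).
Proof.
apply/pseriesP => m /=; congr (_%:R); congr nat_of_bool.
apply/eqP/eqP => [E|->]; apply/eqP/cmP => i.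
  have := congr1 (fun m : {cmonom M} => m (aut_inv w i)) E.
  rewrite cm_actE aut_invK !ucmE => ->; congr nat_of_bool.
  by apply/eqP/eqP => [->|<-]; rewrite ?aut_invK ?aut_funK.
by rewrite cm_actE !ucmE (inj_eq (can_inj (aut_funK w))).
Qed.

Lemma ps_act_subst2 (c : nat -> nat -> R) f g :
  ps_act (subst2 c f g) = subst2 c (ps_act f) (ps_act g).
Proof.
have E i j : ps_act f ^+ i * ps_act g ^+ j = ps_act (f ^+ i * g ^+ j).
  by rewrite rmorphM !rmorphXn.
apply/pseriesP => m; rewrite subst2E [LHS](subst2E c f g (cm_act m)) mdeg_act.
by apply: eq_bigr => i _; apply: eq_bigr => j _; rewrite E.
Qed.

Lemma fga_ideal_act f : f \in @fga_ideal R F M -> ps_act f \in @fga_ideal R F M.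
Proof.
have w0 : w 0 = 0 by apply: (addIr (w 0)); rewrite -aut_funD !add0r.
have relA r : fga_relator F r -> fga_relator F (ps_act r).
  case=> [->|[a [b ->]]]; first by left; rewrite ps_actX w0.
  right; exists (w a), (w b).
  by rewrite raddfB /= ps_act_subst2 !ps_actX aut_funD.
have idA g : fga_ideal0 F g -> fga_ideal0 F (ps_act g).
  elim=> [|h r g' Hr _ IH]; first by rewrite raddf0; constructor.
  by rewrite rmorphD rmorphM; constructor; auto.
move/fga_idealP => H; apply/fga_idealP => d; have [g Ig fg] := H d.
by exists (ps_act g); [apply: idA | move=> m lt; apply: fg; rewrite mdeg_act].
Qed.

Definition fga_act (s : fga F M) : fga F M := \pi_(fga F M)%qT (ps_act (repr s)).

Lemma fga_act_pi f :
  fga_act (\pi_(fga F M)%qT f) = \pi_(fga F M)%qT (ps_act f).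
Proof.
apply/fga_piE; rewrite -raddfB; apply/fga_ideal_act/fga_piE.
by rewrite reprK.
Qed.

Lemma fga_actX a : fga_act (fga_x F a) = fga_x F (w a).
Proof. by rewrite fga_act_pi ps_actX. Qed.

Lemma fga_act_zmod : zmod_morphism fga_act.
Proof.
move=> s t; rewrite -[s]reprK -[t]reprK -raddfB !fga_act_pi.
by rewrite -(raddfB \pi_(fga F M)%qT) -(raddfB ps_act).
Qed.

Lemma fga_act_monoid : monoid_morphism fga_act.
Proof.
split=> [|s t].
  by rewrite -(rmorph1 \pi_(fga F M)%qT) fga_act_pi (rmorph1 ps_act).
rewrite -[s]reprK -[t]reprK -rmorphM !fga_act_pi.
by rewrite -(rmorphM \pi_(fga F M)%qT) -(rmorphM ps_act).
Qed.

HB.instance Definition _ :=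
  GRing.isZmodMorphism.Build (fga F M) (fga F M) fga_act fga_act_zmod.
HB.instance Definition _ :=
  GRing.isMonoidMorphism.Build (fga F M) (fga F M) fga_act fga_act_monoid.

End Action.

(* The localization S[1/x | x in X]: fractions whose denominators are finite
   products of elements of X. *)
Section Localization.
Variables (S : comNzRingType) (X : set S).

Definition denom : {pred S} := fun s =>
  `[< exists2 l : seq S, (forall x, x \in l -> X x) & s = \prod_(x <- l) x >].

Lemma denom1 : 1 \in denom.
Proof. by apply/asboolP; exists [::]; rewrite ?big_nil. Qed.

Lemma denomM s t : s \in denom -> t \in denom -> s * t \in denom.
Proof.
move=> /asboolP[l Hl ->] /asboolP[k Hk ->]; apply/asboolP; exists (l ++ k).
  by move=> x; rewrite mem_cat => /orP[/Hl|/Hk].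
by rewrite big_cat.
Qed.

Record frac := Frac { fnum : S; fden : S; fdenP : fden \in denom }.

HB.instance Definition _ := gen_eqMixin frac.
HB.instance Definition _ := gen_choiceMixin frac.

Definition frac_eqv (p q : frac) :=
  `[< exists2 u, u \in denom & u * (fnum p * fden q) = u * (fnum q * fden p) >].

Lemma frac_eqv_equiv : equiv_class_of frac_eqv.
Proof.
split=> [p|p q|q p r].
- by apply/asboolP; exists 1; rewrite ?denom1.
- by apply/asboolP/asboolP => -[u Hu E]; exists u.
- move=> /asboolP[u Hu E] /asboolP[v Hv E']; apply/asboolP.
  exists (u * v * fden q); first by rewrite !denomM // fdenP.
  transitivity (v * fden r * (u * (fnum p * fden q))); first by ring.
  rewrite E; transitivity (u * fden p * (v * (fnum q * fden r))); first by ring.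
  by rewrite E'; ring.
Qed.
Canonical frac_eqv_rel := EquivRelPack frac_eqv_equiv.
Canonical frac_enc := defaultEncModRel frac_eqv.

Definition loc := {eq_quot frac_eqv}%qT.
HB.instance Definition _ := Choice.on loc.
HB.instance Definition _ := EqQuotient.on loc.

Definition mkloc (p : frac) : loc := \pi_loc%qT p.

Lemma mklocE p q : (mkloc p = mkloc q) <->
  (exists2 u, u \in denom & u * (fnum p * fden q) = u * (fnum q * fden p)).
Proof.
split=> [/eqquotP/asboolP //|H].
by apply/eqquotP/asboolP.
Qed.

Definition frac_of s := Frac s denom1.
Definition frac_add p q :=
  Frac (fnum p * fden q + fnum q * fden p) (denomM (fdenP p) (fdenP q)).
Definition frac_mul p q := Frac (fnum p * fnum q) (denomM (fdenP p) (fdenP q)).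
Definition frac_opp p := Frac (- fnum p) (fdenP p).

Definition loc_add (a b : loc) := mkloc (frac_add (repr a) (repr b)).
Definition loc_mul (a b : loc) := mkloc (frac_mul (repr a) (repr b)).
Definition loc_opp (a : loc) := mkloc (frac_opp (repr a)).

Lemma loc_ind (T : loc -> Prop) : (forall p, T (mkloc p)) -> forall a, T a.
Proof. by move=> H a; rewrite -[a]reprK; apply: H. Qed.

Lemma repr_mkloc p : exists2 u, u \in denom &
  u * (fnum (repr (mkloc p)) * fden p) = u * (fnum p * fden (repr (mkloc p))).
Proof. by apply/mklocE; rewrite /mkloc reprK. Qed.

Lemma loc_addE p q : loc_add (mkloc p) (mkloc q) = mkloc (frac_add p q).
Proof.
have [u Hu E] := repr_mkloc p; have [v Hv E'] := repr_mkloc q.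
rewrite /loc_add; move: (repr (mkloc p)) (repr (mkloc q)) E E' => p' q' E E'.
apply/mklocE; exists (u * v); first exact: denomM.
rewrite /=.
transitivity (v * fden q * fden q' * (u * (fnum p' * fden p))
   + u * fden p * fden p' * (v * (fnum q' * fden q))); first by ring.
by rewrite E E'; ring.
Qed.

Lemma loc_mulE p q : loc_mul (mkloc p) (mkloc q) = mkloc (frac_mul p q).
Proof.
have [u Hu E] := repr_mkloc p; have [v Hv E'] := repr_mkloc q.
rewrite /loc_mul; move: (repr (mkloc p)) (repr (mkloc q)) E E' => p' q' E E'.
apply/mklocE; exists (u * v); first exact: denomM.
rewrite /=.
transitivity ((u * (fnum p' * fden p)) * (v * (fnum q' * fden q))); first by ring.
by rewrite E E'; ring.
Qed.

Lemma loc_oppE p : loc_opp (mkloc p) = mkloc (frac_opp p).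
Proof.
have [u Hu E] := repr_mkloc p; rewrite /loc_opp.
move: (repr (mkloc p)) E => p' E; apply/mklocE; exists u => //=.
by rewrite !mulNr !mulrN E.
Qed.

Lemma mkloc_eq p q : fnum p * fden q = fnum q * fden p -> mkloc p = mkloc q.
Proof. by move=> E; apply/mklocE; exists 1; rewrite ?denom1 ?E. Qed.

Fact loc_addA : associative loc_add.
Proof.
elim/loc_ind=> p; elim/loc_ind=> q; elim/loc_ind=> r.
by rewrite !loc_addE; apply: mkloc_eq => /=; ring.
Qed.
Fact loc_addC : commutative loc_add.
Proof.
elim/loc_ind=> p; elim/loc_ind=> q.
by rewrite !loc_addE; apply: mkloc_eq => /=; ring.
Qed.
Fact loc_add0 : left_id (mkloc (frac_of 0)) loc_add.
Proof. by elim/loc_ind=> p; rewrite loc_addE; apply: mkloc_eq => /=; ring. Qed.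
Fact loc_addN : left_inverse (mkloc (frac_of 0)) loc_opp loc_add.
Proof.
elim/loc_ind=> p; rewrite loc_oppE loc_addE.
by apply: mkloc_eq => /=; ring.
Qed.

HB.instance Definition _ :=
  GRing.isZmodule.Build loc loc_addA loc_addC loc_add0 loc_addN.

Fact loc_mulA : associative loc_mul.
Proof.
elim/loc_ind=> p; elim/loc_ind=> q; elim/loc_ind=> r.
by rewrite !loc_mulE; apply: mkloc_eq => /=; ring.
Qed.
Fact loc_mulC : commutative loc_mul.
Proof.
elim/loc_ind=> p; elim/loc_ind=> q.
by rewrite !loc_mulE; apply: mkloc_eq => /=; ring.
Qed.
Fact loc_mul1 : left_id (mkloc (frac_of 1)) loc_mul.
Proof. by elim/loc_ind=> p; rewrite loc_mulE; apply: mkloc_eq => /=; ring. Qed.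
Fact loc_mulD : left_distributive loc_mul loc_add.
Proof.
elim/loc_ind=> p; elim/loc_ind=> q; elim/loc_ind=> r.
by rewrite !(loc_addE, loc_mulE); apply: mkloc_eq => /=; ring.
Qed.

(* pz: 0 is not excluded from the denominators, so 0 = 1 is possible *)
HB.instance Definition _ :=
  GRing.Zmodule_isComPzRing.Build loc loc_mulA loc_mulC loc_mul1 loc_mulD.

Definition to_loc s : loc := mkloc (frac_of s).

Lemma to_loc_zmod : zmod_morphism to_loc.
Proof.
move=> s t.
have -> : to_loc s - to_loc t =
  loc_add (mkloc (frac_of s)) (loc_opp (mkloc (frac_of t))) by [].
rewrite loc_oppE loc_addE.
by apply: mkloc_eq => /=; ring.
Qed.

Lemma to_loc_monoid : monoid_morphism to_loc.
Proof.
split=> [//|s t].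
have -> : to_loc s * to_loc t = loc_mul (mkloc (frac_of s)) (mkloc (frac_of t)).
  by [].
by rewrite loc_mulE; apply: mkloc_eq => /=; ring.
Qed.

HB.instance Definition _ := GRing.isZmodMorphism.Build S loc to_loc to_loc_zmod.
HB.instance Definition _ :=
  GRing.isMonoidMorphism.Build S loc to_loc to_loc_monoid.

End Localization.

(* The inverse of q if it has one, and 0 otherwise. *)
Definition pz_inv (Q : comPzRingType) (q : Q) : Q := xget 0 [set r | q * r = 1]%classic.

Record cartan_matrix (n : nat) := CartanMatrix {
  gcm_mx :> 'M[int]_n;
  gcm_diag : forall i, gcm_mx i i = 2;
  gcm_off : forall i j, i != j -> gcm_mx i j <= 0;
  gcm_zero : forall i j, gcm_mx i j = 0 <-> gcm_mx j i = 0 }.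

(* The complex numbers are K[i], where K is the field of real numbers. *)
Record root_datum (K : realType) (n : nat) (A : cartan_matrix n) := RootDatum {
  rd_h : vectType K[i];
  simple_root : 'I_n -> 'Hom(rd_h, K[i]^o);
  simple_coroot : 'I_n -> rd_h;
  rd_dim : (\dim {:rd_h} =
    2 * n - \rank (map_mx (fun z : int => z%:~R) A : 'M[K[i]]_n))%N;
  simple_root_free : free [seq simple_root i | i : 'I_n];
  simple_coroot_free : free [seq simple_coroot i | i : 'I_n];
  rd_pairing : forall i j, simple_root j (simple_coroot i) = (A i j)%:~R }.

Section WeylGroup.
Variables (K : realType) (n : nat) (A : cartan_matrix n) (D : root_datum K A).

Definition hdual := 'Hom(rd_h D, K[i]^o).
HB.instance Definition _ := Vector.on hdual.
Implicit Types (i : 'I_n) (l : hdual).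

Definition sreflect_fun i l : hdual :=
  l - l (simple_coroot D i) *: (simple_root D i : hdual).

Fact sreflect_linear i : linear (sreflect_fun i).
Proof.
move=> c l k; rewrite /sreflect_fun add_lfunE scale_lfunE.
by rewrite scalerDl -scalerA scalerBr opprD addrACA.
Qed.
HB.instance Definition _ i :=
  GRing.isLinear.Build K[i] hdual hdual *:%R (sreflect_fun i) (sreflect_linear i).

Definition sreflect i : 'End(hdual) := linfun (sreflect_fun i).

Lemma sreflectE i l :
  sreflect i l = l - l (simple_coroot D i) *: (simple_root D i : hdual).
Proof. by rewrite lfunE. Qed.

Lemma sreflectK i : (sreflect i \o sreflect i)%VF = \1%VF.
Proof.
apply/lfunP => l; rewrite comp_lfunE id_lfunE !sreflectE.
rewrite add_lfunE opp_lfunE scale_lfunE rd_pairing gcm_diag.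
set c := l _; set r : hdual := simple_root D i.
have -> : c - c *: (2%:~R : K[i]^o) = - c :> K[i]^o.
  by rewrite /GRing.scale /= rmorph_nat mulr_natr mulr2n opprD addrA subrr sub0r.
by rewrite scaleNr opprK subrK.
Qed.

(* s_(i_1) ... s_(i_l) *)
Definition word_end (s : seq 'I_n) : 'End(hdual) :=
  foldr (fun i f => (sreflect i \o f)%VF) \1%VF s.

Lemma word_end_cat s t : word_end (s ++ t) = (word_end s \o word_end t)%VF.
Proof.
elim: s => [|i s IH] /=; first by rewrite comp_lfun1l.
by rewrite IH comp_lfunA.
Qed.

Lemma word_end_rev s : (word_end (rev s) \o word_end s)%VF = \1%VF.
Proof.
elim: s => [|i s IH]; first by rewrite comp_lfun1l.
rewrite rev_cons -cats1 word_end_cat /= comp_lfun1r comp_lfunA.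
by rewrite -(comp_lfunA _ (sreflect i) (sreflect i)) sreflectK comp_lfun1r.
Qed.

Record weyl := Weyl {
  weyl_end : 'End(hdual);
  weyl_gen : `[< exists s, weyl_end = word_end s >] }.

HB.instance Definition _ := [isSub for weyl_end].
HB.instance Definition _ := [Choice of weyl by <:].

Definition weyl_fun (w : weyl) (l : hdual) : hdual := weyl_end w l.

Definition word s : weyl := Weyl (asboolT (ex_intro _ s (erefl (word_end s)))).

Lemma weylP (w : weyl) : exists s, w = word s.
Proof.
have [s Es] := asboolP _ (weyl_gen w).
by exists s; apply: val_inj.
Qed.

Fact weyl_mul_subproof (u v : weyl) :
  `[< exists s, (weyl_end u \o weyl_end v)%VF = word_end s >].
Proof.
have [s ->] := weylP u; have [t ->] := weylP v; apply/asboolP.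
by exists (s ++ t); rewrite word_end_cat.
Qed.
Definition weyl_mul u v := Weyl (weyl_mul_subproof u v).

Lemma weyl_word_rev (w : weyl) s : w = word s ->
  (word_end (rev s) = (weyl_end w)^-1)%VF.
Proof.
move=> ->; have Hs := word_end_rev s; have Hr := word_end_rev (rev s).
rewrite revK in Hr.
have k0 : lker (word_end s) == 0%VS.
  apply/lker0P => x y E; move/lfunP: Hs => Hs.
  by have := Hs x; rewrite comp_lfunE E -comp_lfunE Hs !id_lfunE.
by rewrite /= -[LHS]comp_lfun1r -(lker0_compfV k0) comp_lfunA Hs comp_lfun1l.
Qed.

Fact weyl_inv_subproof (w : weyl) :
  `[< exists s, ((weyl_end w)^-1)%VF = word_end s >].
Proof.
have [s Es] := weylP w; apply/asboolP; exists (rev s).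
by rewrite (weyl_word_rev Es).
Qed.
Definition weyl_inv w := Weyl (weyl_inv_subproof w).

Fact weyl_mulA : associative weyl_mul.
Proof. by move=> u v w; apply: val_inj; rewrite /= comp_lfunA. Qed.
Fact weyl_mul1 : left_id (word [::]) weyl_mul.
Proof. by move=> u; apply: val_inj; rewrite /= comp_lfun1l. Qed.
Fact weyl_mul1r : right_id (word [::]) weyl_mul.
Proof. by move=> u; apply: val_inj; rewrite /= comp_lfun1r. Qed.
Fact weyl_mulV : left_inverse (word [::]) weyl_inv weyl_mul.
Proof.
move=> w; apply: val_inj; have [s Es] := weylP w.
by rewrite /= -(weyl_word_rev Es) Es word_end_rev.
Qed.
Fact weyl_mulVr : right_inverse (word [::]) weyl_inv weyl_mul.
Proof.
move=> w; apply: val_inj; have [s Es] := weylP w.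
by rewrite /= -(weyl_word_rev Es) Es -{1}(revK s) word_end_rev.
Qed.

HB.instance Definition _ := isGroup.Build weyl
  weyl_mulA weyl_mul1 weyl_mul1r weyl_mulV weyl_mulVr.

Implicit Types (u v w t : weyl).

Lemma weyl_funM u v l : weyl_fun (u * v)%g l = weyl_fun u (weyl_fun v l).
Proof. by rewrite /weyl_fun /= comp_lfunE. Qed.
Lemma weyl_fun1 l : weyl_fun 1%g l = l.
Proof. by rewrite /weyl_fun /= id_lfunE. Qed.

Lemma has_length w : exists k, `[< exists2 s, size s = k & w = word s >].
Proof. by have [s ->] := weylP w; exists (size s); apply/asboolP; exists s. Qed.

Definition wlength w : nat := ex_minn (has_length w).

Definition reduced_seq (s : seq 'I_n) w := w = word s /\ size s = wlength w.

Definition sgen i : weyl := word [:: i].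

Definition is_reflection t := exists w i, t = (w * sgen i * w^-1)%g.

Inductive bruhat u : weyl -> Prop :=
| bruhat_refl : bruhat u u
| bruhat_step v t : bruhat u v -> is_reflection t ->
    (wlength v < wlength (v * t)%g)%N -> bruhat u (v * t)%g.

End WeylGroup.

Definition is_Zbasis (V : zmodType) (L : {pred V}) (r : nat) (e : 'I_r -> V) :=
  (forall j, e j \in L) /\
  (forall l, l \in L -> exists! c : {ffun 'I_r -> int}, l = \sum_j e j *~ c j).

Record demazure_lattice (K : realType) n (A : cartan_matrix n) (D : root_datum K A) :=
  DemazureLattice {
    dl_set : zmodClosed (hdual D);
    dl_free : exists r (e : 'I_r -> hdual D), is_Zbasis dl_set e;
    dl_root : forall i, (simple_root D i : hdual D) \in dl_set;
    dl_int : forall l : hdual D, l \in dl_set -> forall i,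
      exists z : int, l (simple_coroot D i) = z%:~R;
    dl_ext : forall i, exists r (e : 'I_r -> hdual D),
      is_Zbasis dl_set e /\ exists j, e j = simple_root D i }.

Section Lattice.
Variables (K : realType) (n : nat) (A : cartan_matrix n) (D : root_datum K A).
Variable L : demazure_lattice D.
Notation W := (weyl D).

Record lattice := Lattice { lat_val : hdual D; latP : lat_val \in dl_set L }.

HB.instance Definition _ := [isSub for lat_val].
HB.instance Definition _ := [Choice of lattice by <:].
HB.instance Definition _ := [SubChoice_isSubZmodule of lattice by <:].

Lemma lattice_stable (w : W) (l : hdual D) : 
  l \in dl_set L -> weyl_fun w l \in dl_set L.
Proof.
have [s ->] := weylP w; elim: s l => [|i s IH] l Ll.
  by rewrite weyl_fun1.
rewrite (_ : word D (i :: s) = sgen D i * word D s)%g; last first.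
  by apply: val_inj => /=; rewrite comp_lfun1r.
have Hs := IH _ Ll; rewrite weyl_funM; move: (weyl_fun (word D s) l) Hs => k Hk.
rewrite /weyl_fun /= comp_lfun1r sreflectE.
have [z ->] := dl_int Hk i.
by rewrite rpredB // scaler_int rpredMz // dl_root.
Qed.

Definition lat_act (w : W) (a : lattice) : lattice :=
  Lattice (lattice_stable w (latP a)).

Fact lat_actK w : cancel (lat_act w) (lat_act (w^-1)%g).
Proof.
by move=> a; apply: val_inj; rewrite /= -weyl_funM mulVg weyl_fun1.
Qed.
Fact lat_actVK w : cancel (lat_act (w^-1)%g) (lat_act w).
Proof.
by move=> a; apply: val_inj; rewrite /= -weyl_funM mulgV weyl_fun1.
Qed.
Fact lat_actD w : {morph lat_act w : a b / a + b}.
Proof. by move=> a b; apply: val_inj; exact: (linearD (weyl_end w)). Qed.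

Definition lat_aut w := ZmodAut (lat_actK w) (lat_actVK w) (lat_actD w).

Definition aroot i : lattice := Lattice (dl_root L i).

Definition is_root (a : lattice) := exists w i, a = lat_act w (aroot i).

Definition positive (a : lattice) :=
  exists c : 'I_n -> nat, a = \sum_i aroot i *+ c i.

(* t = s_a *)
Definition root_reflection (a : lattice) (t : W) :=
  exists w i, a = lat_act w (aroot i) /\ t = (w * sgen D i * w^-1)%g.

End Lattice.

Section DemazureAlgebra.
Variables (K : realType) (n : nat) (A : cartan_matrix n) (D : root_datum K A).
Variables (L : demazure_lattice D) (R : comNzRingType) (F : fgl R).
Notation W := (weyl D).

Definition dS := fga F (lattice L).
HB.instance Definition _ := GRing.ComNzRing.on dS.

Definition dx (a : lattice L) : dS := fga_x F a.

Definition dQ := loc [set s : dS | exists a, is_root a /\ positive a /\ s = dx a]%classic.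
HB.instance Definition _ := GRing.ComPzRing.on dQ.

Definition inQ (s : dS) : dQ := to_loc _ s.

Definition act_S (w : W) (s : dS) : dS := fga_act (lat_aut L w) s.

(* The action of w on fractions. It makes sense since w(m) is invertible in Q
   for every denominator m: w maps a root a to plus or minus a positive root,
   and x_(-a) is the product of x_a and of a unit of S. *)
Definition act_Q (w : W) (q : dQ) : dQ :=
  inQ (act_S w (fnum (repr q))) * pz_inv (inQ (act_S w (fden (repr q)))).

Definition QW := {malg dQ[W]}.
HB.instance Definition _ := GRing.Zmodule.on QW.

Definition QW_scale (q : dQ) (f : QW) : QW := [malg w in msupp f => q * f@_w].

Lemma QW_scaleE q f w : (QW_scale q f)@_w = q * f@_w.
Proof. by rewrite mcoeffE; case: msuppP; rewrite ?mulr0. Qed.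

Fact QW_scaleA q r f : QW_scale q (QW_scale r f) = QW_scale (q * r) f.
Proof. by apply/malgP => w; rewrite !QW_scaleE mulrA. Qed.
Fact QW_scale1 : left_id 1 QW_scale.
Proof. by move=> f; apply/malgP => w; rewrite QW_scaleE mul1r. Qed.
Fact QW_scaleDr : right_distributive QW_scale +%R.
Proof.
by move=> q f g; apply/malgP => w; rewrite !(QW_scaleE, mcoeffD) mulrDr.
Qed.
Fact QW_scaleDl f : {morph QW_scale^~ f : q r / q + r}.
Proof.
by move=> q r; apply/malgP => w; rewrite !(QW_scaleE, mcoeffD) mulrDl.
Qed.
HB.instance Definition _ := GRing.Zmodule_isLmodule.Build dQ QW
  QW_scaleA QW_scale1 QW_scaleDr QW_scaleDl.

Definition delta (w : W) : QW := mkmalgU w 1.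

Definition QW_mul (f g : QW) : QW :=
  \sum_(v <- msupp f) \sum_(w <- msupp g)
    (f@_v * act_Q v g@_w) *: delta (v * w)%g.

Definition Xel (a : lattice L) (t : W) : QW :=
  pz_inv (inQ (dx a)) *: (delta 1%g - delta t).

Definition Yel (i : 'I_n) : QW :=
  pz_inv (inQ (dx (- aroot L i))) *: delta 1%g +
  pz_inv (inQ (dx (aroot L i))) *: delta (sgen D i).

Definition Yword (s : seq 'I_n) : QW :=
  foldr (fun i f => QW_mul (Yel i) f) (delta 1%g) s.

(* S contains the image of R, so that the R-subalgebra generated by S and the
   X_a is the closure of these under sums and products. *)
Inductive DF : QW -> Prop :=
| DF_S s : DF (inQ s *: delta 1%g)
| DF_X a t : root_reflection a t -> DF (Xel a t)
| DF_add f g : DF f -> DF g -> DF (f + g)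
| DF_mul f g : DF f -> DF g -> DF (QW_mul f g).

Local Notation QWdual := {linear QW -> dQ^o}.

Definition in_DFdual (f : QWdual) := forall g, DF g -> exists s, f g = inQ s.

Definition dual_mul_fun (f g : QWdual) (q : QW) : dQ^o :=
  \sum_(w <- msupp q) q@_w * (f (delta w) * g (delta w)).

Lemma dual_mul_funE f g (d : {fset W}) q : (msupp q `<=` d)%fset ->
  dual_mul_fun f g q = \sum_(w <- d) q@_w * (f (delta w) * g (delta w)).
Proof.
move=> le; rewrite /dual_mul_fun [LHS](big_fset_incl _ le) // => w _.
by move=> /mcoeff_outdom ->; rewrite mul0r.
Qed.

Fact dual_mul_linear f g : linear (dual_mul_fun f g).
Proof.
move=> c p q; pose d := (msupp p `|` msupp q `|` msupp (c *: p + q)%R)%fset.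
rewrite (@dual_mul_funE _ _ d) ?fsubsetUr //.
rewrite (@dual_mul_funE _ _ d p); last by rewrite /d -fsetUA fsubsetUl.
rewrite (@dual_mul_funE _ _ d q); last first.
  by rewrite /d (fsetUC (msupp p)) -fsetUA fsubsetUl.
rewrite scaler_sumr -big_split; apply: eq_bigr => w _ /=.
by rewrite mcoeffD [(c *: p)@_w]QW_scaleE mulrDl -mulrA.
Qed.
HB.instance Definition _ f g :=
  GRing.isLinear.Build dQ QW dQ^o *:%R (dual_mul_fun f g) (dual_mul_linear f g).

Definition dual_mul (f g : QWdual) : QWdual := dual_mul_fun f g.

(* f = sum_(w in P) (c w) (phi w), a possibly infinite sum which is finite when
   evaluated at any element of Q_W *)
Definition formal_sum (f : QWdual) (P : set W) (c : W -> dS)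
    (phi : W -> QWdual) :=
  forall q : QW, finite_set [set w | P w /\ phi w q != 0]%classic /\
    f q = \sum_(w \in P) inQ (c w) * phi w q.

Section Bases.
Variable I : W -> seq 'I_n.

(* b^Y_(w, I_v): the coefficients of delta_w on the basis (Y_(I_v))_v of Q_W,
   the support of the expansion being contained in {v | v <= w} *)
Definition bY (w v : W) : dQ := (xget 0 [set c : QW |
  (forall v, c@_v != 0 -> bruhat v w) /\
  delta w = \sum_(v <- msupp c) c@_v *: Yword (I v)]%classic)@_v.

Definition is_Ystar (w : W) (f : QWdual) :=
  forall v, f (Yword (I v)) = (v == w)%:R.

(* Y^*_(I_w): the element of the basis dual to (Y_(I_v))_v *)
Definition Ystar (w : W) : QWdual :=
  if pselect (exists f, is_Ystar w f) is left H then projT1 (cid H) else \0.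

End Bases.
End DemazureAlgebra.

(* Main.v *)
(* Let M be the set of sums of q_w delta_w in Q_W such that, for every root a and
   every w, x_a q_w and q_w + q_(s_a w) lie in the localization of S at the prime
   ideal (x_a). It is stable under the X_a, so it contains D_F. If w has maximal
   length in the support of f in M, then q_w can only have poles, and simple ones, at
   the x_a with s_a w < w, that is, at the inversions of w: so q_w is an S-multiple of
   the leading coefficient of Y_(I_w). Hence M is spanned over S by the Y_(I_w), and
   the Y^*_(I_w) take values in S on it. So does a product of two such functionals f,
   g: f(delta_w) and f(delta_(s_a w)) are congruent modulo x_a, hence the sum of
   q_w f(delta_w) g(delta_w) is regular at every x_a. Then the coefficients of
   Y^*_(I_u) Y^*_(I_v) are its values at the Y_(I_w), and the recursion is its value at
   delta_w = sum_t b^Y_(w, I_t) Y_(I_t).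

   That (x_a) is prime, and contains x_b only for b = a or - a, follows from
   S = R[[y_1, ..., y_r]] with x_a = y_1 when a is part of a basis of the lattice. *)

Require Import Defs.
From HB Require Import structures.
From mathcomp Require Import all_boot all_order all_algebra all_fingroup.
From mathcomp Require Import generic_quotient ring_quotient.
From mathcomp Require Import finmap boolp classical_sets cardinality fsbigop.
From mathcomp Require Import reals complex.
From mathcomp Require Import monalg ring zify.

Set Implicit Arguments.
Unset Strict Implicit.
Unset Printing Implicit Defensive.

Import Order.TTheory GRing.Theory Num.Theory.
Local Open Scope ring_scope.
Local Notation "1" := (@mone _) : monom_scope.
Local Notation "x * y" := (mmul x y) : monom_scope.

Arguments pscoef : simpl never.

(** * Power series and substitution *)

(** Whether an element of [Q] lies in [S] is tested one root at a time: a denominator is a finite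
    product of factors [x_a], and each factor cancels as soon as the element is regular at [x_a]. So
    every condition is local at one root, even when [W] is infinite, and the inductions run over a
    bound for the lengths in a finite support. The opposite residues at [w] and [s_a w] are modelled
    on [X_a delta_w = (delta_w - delta_(s_a w)) / x_a]; the value of a functional at this same
    element gives the congruence modulo [x_a] of its values at [delta_w] and [delta_(s_a w)].
    Characteristic 0 enters through integers: 2 must stay outside [(x_a)], and the linear
    coefficients of [x_b], which are integers, must not vanish by accident. That [w s_i] is longer
    than [w] exactly when [w(a_i)] is positive is derived from the Cartan matrix. It reduces to two
    simple roots, where [a_ij a_ji < 4] yields a braid relation and [a_ij a_ji >= 4] yields
    positivity for all alternating words. *)

Section VanishingOrder.
Variables (R : comNzRingType) (I : choiceType).
Implicit Types (f g h : pseries R I) (m : {cmonom I}) (d : nat).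

(** This filtration is multiplicative and separated: identities between limits are proved up to
    order [d] for every [d]. *)
Definition ps_ge d f := forall m, (mdeg m < d)%N -> f m = 0.

Lemma ps_ge0 d : ps_ge d 0. Proof. by []. Qed.
Lemma ps_geD d f g : ps_ge d f -> ps_ge d g -> ps_ge d (f + g).
Proof. by move=> Hf Hg m lt; rewrite pscoefD Hf ?Hg ?addr0. Qed.
Lemma ps_geN d f : ps_ge d f -> ps_ge d (- f).
Proof. by move=> Hf m lt; rewrite pscoefN Hf ?oppr0. Qed.
Lemma ps_geB d f g : ps_ge d f -> ps_ge d g -> ps_ge d (f - g).
Proof. by move=> Hf /ps_geN; apply: ps_geD. Qed.
Lemma ps_ge_sum (T : Type) (r : seq T) (P : pred T) (E : T -> pseries R I) d :
  (forall i, P i -> ps_ge d (E i)) -> ps_ge d (\sum_(i <- r | P i) E i).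
Proof. by move=> H; apply: big_ind => // *; apply: ps_geD. Qed.
Lemma ps_geM d e f g : ps_ge d f -> ps_ge e g -> ps_ge (d + e) (f * g).
Proof.
move=> Hf Hg m lt; rewrite pscoefM big_seq big1 // => p; rewrite in_decs => /eqP Em.
have [lt1|ge1] := ltnP (mdeg p.1) d; first by rewrite Hf ?mul0r.
rewrite Hg ?mulr0 //; move: lt; rewrite -Em mdegM => lt.
by rewrite -(ltn_add2l d); apply: leq_ltn_trans lt; rewrite leq_add2r.
Qed.
Lemma ps_ge_le d e f : (d <= e)%N -> ps_ge e f -> ps_ge d f.
Proof. by move=> le H m lt; apply: H; apply: leq_trans le. Qed.
Lemma ps_ge_any f : ps_ge 0 f. Proof. by []. Qed.
Lemma ps_geMl d f g : ps_ge d f -> ps_ge d (g * f).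
Proof. by move=> H; rewrite -[d]add0n; apply: ps_geM. Qed.
Lemma ps_ge1P f : ps_ge 1 f <-> f 1%M = 0.
Proof.
split=> [H|H m]; first by apply: H; rewrite mdeg1.
by rewrite ltnS leqn0 mdeg_eq0 => /eqP ->.
Qed.
Lemma ps_geX f d : ps_ge 1 f -> ps_ge d (f ^+ d).
Proof.
move=> Hf; elim: d => [|d IH]; first exact: ps_ge_any.
by rewrite exprS -add1n; apply: ps_geM.
Qed.
Lemma ps_ge_eq f g : (forall d, ps_ge d (f - g)) -> f = g.
Proof.
move=> H; apply/pseriesP => m; apply/eqP; rewrite -subr_eq0.
by apply/eqP; apply: (H (mdeg m).+1).
Qed.
Lemma ps_geBP d f g : ps_ge d (f - g) <-> (forall m, (mdeg m < d)%N -> f m = g m).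
Proof.
split=> H m /H; rewrite pscoefD pscoefN; last by move->; rewrite subrr.
by move=> /eqP; rewrite subr_eq0 => /eqP.
Qed.

Lemma pscoef_sum (T : Type) (r : seq T) (P : pred T) (E : T -> pseries R I) m :
  (\sum_(i <- r | P i) E i) m = \sum_(i <- r | P i) E i m.
Proof. by elim/big_rec2: _ => // i x y _ <-. Qed.

Definition psmono m0 := mk_pseries (degwise_finite1 R m0).

Lemma psmonoE m0 m : psmono m0 m = (m == m0)%:R. Proof. by []. Qed.

Lemma psmonoM_mul a f m : (psmono a * f) (a * m)%M = f m.
Proof.
rewrite pscoefM (big_rem (a, m)) /=; last by rewrite in_decs.
rewrite psmonoE eqxx mul1r big_seq big1 ?addr0 // => -[c b].
rewrite mem_rem_uniq ?fset_uniq // inE in_decs /= => /andP[nab /eqP Em].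
rewrite psmonoE; have [a1|] := eqVneq c a; last by rewrite mul0r.
by move: nab; rewrite a1 in Em *; rewrite (mulcmI Em) eqxx.
Qed.

Lemma psmonoM_out a f m : (forall m', m <> (a * m')%M) -> (psmono a * f) m = 0.
Proof.
move=> N; rewrite pscoefM big_seq big1 // => -[c b]; rewrite in_decs /= => /eqP Em.
by rewrite psmonoE /=; have [a1|] := eqVneq c a; rewrite ?mul0r // -Em a1 in N *; case: (N b).
Qed.

Lemma psmonoM a b : psmono (a * b)%M = psmono a * psmono b.
Proof.
apply/pseriesP => m; have [[m' ->]|N] := pselect (exists m', m = (a * m')%M).
  rewrite psmonoM_mul !psmonoE; congr ((_ : bool)%:R).
  by apply/eqP/eqP => [/mulcmI|->].
rewrite psmonoM_out => [|m' E]; last by apply: N; exists m'.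
by rewrite psmonoE; case: eqP => // E; case: N; exists b.
Qed.

Fact psC_subproof (c : R) : degwise_finite (fun m => c * (m == 1%M :> {cmonom I})%:R).
Proof.
move=> d; apply: sub_finite_set (finite_set1 1%M) => m /= [_].
by case: (eqVneq m 1%M) => // _ /eqP; rewrite mulr0.
Qed.
Definition psC c := mk_pseries (psC_subproof c).

Lemma psCE c m : psC c m = c * (m == 1%M)%:R. Proof. by []. Qed.
Lemma psXE (i : I) m : psX R i m = (m == ucm i)%:R. Proof. by []. Qed.

Lemma pscoefCM c f m : (psC c * f) m = c * f m.
Proof.
rewrite -{2}[f]mul1r !pscoefM big_distrr; apply: eq_bigr => p _.
exact: (esym (mulrA _ _ _)).
Qed.

Fact psC_zmod : zmod_morphism psC.
Proof. by move=> a b; apply/pseriesP => m; rewrite pscoefD pscoefN !psCE mulrBl. Qed.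
Fact psC_monoid : monoid_morphism psC.
Proof.
split=> [|a b]; apply/pseriesP => m.
 exact: (etrans (psCE 1 m) (mul1r _)).
exact: (etrans (esym (mulrA a b _)) (esym (pscoefCM a (psC b) m))).
Qed.
HB.instance Definition _ := GRing.isZmodMorphism.Build R (pseries R I) psC psC_zmod.
HB.instance Definition _ := GRing.isMonoidMorphism.Build R (pseries R I) psC psC_monoid.

(* Series without constant term; they are the points of any formal group law. *)
Record maxps := MaxPs { maxval :> pseries R I; maxvalP : maxval 1%M == 0 }.
HB.instance Definition _ := [isSub for maxval].
HB.instance Definition _ := [Choice of maxps by <:].

Lemma maxps_ge (f : maxps) : ps_ge 1 f.
Proof. by apply/ps_ge1P/eqP/maxvalP. Qed.

Lemma psX_max (i : I) : psX R i 1%M == 0.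
Proof. by rewrite psXE (eq_sym _ (ucm i)) cm1_eq1. Qed.
Definition maxX (i : I) := MaxPs (psX_max i).

Lemma maxps_subst2 c (f g : maxps) : c 0%N 0%N = 0 -> subst2 c f g 1%M == 0.
Proof. by move=> c0; rewrite subst2E mdeg1 !big_ord1 c0 mul0r. Qed.

(** Terms with [i] or [j] beyond [mdeg m] have order above [mdeg m]. The truncation in [subst2],
    which varies with the monomial, can thus be replaced by one valid for all monomials of low
    degree. *)
Lemma subst2_bound c (f g : maxps) N m : (mdeg m < N)%N ->
  subst2 c f g m = \sum_(i < N) \sum_(j < N) c i j * (maxval f ^+ i * maxval g ^+ j) m.
Proof.
move=> lt; have Z i j : (mdeg m < i + j)%N -> (maxval f ^+ i * maxval g ^+ j) m = 0.
  exact: (ps_geM (ps_geX (maxps_ge f)) (ps_geX (maxps_ge g))).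
rewrite subst2E (big_ord_widen _ (fun i : nat => \sum_(j < (mdeg m).+1)
   c i j * (maxval f ^+ i * maxval g ^+ j) m) lt)
  [RHS](bigID (fun i : 'I_N => (i < (mdeg m).+1)%N)) /=.
rewrite [X in _ = _ + X]big1 ?addr0 => [|i]; last first.
  rewrite -leqNgt => li; apply: big1 => j _.
  by rewrite Z ?mulr0 // (leq_trans li) ?leq_addr.
apply: eq_bigr => i _.
rewrite (big_ord_widen _ (fun j : nat => c i j * (maxval f ^+ i * maxval g ^+ j) m) lt).
rewrite [RHS](bigID (fun j : 'I_N => (j < (mdeg m).+1)%N)) /=.
rewrite [X in _ = _ + X]big1 ?addr0 => [|j]; first by [].
by rewrite -leqNgt => lj; rewrite Z ?mulr0 // (leq_trans lj) ?leq_addl.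
Qed.

Lemma subst2_trunc c (f g : maxps) N :
  ps_ge N (subst2 c f g - \sum_(i < N) \sum_(j < N) psC (c i j) * (maxval f ^+ i * maxval g ^+ j)).
Proof.
apply/ps_geBP => m lt; rewrite (subst2_bound _ _ _ lt) pscoef_sum.
apply: eq_bigr => i _; rewrite pscoef_sum; apply: eq_bigr => j _.
by rewrite pscoefCM.
Qed.

End VanishingOrder.

Arguments psC {R} I c.
Arguments maxX R {I} i.

(** * Substitution of power series without constant term *)

Section Substitution.
Variables (R : comNzRingType) (J I : choiceType).
Notation PJ := (pseries R J).
Notation P := (pseries R I).
Implicit Types (phi : J -> maxps R I) (k l : {cmonom J}).

Definition cmon_eval phi k : P := \prod_(j <- finsupp k) maxval (phi j) ^+ k j.

Lemma cmon_evalw phi (d : {fset J}) k : (finsupp k `<=` d)%fset ->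
  cmon_eval phi k = \prod_(j <- d) maxval (phi j) ^+ k j.
Proof.
move=> le; apply: big_fset_incl => // j _; rewrite -cmE_eq0 => /eqP ->.
by rewrite expr0.
Qed.

Fact cmon_eval_morphism phi : mmorphism (cmon_eval phi).
Proof.
split=> [k l|]; last by rewrite /cmon_eval mdom1 big_seq_fset0.
have Ed := mdomD k l.
rewrite !(@cmon_evalw _ (finsupp (k * l)%M)) ?Ed ?fsubsetUl ?fsubsetUr // -big_split /=.
by apply: eq_bigr => j _; rewrite cmM exprD.
Qed.
HB.instance Definition _ phi :=
  isMultiplicative.Build {cmonom J} P (cmon_eval phi) (cmon_eval_morphism phi).

Lemma cmon_evalU phi j : cmon_eval phi (ucm j) = phi j.
Proof. by rewrite /cmon_eval mdomU big_seq_fset1 cmUU. Qed.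

Lemma cmon_eval_ge phi k : ps_ge (mdeg k) (cmon_eval phi k).
Proof.
rewrite mdegE /cmon_eval; elim/big_rec2: _ => [|j d f _ IH]; first exact: ps_ge_any.
by apply: ps_geM IH; apply/ps_geX/maxps_ge.
Qed.

Definition poly_eval phi (g : {malg R[{cmonom J}]}) : P := mmap (psC I) (cmon_eval phi) g.
Fact poly_eval_zmod phi : zmod_morphism (poly_eval phi).
Proof. exact: raddfB. Qed.
Fact poly_eval_monoid phi : monoid_morphism (poly_eval phi).
Proof.
split; first exact: (@mmap1 _ _ _ (psC I) (cmon_eval phi)).
exact: (@mmap_is_multiplicative _ _ _ (psC I) (cmon_eval phi)).1.
Qed.
HB.instance Definition _ phi := GRing.isZmodMorphism.Build {malg R[{cmonom J}]} P
  (poly_eval phi) (poly_eval_zmod phi).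
HB.instance Definition _ phi := GRing.isMonoidMorphism.Build {malg R[{cmonom J}]} P
  (poly_eval phi) (poly_eval_monoid phi).

Lemma poly_evalE phi g : poly_eval phi g = \sum_(k <- msupp g) psC I g@_k * cmon_eval phi k.
Proof. by []. Qed.

Lemma poly_eval_ge phi g d : (forall k, (mdeg k < d)%N -> g@_k = 0) -> ps_ge d (poly_eval phi g).
Proof.
move=> H; rewrite poly_evalE; apply: ps_ge_sum => k _.
have [/H -> |le] := ltnP (mdeg k) d; first by rewrite raddf0 mul0r.
by apply/ps_geMl/(ps_ge_le le)/cmon_eval_ge.
Qed.

Lemma ps_trunc_finite (f : PJ) d : finite_set [set k | (mdeg k < d)%N /\ f k != 0]%classic.
Proof.
have H : finite_set (\bigcup_(e in `I_d) [set k | mdeg k = e /\ f k != 0])%classic.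
  by apply: bigcup_finite => [|e _]; [exact: finite_II | exact: pscoefP].
by apply: sub_finite_set H => k [/= lt nz]; exists (mdeg k).
Qed.
Definition ps_trunc d (f : PJ) : {malg R[{cmonom J}]} :=
  [malg k in fset_set [set k | (mdeg k < d)%N /\ f k != 0]%classic => f k].

Lemma ps_truncE d f k : (ps_trunc d f)@_k = if (mdeg k < d)%N then f k else 0.
Proof.
rewrite mcoeffE in_fset_set; last exact: ps_trunc_finite.
case: ifP => [|/negbT N]; first by rewrite inE => -[->].
case: ifP => // lt; apply/esym/eqP; apply: contraNT N => nz.
by rewrite inE.
Qed.

Fact psubst_subproof phi (f : PJ) :
  degwise_finite (fun m => poly_eval phi (ps_trunc (mdeg m).+1 f) m).
Proof.
move=> d; apply: sub_finite_set (pscoefP (poly_eval phi (ps_trunc d.+1 f)) d).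
by move=> m [/= <-].
Qed.
(** A monomial of degree [e] evaluates to a series of order at least [e], so the coefficient at [m]
    only sees the part of [f] of degree at most [mdeg m], which is a polynomial. *)
Definition psubst phi f := mk_pseries (@psubst_subproof phi f).

Lemma psubstE phi f m : psubst phi f m = poly_eval phi (ps_trunc (mdeg m).+1 f) m.
Proof. by []. Qed.

Lemma psubst_trunc phi f d : ps_ge d (psubst phi f - poly_eval phi (ps_trunc d f)).
Proof.
apply/ps_geBP => m lt; rewrite psubstE; apply/eqP; rewrite -subr_eq0 -pscoefN -pscoefD.
rewrite -raddfB; apply/eqP/(@poly_eval_ge _ _ (mdeg m).+1) => // k ltk.
by rewrite mcoeffB !ps_truncE ltk (leq_trans ltk) ?subrr.
Qed.

Fact psubst_zmod phi : zmod_morphism (psubst phi).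
Proof.
move=> f g; apply/pseriesP => m; rewrite pscoefD pscoefN !psubstE.
rewrite -pscoefN -pscoefD -raddfB; congr (poly_eval _ _ m).
apply/malgP => k; rewrite mcoeffB !ps_truncE pscoefD pscoefN.
by case: ifP; rewrite ?subr0.
Qed.
HB.instance Definition _ phi :=
  GRing.isZmodMorphism.Build PJ P (psubst phi) (psubst_zmod phi).

Lemma ps_trunc_mul d (f g : PJ) k : (mdeg k < d)%N ->
  (ps_trunc d f * ps_trunc d g)@_k = (f * g) k.
Proof.
move=> lt; rewrite mcoeffMl pscoefM.
set a := ps_trunc d f; set b := ps_trunc d g.
pose l := [seq (p, q) | p <- enum_fset (msupp a), q <- enum_fset (msupp b)].
transitivity (\sum_(p <- l) (a@_p.1 * b@_p.2) *+ ((p.1 * p.2)%M == k)).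
  by rewrite big_allpairs.
have ul : uniq l by apply: allpairs_uniq; rewrite ?fset_uniq // => -[? ?] [? ?].
rewrite (bigID (fun p => (p.1 * p.2)%M == k)) /= [X in _ + X]big1 ?addr0; last first.
  by move=> p /negbTE ->.
transitivity (\sum_(p <- [seq p <- l | (p.1 * p.2)%M == k]) a@_p.1 * b@_p.2).
  by rewrite big_filter; apply: eq_bigr => p ->.
have sub : {subset [seq p <- l | (p.1 * p.2)%M == k] <= decs k}.
  by move=> p; rewrite mem_filter in_decs => /andP[].
have E p : p \in decs k -> a@_p.1 * b@_p.2 = f p.1 * g p.2.
  rewrite in_decs => /eqP Ek; rewrite !ps_truncE.
  by rewrite !(leq_ltn_trans _ lt) // -Ek mdegM ?leq_addr ?leq_addl.
rewrite [RHS](bigID (mem [seq p <- l | (p.1 * p.2)%M == k])) /=.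
rewrite [X in _ + X]big_seq_cond [X in _ + X]big1 ?addr0; last first.
  move=> p /andP[pk]; rewrite mem_filter; rewrite in_decs in pk; rewrite pk /=.
  rewrite -(E _ _) ?in_decs // => N.
  have [a0|a0] := boolP (p.1 \in msupp a); last by rewrite (mcoeff_outdom a0) mul0r.
  have [b0|b0] := boolP (p.2 \in msupp b); last by rewrite (mcoeff_outdom b0) mulr0.
  by case/negP: N; apply/allpairsP; exists p; case: p a0 b0 {pk}.
rewrite -[RHS]big_filter; rewrite big_seq [RHS]big_seq.
have P1 : perm_eq [seq p <- l | (p.1 * p.2)%M == k]
   [seq i <- decs k | i \in [seq p <- l | (p.1 * p.2)%M == k]].
  apply: uniq_perm; rewrite ?filter_uniq ?fset_uniq // => p.
  rewrite [RHS]mem_filter; apply/idP/idP => [H|/andP[]//].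
  by rewrite H sub.
rewrite (perm_big _ P1) /=; apply: eq_big => p; first by rewrite (perm_mem P1).
by move=> /sub /E.
Qed.

Lemma psubst_approx phi (f : PJ) (g : {malg R[{cmonom J}]}) d :
  (forall k, (mdeg k < d)%N -> f k = g@_k) -> ps_ge d (psubst phi f - poly_eval phi g).
Proof.
move=> H; have -> : psubst phi f - poly_eval phi g =
  (psubst phi f - poly_eval phi (ps_trunc d f)) + poly_eval phi (ps_trunc d f - g).
  by rewrite raddfB /=; ring.
apply: ps_geD; first exact: psubst_trunc; apply: poly_eval_ge => k lt.
by rewrite mcoeffB ps_truncE lt H ?subrr.
Qed.

Fact psubst_monoid phi : monoid_morphism (psubst phi).
Proof.
split=> [|f g]; apply: ps_ge_eq => d.
  rewrite -(rmorph1 (poly_eval phi)); apply: psubst_approx => k _.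
  by rewrite mcoeff1.
set ef := poly_eval phi (ps_trunc d f); set eg := poly_eval phi (ps_trunc d g).
have -> : psubst phi (f * g) - psubst phi f * psubst phi g =
  (psubst phi (f * g) - ef * eg) - (psubst phi f * (psubst phi g - eg) +
     eg * (psubst phi f - ef)) by ring.
apply: ps_geB; last by apply: ps_geD; apply: ps_geMl; apply: psubst_trunc.
rewrite /ef /eg -rmorphM; apply: psubst_approx => k lt.
by rewrite ps_trunc_mul.
Qed.
HB.instance Definition _ phi :=
  GRing.isMonoidMorphism.Build PJ P (psubst phi) (psubst_monoid phi).

Lemma psubst_ge phi d f : ps_ge d f -> ps_ge d (psubst phi f).
Proof.
move=> H; rewrite -[psubst phi f]subr0 -(raddf0 (poly_eval phi)).
by apply: psubst_approx => k lt; rewrite mcoeff0 H.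
Qed.

Lemma psubstC phi c : psubst phi (psC J c) = psC I c.
Proof.
apply: ps_ge_eq => d; have -> : psC I c = poly_eval phi c%:MP.
  by rewrite /poly_eval mmapC.
apply: psubst_approx => k _; rewrite psCE mcoeffC.
by case: eqP; rewrite ?mulr1 ?mulr0.
Qed.

Lemma psubst_mono phi k : psubst phi (psmono R k) = cmon_eval phi k.
Proof.
apply: ps_ge_eq => d; have -> : cmon_eval phi k = poly_eval phi << k >>.
  by rewrite /poly_eval mmapU /= (rmorph1 (psC I)) mul1r.
by apply: psubst_approx => l _; rewrite psmonoE mcoeffU1 eq_sym.
Qed.

Lemma psubstX phi j : psubst phi (psX R j) = phi j.
Proof. by rewrite -cmon_evalU -psubst_mono. Qed.

Fact psubst_max_subproof phi (f : maxps R J) : psubst phi f 1%M == 0.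
Proof. by apply/eqP/ps_ge1P/psubst_ge/maxps_ge. Qed.
Definition psubst_max phi f := MaxPs (psubst_max_subproof phi f).

End Substitution.

Section ContinuousMorphisms.
Variables (R : comNzRingType) (J I : choiceType).
Notation PJ := (pseries R J).
Notation P := (pseries R I).

Definition ps_continuous (chi : PJ -> P) :=
  (forall c, chi (psC J c) = psC I c) /\ (forall d f, ps_ge d f -> ps_ge d (chi f)).

Lemma psubst_continuous (phi : J -> maxps R I) : ps_continuous (psubst phi).
Proof. by split=> [c|d f]; [apply: psubstC | apply: psubst_ge]. Qed.

Fact ps_continuous_max chi (Hchi : ps_continuous chi) (f : maxps R J) : chi f 1%M == 0.
Proof. by apply/eqP/ps_ge1P/Hchi.2/maxps_ge. Qed.

Lemma cmon_evalX k : cmon_eval (@maxX R J) k = psmono R k.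
Proof.
move: {2}(mdeg k) (erefl (mdeg k)) => d; elim: d k => [|d IH] k dk.
  by rewrite (mdeg_eq0I dk) /cmon_eval mdom1 big_seq_fset0.
have [i ki] : exists i, k i != 0%N.
  apply: contrapT => Nk; have k1 : k = 1%M.
    apply/eqP/cmP => i; rewrite cm1; case: (eqVneq (k i) 0%N) => // ki.
    by case: Nk; exists i.
  by move: dk; rewrite k1 mdeg1.
have Ek := cm_split ki; move: dk; rewrite Ek mdegM mdegU => -[dk].
by rewrite (cmon_eval_morphism _).1 cmon_evalU IH // psmonoM.
Qed.

Lemma psubst_id f : psubst (@maxX R J) f = f.
Proof.
apply: ps_ge_eq => d; have -> : psubst (@maxX R J) f - f =
  (psubst (@maxX R J) f - poly_eval (@maxX R J) (ps_trunc d f)) +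
  (poly_eval (@maxX R J) (ps_trunc d f) - f) by ring.
apply: ps_geD; first exact: psubst_trunc; apply/ps_geBP => m lt.
have E (g : {malg R[{cmonom J}]}) : poly_eval (@maxX R J) g m = g@_m.
  rewrite poly_evalE pscoef_sum [in RHS](monalgE g) raddf_sum /=.
  apply: eq_bigr => k _; rewrite pscoefCM cmon_evalX psmonoE mcoeffU eq_sym.
  by case: eqP; rewrite ?mulr1 ?mulr0.
by rewrite E ps_truncE lt.
Qed.

(** Both sides agree on polynomials, and [f] is a polynomial up to an error of order [d], which both
    sides send to order [d]. Hence continuous morphisms can be compared on the variables alone. *)
Lemma continuous_psubst (chi : {rmorphism PJ -> P}) (Hchi : ps_continuous chi) f :
  chi f = psubst (fun j => MaxPs (ps_continuous_max Hchi (maxX R j))) f.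
Proof.
set phi := fun j => _; apply: ps_ge_eq => d.
have Ech (g : {malg R[{cmonom J}]}) : chi (poly_eval (@maxX R J) g) = poly_eval phi g.
  rewrite !poly_evalE rmorph_sum; apply: eq_bigr => k _.
  rewrite rmorphM /= Hchi.1 /cmon_eval rmorph_prod; congr (_ * _).
  by apply: eq_bigr => j _; rewrite rmorphXn.
have -> : chi f - psubst phi f =
  chi (psubst (@maxX R J) f - poly_eval (@maxX R J) (ps_trunc d f)) -
  (psubst phi f - poly_eval phi (ps_trunc d f)).
  by rewrite rmorphB /= Ech psubst_id; ring.
apply: ps_geB; last exact: psubst_trunc.
by apply/Hchi.2/psubst_trunc.
Qed.

Lemma psubst_ext (phi psi : J -> maxps R I) f :
  (forall j, maxval (phi j) = maxval (psi j)) -> psubst phi f = psubst psi f.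
Proof.
by move=> E; have -> : phi = psi by apply/funext => j; apply: val_inj; apply: E.
Qed.

Lemma continuous_morph_ext (chi psi : {rmorphism PJ -> P}) :
  ps_continuous chi -> ps_continuous psi ->
  (forall j, chi (psX R j) = psi (psX R j)) -> chi =1 psi.
Proof.
move=> Hc Hp E f; rewrite (continuous_psubst Hc) (continuous_psubst Hp).
by apply: psubst_ext => j; apply: E.
Qed.

Lemma continuous_subst2 (chi : {rmorphism PJ -> P}) (Hchi : ps_continuous chi)
    c (f g : maxps R J) :
  chi (subst2 c f g) = subst2 c (chi f) (chi g).
Proof.
pose f' := MaxPs (ps_continuous_max Hchi f); pose g' := MaxPs (ps_continuous_max Hchi g).
apply: ps_ge_eq => d.
pose B (K : choiceType) (f g : pseries R K) : pseries R K :=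
  \sum_(i < d) \sum_(j < d) psC K (c i j) * (f ^+ i * g ^+ j).
have EB : chi (B J f g) = B I f' g'.
  rewrite rmorph_sum; apply: eq_bigr => i _; rewrite rmorph_sum; apply: eq_bigr => j _.
  by rewrite !rmorphM /= Hchi.1 !rmorphXn.
have -> : chi (subst2 c f g) - subst2 c (chi f) (chi g) =
  chi (subst2 c f g - B J f g) - (subst2 c f' g' - B I f' g').
  by rewrite rmorphB EB /=; ring.
by apply: ps_geB; [apply/Hchi.2/subst2_trunc | apply: subst2_trunc].
Qed.

End ContinuousMorphisms.

(** * Congruences modulo closed ideals *)

Section ClosedIdeals.
Variables (R : comNzRingType) (I : choiceType).
Notation P := (pseries R I).

(** Kept abstract because there are two instances: the ideals [ps_ge d], which give the contraction
    estimate for inverses, and [fga_ideal]. *)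
Definition closed_ideal (N : P -> Prop) :=
  [/\ N 0, forall f g, N f -> N g -> N (f + g), forall f g, N g -> N (f * g)
    & forall f, (forall d, exists2 h, N h & ps_ge d (f - h)) -> N f].

Lemma ps_ge_closed_ideal d : closed_ideal (@ps_ge R I d).
Proof.
split=> [|f g|f g|f]; [exact: ps_ge0 | exact: ps_geD | exact: ps_geMl |].
by move=> /(_ d)[h Hh Hfh]; rewrite -[f](subrK h); apply: ps_geD.
Qed.

Variables (N : P -> Prop) (HN : closed_ideal N).

Lemma closed_idealN f : N f -> N (- f).
Proof. by case: HN => _ _ H _ /(H (-1)); rewrite mulN1r. Qed.
Lemma closed_ideal_sum (T : Type) (r : seq T) (E : T -> P) :
  (forall i, N (E i)) -> N (\sum_(i <- r) E i).
Proof. by case: HN => N0 ND _ _ H; apply: big_ind => // *; apply: ND. Qed.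

Lemma closed_idealM2 f f' g g' : N (f - f') -> N (g - g') -> N (f * g - f' * g').
Proof.
case: HN => _ ND NM _ Hf Hg.
have -> : f * g - f' * g' = g * (f - f') + f' * (g - g') by ring.
by apply: ND; apply: NM.
Qed.

Lemma closed_idealX f f' n : N (f - f') -> N (f ^+ n - f' ^+ n).
Proof.
move=> Hf; elim: n => [|n IH]; first by rewrite subrr; case: HN.
by rewrite !exprS; apply: closed_idealM2.
Qed.

Lemma closed_ideal_subst2 c (f f' g g' : maxps R I) :
  N (maxval f - maxval f') -> N (maxval g - maxval g') -> N (subst2 c f g - subst2 c f' g').
Proof.
case: (HN) => N0 ND NM NC Hf Hg; apply: NC => d.
pose B (f g : P) : P := \sum_(i < d) \sum_(j < d) psC I (c i j) * (f ^+ i * g ^+ j).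
exists (B f g - B f' g').
  rewrite /B -sumrB; apply: closed_ideal_sum => i; rewrite -sumrB.
  apply: closed_ideal_sum => j; rewrite -mulrBr; apply: NM.
  by apply: closed_idealM2; apply: closed_idealX.
have -> : subst2 c f g - subst2 c f' g' - (B f g - B f' g') =
  (subst2 c f g - B f g) - (subst2 c f' g' - B f' g') by ring.
by apply: ps_geB; apply: subst2_trunc.
Qed.

Lemma closed_ideal_psubst (J : choiceType) (phi psi : J -> maxps R I) f :
  (forall j, N (maxval (phi j) - maxval (psi j))) -> N (psubst phi f - psubst psi f).
Proof.
case: (HN) => N0 ND NM NC H; apply: NC => d.
pose t := ps_trunc d f; exists (poly_eval phi t - poly_eval psi t); last first.
  have -> : psubst phi f - psubst psi f - (poly_eval phi t - poly_eval psi t) =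
    (psubst phi f - poly_eval phi t) - (psubst psi f - poly_eval psi t) by ring.
  by apply: ps_geB; apply: psubst_trunc.
rewrite !poly_evalE -sumrB; apply: closed_ideal_sum => k; rewrite -mulrBr; apply: NM.
rewrite /cmon_eval; elim/big_rec2: _ => [|j f1 f2 _ IH]; first by rewrite subrr.
by apply: closed_idealM2 => //; apply: closed_idealX.
Qed.

End ClosedIdeals.

(** * The group of points of a formal group law *)

Arguments subst2 : simpl never.

(** A copy of [maxps] that remembers [F], so that the group structure defined by [F] can be attached
    to it. *)
Definition fgl_points (R : comNzRingType) (I : choiceType) (F : fgl R) := maxps R I.

Section FormalGroupPoints.
Variables (R : comNzRingType) (F : fgl R) (I : choiceType).
Notation P := (pseries R I).

Notation fgpt := (fgl_points I F).
HB.instance Definition _ := Choice.on fgpt.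
Implicit Types f g h : fgpt.

(** The coefficients of [H] in [F(x, y) = x + y + x y H(x, y)]. *)
Definition fgl_tail (i j : nat) : R := F i.+1 j.+1.

Lemma fgl_unitl i : F 0 i = (i == 1)%:R.
Proof. by rewrite fgl_comm fgl_unit. Qed.

Lemma fgl_subst2E f g : subst2 F f g =
  maxval f + maxval g + maxval f * maxval g * subst2 fgl_tail f g.
Proof.
apply: ps_ge_eq => -[|d]; first exact: ps_ge_any.
pose B (c : nat -> nat -> R) n : P :=
  \sum_(i < n) \sum_(j < n) psC I (c i j) * (maxval f ^+ i * maxval g ^+ j).
have E : B F d.+2 = maxval f + maxval g + maxval f * maxval g * B fgl_tail d.+1.
  rewrite /B big_ord_recl /= [X in _ + X](_ : _ =
     maxval f + maxval f * maxval g * B fgl_tail d.+1); last first.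
    transitivity (\sum_(i < d.+1) (psC I (F i.+1 0%N) * maxval f ^+ i.+1 +
      \sum_(j < d.+1) psC I (fgl_tail i j) * (maxval f ^+ i.+1 * maxval g ^+ j.+1))).
      by apply: eq_bigr => i _; rewrite big_ord_recl /= expr0 mulr1.
    rewrite big_split /=; congr (_ + _).
      rewrite big_ord_recl fgl_unit rmorph1 mul1r expr1 big1 ?addr0 // => i _.
      by rewrite fgl_unit rmorph0 mul0r.
    rewrite /B mulr_sumr; apply: eq_bigr => i _; rewrite mulr_sumr.
    by apply: eq_bigr => j _; rewrite !exprS; ring.
  rewrite addrCA addrA; congr (_ + _ + _).
  rewrite big_ord_recl big_ord_recl !fgl_unitl rmorph0 mul0r add0r.
  rewrite rmorph1 !mul1r expr1 big1 ?addr0 // => i _.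
  by rewrite fgl_unitl rmorph0 mul0r.
have -> : subst2 F f g - (maxval f + maxval g + maxval f * maxval g * subst2 fgl_tail f g) =
  (subst2 F f g - B F d.+2) - maxval f * maxval g * (subst2 fgl_tail f g - B fgl_tail d.+1).
  by rewrite E; ring.
apply: ps_geB; last by apply/ps_geMl/subst2_trunc.
by apply: (@ps_ge_le _ _ _ d.+2) => //; apply: subst2_trunc.
Qed.

Fact fgpt_add_subproof f g : subst2 F f g 1%M == 0.
Proof. by apply: maxps_subst2; rewrite fgl_unit. Qed.
Definition fgpt_add f g : fgpt := MaxPs (fgpt_add_subproof f g).

Fact fgpt0_subproof : (0 : P) 1%M == 0. Proof. exact: eqxx. Qed.
Definition fgpt0 : fgpt := MaxPs fgpt0_subproof.

Fact fgpt_addC : commutative fgpt_add.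
Proof.
move=> f g; apply: val_inj; apply/pseriesP => m /=; rewrite !subst2E exchange_big.
by apply: eq_bigr => i _; apply: eq_bigr => j _; rewrite fgl_comm [maxval f ^+ _ * _]mulrC.
Qed.

Fact fgpt_add0 : left_id fgpt0 fgpt_add.
Proof. by move=> f; apply: val_inj; rewrite [LHS]fgl_subst2E /= add0r !mul0r addr0. Qed.

(** Associativity of [F] is an identity in three variables; substituting [f], [g], [h] for them
    transports it, since substitution commutes with [subst2]. *)
Fact fgpt_addA : associative fgpt_add.
Proof.
move=> f g h; apply: val_inj => /=.
pose phi (k : 'I_3) : maxps R I := nth fgpt0 [:: f; g; h] k.
pose x k := maxX R (inord k : 'I_3).
pose ad (J : choiceType) (a b : maxps R J) : maxps R J :=
  MaxPs (@maxps_subst2 _ _ F a b (fgl_unit F 0)).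
have S (a b : maxps R 'I_3) : psubst phi (subst2 F a b) =
  subst2 F (psubst phi a) (psubst phi b).
  exact/continuous_subst2/psubst_continuous.
have X k : (k < 3)%N -> psubst phi (maxX R (inord k : 'I_3)) = nth fgpt0 [:: f; g; h] k.
  by move=> lt; rewrite psubstX /phi inordK.
have := congr1 (psubst phi) (fgl_assoc F).
rewrite (S (x 0%N) (ad _ (x 1%N) (x 2%N))) (S (x 1%N) (x 2%N)).
by rewrite (S (ad _ (x 0%N) (x 1%N)) (x 2%N)) (S (x 0%N) (x 1%N)) !X.
Qed.

(* F(f, g) = f + g + f g H(f, g), so - f is the fixed point of the contraction
   g |-> - f - f g H(f, g). *)
Section Inverse.
Variable f : fgpt.

Fact fgpt_opp_step_subproof g :
  (- maxval f - maxval f * maxval g * subst2 fgl_tail f g) 1%M == 0.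
Proof.
apply/eqP/ps_ge1P/ps_geB; first exact/ps_geN/maxps_ge.
by rewrite mulrAC; apply/ps_geMl/maxps_ge.
Qed.
Definition fgpt_opp_step g : fgpt := MaxPs (fgpt_opp_step_subproof g).

Lemma fgpt_opp_step_contract d g h :
  ps_ge d (maxval g - maxval h) ->
  ps_ge d.+1 (maxval (fgpt_opp_step g) - maxval (fgpt_opp_step h)).
Proof.
move=> H /=; set Hg := subst2 _ f g; set Hh := subst2 _ f h.
have -> : - maxval f - maxval f * maxval g * Hg - (- maxval f - maxval f * maxval h * Hh)
  = - (maxval f * (maxval g * Hg - maxval h * Hh)) by ring.
apply: ps_geN; rewrite -add1n; apply: ps_geM (maxps_ge f) _.
apply: (closed_idealM2 (ps_ge_closed_ideal _ _ d)) => //.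
apply: (closed_ideal_subst2 (ps_ge_closed_ideal _ _ d)) => //.
by rewrite subrr; apply: ps_ge0.
Qed.

Definition fgpt_opp_seq n := iter n fgpt_opp_step fgpt0.

Lemma fgpt_opp_seqS n : ps_ge n (maxval (fgpt_opp_seq n.+1) - maxval (fgpt_opp_seq n)).
Proof.
by elim: n => [|n IH]; [exact: ps_ge_any | exact: fgpt_opp_step_contract IH].
Qed.

Lemma fgpt_opp_seq_le n k : ps_ge n (maxval (fgpt_opp_seq (k + n)) - maxval (fgpt_opp_seq n)).
Proof.
elim: k => [|k IH]; first by rewrite subrr; apply: ps_ge0.
rewrite -(subrK (maxval (fgpt_opp_seq (k + n))) (maxval (fgpt_opp_seq (k.+1 + n)))) -addrA.
by apply: ps_geD IH; apply: ps_ge_le (@fgpt_opp_seqS (k + n)); rewrite leq_addl.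
Qed.

(** From the [n]-th iterate on, the coefficients of degree below [n] no longer change, so the limit
    at [m] is read off at stage [(mdeg m).+1]. *)
Fact fgpt_opp_subproof1 : degwise_finite (fun m => maxval (fgpt_opp_seq (mdeg m).+1) m).
Proof.
move=> d; apply: sub_finite_set (pscoefP (maxval (fgpt_opp_seq d.+1)) d).
by move=> m [/= <-].
Qed.
Fact fgpt_opp_subproof : mk_pseries fgpt_opp_subproof1 1%M == 0.
Proof. exact: maxvalP. Qed.
Definition fgpt_opp : fgpt := MaxPs fgpt_opp_subproof.

Lemma fgpt_opp_approx n : ps_ge n (maxval fgpt_opp - maxval (fgpt_opp_seq n)).
Proof.
apply/ps_geBP => m lt; have := @fgpt_opp_seq_le (mdeg m).+1 (n - (mdeg m).+1).
by rewrite subnK // => /ps_geBP/(_ m (leqnn _)) ->.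
Qed.

Fact fgpt_addN : fgpt_add fgpt_opp f = fgpt0.
Proof.
rewrite fgpt_addC; apply: val_inj; rewrite [LHS]fgl_subst2E.
suff {1}-> : maxval fgpt_opp = maxval (fgpt_opp_step fgpt_opp) by rewrite /=; ring.
apply: ps_ge_eq => d.
rewrite -(subrK (maxval (fgpt_opp_seq d.+1)) (maxval fgpt_opp)) -addrA.
apply: ps_geD; first by apply: ps_ge_le (@fgpt_opp_approx d.+1).
rewrite -opprB; apply: ps_geN; apply: (@ps_ge_le _ _ _ d.+1) => //.
exact/fgpt_opp_step_contract/fgpt_opp_approx.
Qed.
End Inverse.

HB.instance Definition _ :=
  GRing.isZmodule.Build fgpt fgpt_addA fgpt_addC fgpt_add0 fgpt_addN.

Lemma fgpt_addE f g : maxval (f + g) = subst2 F f g. Proof. by []. Qed.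

(** The tangent map at the origin, additive because [F(f, g)] is [f + g] up to order 2. It recovers
    the integral coordinates of [a] from [x_a]. *)
Definition fgpt_lin (i : I) f : R := maxval f (ucm i).

Fact fgpt_linD i : {morph fgpt_lin i : f g / f + g}.
Proof.
move=> f g; rewrite /fgpt_lin fgpt_addE fgl_subst2E !pscoefD.
have H : ps_ge 2 (maxval f * maxval g) by apply: (@ps_geM _ _ 1 1); apply: maxps_ge.
by rewrite (ps_geM H (@ps_ge_any _ _ _)) ?addr0 // mdegU.
Qed.
Fact fgpt_lin_zmod i : zmod_morphism (fgpt_lin i).
Proof.
by move=> f g; apply/eqP; rewrite eq_sym subr_eq -fgpt_linD subrK.
Qed.
HB.instance Definition _ i := GRing.isZmodMorphism.Build fgpt R (fgpt_lin i) (fgpt_lin_zmod i).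

Section Congruence.
Variables (N : P -> Prop) (HN : closed_ideal N).

Definition fgpt_eqv f g := N (maxval f - maxval g).

Lemma fgpt_eqv_refl f : fgpt_eqv f f.
Proof. by rewrite /fgpt_eqv subrr; case: HN. Qed.
Lemma fgpt_eqv_sym f g : fgpt_eqv f g -> fgpt_eqv g f.
Proof. by rewrite /fgpt_eqv -opprB => /(closed_idealN HN); rewrite opprK. Qed.
Lemma fgpt_eqv_trans g f h : fgpt_eqv f g -> fgpt_eqv g h -> fgpt_eqv f h.
Proof.
case: (HN) => _ ND _ _ fg gh; rewrite /fgpt_eqv -(subrK (maxval g) (maxval f)) -addrA.
exact: ND.
Qed.
Lemma fgpt_eqvD f f' g g' : fgpt_eqv f f' -> fgpt_eqv g g' -> fgpt_eqv (f + g) (f' + g').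
Proof. exact: closed_ideal_subst2. Qed.
Lemma fgpt_eqvN f g : fgpt_eqv f g -> fgpt_eqv (- f) (- g).
Proof.
move=> fg; rewrite -[- f](addrK g) -[X in fgpt_eqv _ X]add0r -(addNr f).
apply: fgpt_eqvD (fgpt_eqv_refl _); apply: fgpt_eqvD; first exact: fgpt_eqv_refl.
exact: fgpt_eqv_sym.
Qed.

Section QuasiAdditive.
Variables (M : zmodType) (x : M -> fgpt).
Hypotheses (x0 : fgpt_eqv (x 0) 0) (xD : forall a b, fgpt_eqv (x (a + b)) (x a + x b)).

(** In the completion [x] is additive only modulo [N], so the rules for opposites, multiples and
    sums are derived up to congruence instead of from an additive map. *)
Lemma fgpt_eqv_opp a : fgpt_eqv (x (- a)) (- x a).
Proof.
rewrite -[x (- a)](addrK (x a)) -[X in fgpt_eqv _ X]add0r.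
apply: fgpt_eqvD (fgpt_eqv_refl _); apply: fgpt_eqv_trans x0.
by apply: fgpt_eqv_sym; have := xD (- a) a; rewrite addNr.
Qed.
Lemma fgpt_eqvMn a n : fgpt_eqv (x (a *+ n)) (x a *+ n).
Proof.
elim: n => [|n IH]; first exact: x0.
by rewrite !mulrS; apply: fgpt_eqv_trans (xD _ _) _; apply: fgpt_eqvD (fgpt_eqv_refl _) _.
Qed.
Lemma fgpt_eqvMz a (n : int) : fgpt_eqv (x (a *~ n)) (x a *~ n).
Proof.
case: n => n; first exact: fgpt_eqvMn.
by rewrite NegzE !mulrNz; apply: fgpt_eqv_trans (fgpt_eqv_opp _) _; apply/fgpt_eqvN/fgpt_eqvMn.
Qed.
Lemma fgpt_eqv_sum (T : Type) (r : seq T) (E : T -> M) :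
  fgpt_eqv (x (\sum_(i <- r) E i)) (\sum_(i <- r) x (E i)).
Proof.
elim: r => [|i r IH]; first by rewrite !big_nil.
by rewrite !big_cons; apply: fgpt_eqv_trans (xD _ _) _; apply: fgpt_eqvD (fgpt_eqv_refl _) _.
Qed.
End QuasiAdditive.
End Congruence.
End FormalGroupPoints.

(** * The formal group algebra in coordinates *)

Section PsubstPoints.
Variables (R : comNzRingType) (F : fgl R) (J I : choiceType) (phi : J -> fgl_points I F).

Definition psubst_pt (f : fgl_points J F) : fgl_points I F := psubst_max phi f.

Fact psubst_ptD : {morph psubst_pt : f g / f + g}.
Proof.
move=> f g; apply: val_inj; rewrite [RHS]fgpt_addE.
exact/continuous_subst2/psubst_continuous.
Qed.
Fact psubst_pt_zmod : zmod_morphism psubst_pt.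
Proof. by move=> f g; apply/eqP; rewrite eq_sym subr_eq -psubst_ptD subrK. Qed.
HB.instance Definition _ := GRing.isZmodMorphism.Build (fgl_points J F) (fgl_points I F)
  psubst_pt psubst_pt_zmod.
End PsubstPoints.

(** * Divisibility by a variable *)

Section Divisibility.
Variables (R : comNzRingType) (I : choiceType) (i : I).
Implicit Types (h u : pseries R I) (m : {cmonom I}).

Lemma psX_mul_out u m : m i = 0%N -> (psX R i * u) m = 0.
Proof.
move=> mi; apply: psmonoM_out => m' E.
by move: mi; rewrite E cmM cmUU.
Qed.

Lemma psX_dvd h : (forall m, m i = 0%N -> h m = 0) -> exists u, h = psX R i * u.
Proof.
move=> H; have Hu : degwise_finite (fun m => h (ucm i * m)%M).
  move=> d; have /(finite_preimage (f := fun m => (ucm i * m)%M)) HF := pscoefP h d.+1.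
  apply: sub_finite_set (HF _) => [m /= [dm nz]|x y _ _ /mulcmI //].
  by rewrite mdegM mdegU dm.
exists (mk_pseries Hu); apply/pseriesP => m.
have [m0|/cm_split ->] := eqVneq (m i) 0%N; first by rewrite psX_mul_out ?H.
by rewrite psmonoM_mul.
Qed.

Lemma psX_reg h : psX R i * h = 0 -> h = 0.
Proof.
by move=> E; apply/pseriesP => m; rewrite -(psmonoM_mul (ucm i)) [_ * _]E.
Qed.

Definition kill_var (F : fgl R) (j : I) : fgl_points I F :=
  if j == i then (0 : fgl_points I F) else maxX R j.

(** Setting [x_i] to 0 keeps the coefficients of the monomials free of [x_i], and by [psX_dvd] these
    alone decide divisibility by [x_i]. *)
Lemma psubst_kill F h m : m i = 0%N -> psubst (kill_var F) h m = h m.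
Proof.
move=> mi; rewrite psubstE poly_evalE pscoef_sum.
have E k : cmon_eval (kill_var F) k m = (m == k)%:R.
  have [ki|/cm_split Ek] := eqVneq (k i) 0%N.
    rewrite -psmonoE -cmon_evalX; congr (pscoef _ m).
    rewrite /cmon_eval big_seq [RHS]big_seq; apply: eq_bigr => j jk.
    rewrite /kill_var; case: eqP => // ji.
    by move: jk; rewrite ji -cmE_neq0 ki.
  rewrite Ek (cmon_eval_morphism _).1 cmon_evalU /kill_var eqxx mul0r.
  by case: eqP => // mk; move: mi; rewrite mk cmM cmUU.
set t := ps_trunc _ h.
transitivity (t@_m); last by rewrite ps_truncE leqnn.
rewrite [in RHS](monalgE t) raddf_sum /=; apply: eq_bigr => k _.
rewrite pscoefCM E mcoeffU eq_sym.
by case: eqP; rewrite ?mulr1 ?mulr0.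
Qed.
End Divisibility.

Section Primality.
Variables (R : idomainType) (r : nat).
Notation P := (pseries R 'I_r).

Fixpoint lexle (s : seq 'I_r) (a b : {cmonom 'I_r}) : bool :=
  if s is i :: s' then (a i < b i)%N || (a i == b i) && lexle s' a b else true.

Lemma lex_min s (A : {cmonom 'I_r} -> Prop) : (exists a, A a) ->
  exists2 a, A a & forall b, A b -> lexle s a b.
Proof.
elim: s A => [|i s IH] A [a0 Aa0]; first by exists a0.
have H : exists k, `[< exists2 a, A a & a i = k >].
  by exists (a0 i); apply/asboolP; exists a0.
case: (ex_minnP H) => k /asboolP[a1 Aa1 a1k] kmin.
have [|a [Aa ak] amin] := IH (fun a => A a /\ a i = k); first by exists a1.
exists a => // b Ab /=; rewrite ak.
have : (k <= b i)%N by apply: kmin; apply/asboolP; exists b.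
rewrite leq_eqVlt => /orP[/eqP kb|-> //].
by rewrite -kb ltnn eqxx /= amin.
Qed.

(** At the first index both exponents can only grow while their sum is fixed, so both are equal and
    the comparison passes to the next index. *)
Lemma lexleD s a b c d : lexle s a c -> lexle s b d ->
  (forall i, c i + d i = a i + b i)%N -> {in s, forall i, c i = a i /\ d i = b i}.
Proof.
elim: s => // i s IH /= H1 H2 E j.
have Ei := E i.
have [ac bd] : a i = c i /\ b i = d i.
  move: H1 H2; case: ltngtP => //=; case: ltngtP => //= *; lia.
move: H1 H2; rewrite ac bd !ltnn !eqxx /= => H1 H2.
rewrite inE => /orP[/eqP -> //|]; exact: IH.
Qed.

(* The product of the lexicographically least monomials without x_i of f and g has
   coefficient f_a g_b in f g. *)
Lemma psX_prime (i : 'I_r) (f g u : P) : f * g = psX R i * u ->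
  (exists v, f = psX R i * v) \/ (exists v, g = psX R i * v).
Proof.
move=> E; apply: contrapT => /not_orP[Nf Ng].
have Hex (h : P) : (~ exists v, h = psX R i * v) -> exists m : {cmonom 'I_r}, m i = 0%N /\ h m != 0.
  move=> N; apply: contrapT => N2; apply: N; apply: psX_dvd => m mi.
  by apply/eqP; apply: contrapT => /negP nz; apply: N2; exists m.
have [a [ai fa] amin] := lex_min (enum 'I_r) (Hex _ Nf).
have [b [bi gb] bmin] := lex_min (enum 'I_r) (Hex _ Ng).
suff : (f * g) (a * b)%M = f a * g b.
  rewrite E psX_mul_out; last by rewrite cmM ai bi.
  by move=> /esym/eqP; rewrite mulf_eq0 (negbTE fa) (negbTE gb).
rewrite pscoefM (big_rem (a, b)) /=; last by rewrite in_decs.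
rewrite big_seq big1 ?addr0 // => -[c d].
rewrite mem_rem_uniq ?fset_uniq // inE in_decs /= => /andP[nab /eqP Em].
have Ek k : (c k + d k = a k + b k)%N by rewrite -!cmM Em.
have := Ek i; rewrite ai bi => /eqP; rewrite addn_eq0 => /andP[/eqP ci /eqP di].
have [->|fc] := eqVneq (f c) 0; first by rewrite mul0r.
have [->|gd] := eqVneq (g d) 0; first by rewrite mulr0.
have L := lexleD (amin c (conj ci fc)) (bmin d (conj di gd)) Ek.
case/eqP: nab; congr (_, _); apply/eqP/cmP => k.
  by have [] := L k (mem_enum _ k).
by have [] := L k (mem_enum _ k).
Qed.
End Primality.

Lemma fga_closed_ideal (R : comNzRingType) (F : fgl R) (M : zmodType) :
  closed_ideal (fun f : pseries R M => f \in @fga_ideal R F M).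
Proof.
split=> [|f g Hf Hg|f g Hg|f H]; [exact: rpred0 | exact: rpredD | |].
  by have [_ _ H] := @fga_ideal_closed R F M; rewrite -[f * g]addr0 H ?rpred0.
apply/fga_idealP => d; have [h /fga_idealP/(_ d)[g Ig hg] Hfh] := H d.
by exists g => // m lt; rewrite -hg //; move/ps_geBP: Hfh => ->.
Qed.

Section FormalGroupAlgebraFacts.
Variables (R : comNzRingType) (F : fgl R) (M : zmodType).
Notation P := (pseries R M).
Notation pi := (\pi_(fga F M)%qT : P -> fga F M).

Lemma fga_pi0 (f : P) : pi f = 0 <-> f \in @fga_ideal R F M.
Proof. by rewrite -[0](rmorph0 (\pi_(fga F M)%qT)) fga_piE subr0. Qed.

(** This is [F(x_a, x_(-a)) = x_0 = 0] with [F] written as [x + y + x y H]. It shows that [x_a] and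
    [x_(-a)] divide each other and that [1/x_a + 1/x_(-a) = - H] lies in [S]. *)
Lemma fga_xN (a : M) : exists H : fga F M,
  fga_x F a + fga_x F (- a) + fga_x F a * fga_x F (- a) * H = 0.
Proof.
pose f := maxX R a; pose g := maxX R (- a).
exists (pi (subst2 (fgl_tail F) f g)).
rewrite /fga_x -!(rmorphM \pi_(fga F M)%qT) -!(rmorphD \pi_(fga F M)%qT).
rewrite -(fgl_subst2E f g).
transitivity (pi (psX R 0)).
  apply/fga_piE; rewrite -opprB rpredN -(subrr a); apply/fga_idealP => d.
  exists (psX R (a - a) - subst2 F f g) => //.
  rewrite -[_ - _]addr0 -[_ - _]mul1r; constructor; last by constructor.
  by right; exists a, (- a).
apply/fga_pi0; apply/fga_idealP => d; exists (psX R 0) => //.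
rewrite -[psX _ _]addr0 -[psX _ _]mul1r; constructor; last by constructor.
by left.
Qed.

End FormalGroupAlgebraFacts.

Section Coordinates.
Variables (R : idomainType) (charR : [pchar R] =i pred0) (F : fgl R) (M : zmodType).
Variables (r : nat) (e : 'I_r -> M).
Hypothesis basis : forall a : M, exists! c : {ffun 'I_r -> int}, a = \sum_j e j *~ c j.
Notation P := (pseries R M).
Notation P0 := (pseries R 'I_r).
Notation pi := (\pi_(fga F M)%qT : P -> fga F M).

Lemma coord_ex a : exists c : {ffun 'I_r -> int}, a = \sum_j e j *~ c j.
Proof. by have [c [Ec _]] := basis a; exists c. Qed.
Definition coord a : {ffun 'I_r -> int} := projT1 (cid (coord_ex a)).
Lemma coordE a : a = \sum_j e j *~ coord a j.
Proof. exact: projT2 (cid (coord_ex a)). Qed.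
Lemma coord_uniq a (c : {ffun 'I_r -> int}) : a = \sum_j e j *~ c j -> coord a = c.
Proof. by move=> E; have [d [_ U]] := basis a; rewrite -(U _ (coordE a)) (U _ E). Qed.

Lemma coordD a b : coord (a + b) = [ffun j => coord a j + coord b j].
Proof.
apply: coord_uniq; rewrite {1}(coordE a) {1}(coordE b) -big_split.
by apply: eq_bigr => j _; rewrite ffunE mulrzDr.
Qed.
Lemma coord_basis i : coord (e i) = [ffun j => (i == j)%:R].
Proof.
apply: coord_uniq; rewrite (bigD1 i) //= ffunE eqxx big1 ?addr0 // => j ji.
by rewrite ffunE eq_sym (negbTE ji) mulr0z.
Qed.

(** The integral combination is formed in the group of points of [F], so this is the image of [x_a]
    in [R[[y_1, ..., y_r]]]. *)
Definition coord_pt a : fgl_points 'I_r F := \sum_j (maxX R j : fgl_points 'I_r F) *~ coord a j.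

Lemma coord_ptD : {morph coord_pt : a b / a + b}.
Proof.
move=> a b; rewrite -big_split; apply: eq_bigr => j _.
by rewrite coordD ffunE mulrzDr.
Qed.
Fact coord_pt_zmod : zmod_morphism coord_pt.
Proof. by move=> f g; apply/eqP; rewrite eq_sym subr_eq -coord_ptD subrK. Qed.
HB.instance Definition _ := GRing.isZmodMorphism.Build M (fgl_points 'I_r F) coord_pt coord_pt_zmod.

Lemma coord_pt_basis i : coord_pt (e i) = maxX R i.
Proof.
rewrite /coord_pt (bigD1 i) //= coord_basis ffunE eqxx big1 ?addr0 // => j ji.
by rewrite ffunE eq_sym (negbTE ji) mulr0z.
Qed.

Lemma fgpt_linX (i j : 'I_r) : fgpt_lin i (maxX R j : fgl_points 'I_r F) = (i == j)%:R.
Proof.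
have -> : fgpt_lin i (maxX R j : fgl_points 'I_r F) = (ucm i == ucm j)%:R by [].
congr ((_ : bool)%:R); apply/eqP/eqP => [E|-> //].
move/eqP/cmP/(_ i): E; rewrite cmUU cmU.
by case: eqP.
Qed.

Lemma coord_pt_lin a i : fgpt_lin i (coord_pt a) = (coord a i)%:~R.
Proof.
rewrite raddf_sum /= (bigD1 i) //= raddfMz /= big1 ?addr0 => [|j ji].
  by rewrite fgpt_linX eqxx.
by rewrite raddfMz /= fgpt_linX eq_sym (negbTE ji) mul0rz.
Qed.

Definition fga_coord (f : P) : P0 := psubst coord_pt f.

Lemma fga_coordX a : fga_coord (psX R a) = maxval (coord_pt a).
Proof. exact: psubstX. Qed.

(** The relators vanish because [coord_pt] is additive for the group law of [F], and the closure
    follows because substitution does not lower orders. *)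
Lemma fga_coord_ideal f : f \in @fga_ideal R F M -> fga_coord f = 0.
Proof.
have C : ps_continuous (psubst coord_pt) by apply: psubst_continuous.
have Hr g : fga_relator F g -> psubst coord_pt g = 0.
  case=> [->|[a [b ->]]]; first by rewrite psubstX raddf0.
  rewrite raddfB /= psubstX raddfD /=.
  rewrite (continuous_subst2 C F (maxX R a) (maxX R b)) /= !psubstX.
  by rewrite -fgpt_addE subrr.
have H0 g : fga_ideal0 F g -> psubst coord_pt g = 0.
  elim=> [|h g' g'' Hg _ IH]; first by rewrite raddf0.
  by rewrite rmorphD rmorphM /= IH (Hr _ Hg) mulr0 addr0.
move=> /fga_idealP H; apply: ps_ge_eq => d; have [g Ig fg] := H d.
rewrite subr0 -[fga_coord f]subr0 -(H0 g Ig) -raddfB.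
by apply/psubst_ge/ps_geBP.
Qed.

Definition fga_lift (h : P0) : P := psubst (fun j => maxX R (e j)) h.

Lemma fga_liftK h : fga_coord (fga_lift h) = h.
Proof.
apply: (@continuous_morph_ext _ _ _ (psubst coord_pt \o psubst (fun j => maxX R (e j))) idfun).
- split=> [c|d f H] /=; first by rewrite !psubstC.
  by do 2 apply: psubst_ge.
- by [].
by move=> j; rewrite /= !psubstX /= coord_pt_basis.
Qed.

(* a |-> x_a and a |-> (the lift of the coordinates of x_a) are additive modulo the
   ideal for the formal group law, and agree on the basis. *)
Lemma fga_coordK f : (f - fga_lift (fga_coord f)) \in @fga_ideal R F M.
Proof.
pose N (f : P) := is_true (f \in @fga_ideal R F M).
have HN : closed_ideal N := @fga_closed_ideal R F M.
pose x (a : M) : fgl_points M F := maxX R a.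
pose z : {additive fgl_points 'I_r F -> fgl_points M F} :=
  @psubst_pt R F 'I_r M (fun j => maxX R (e j)).
have HX a : fgpt_eqv N (x a) (z (coord_pt a)).
  have x0 : fgpt_eqv N (x 0) 0.
    rewrite /fgpt_eqv /N subr0; apply/fga_idealP => d; exists (psX R 0) => //.
    rewrite -[psX _ _]addr0 -[psX _ _]mul1r; constructor; last by constructor.
    by left.
  have xD b c : fgpt_eqv N (x (b + c)) (x b + x c).
    apply/fga_idealP => d; eexists; last by [].
    rewrite -[_ - _]addr0 -[_ - _]mul1r; constructor; last by constructor.
    by right; exists b, c.
  rewrite [X in x X](coordE a) /coord_pt raddf_sum /=.
  apply: fgpt_eqv_trans (fgpt_eqv_sum HN x0 xD _ _) _ => //.
  elim/big_rec2: _ => [|j f1 f2 _ IH]; first exact: fgpt_eqv_refl.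
  apply: fgpt_eqvD => //; apply: fgpt_eqv_trans (fgpt_eqvMz HN x0 xD _ _) _ => //.
  rewrite raddfMz /= (_ : z _ = x (e j)); first exact: fgpt_eqv_refl.
  by apply: val_inj; rewrite /= psubstX.
rewrite -{1}(psubst_id f).
have -> : fga_lift (fga_coord f) = psubst (fun a => z (coord_pt a)) f.
  apply: (@continuous_morph_ext _ _ _ (psubst (fun j => maxX R (e j)) \o psubst coord_pt)
    (psubst (fun a => z (coord_pt a)))).
  - split=> [c|d g H] /=; first by rewrite !psubstC.
    by do 2 apply: psubst_ge.
  - exact: psubst_continuous.
  by move=> a; rewrite /= !psubstX.
exact: (closed_ideal_psubst HN).
Qed.

Lemma fga_coord_eq f g : pi f = pi g <-> fga_coord f = fga_coord g.
Proof.
rewrite fga_piE; split=> [/fga_coord_ideal|E].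
  by rewrite /fga_coord raddfB /= => /eqP; rewrite subr_eq0 => /eqP.
have -> : f - g = (f - fga_lift (fga_coord f)) - (g - fga_lift (fga_coord g)).
  by rewrite E; ring.
by rewrite rpredB ?fga_coordK.
Qed.

Variable i : 'I_r.
Notation x := (fga_x F (e i)).

Lemma fga_x_dvdE f : (exists u, pi f = x * u) <-> (exists v, fga_coord f = psX R i * v).
Proof.
split=> [[u]|[v Ev]].
  elim/quotW: u => u; rewrite /fga_x -rmorphM => /fga_coord_eq E.
  exists (fga_coord u); rewrite E /fga_coord rmorphM /= psubstX.
  by rewrite coord_pt_basis.
exists (pi (fga_lift v)); rewrite /fga_x -rmorphM; apply/fga_coord_eq.
rewrite Ev /fga_coord rmorphM /= psubstX.
by rewrite coord_pt_basis -{1}(fga_liftK v).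
Qed.

Lemma fga_x_reg s : x * s = 0 -> s = 0.
Proof.
elim/quotW: s => s; rewrite /fga_x -rmorphM -(rmorph0 (\pi_(fga F M)%qT)) => /fga_coord_eq E.
apply/fga_coord_eq; rewrite [RHS]raddf0; apply: (@psX_reg _ _ i).
by move: E; rewrite /fga_coord raddf0 rmorphM /= psubstX coord_pt_basis.
Qed.

Lemma fga_x_prime s t u : s * t = x * u -> (exists v, s = x * v) \/ (exists v, t = x * v).
Proof.
elim/quotW: s => s; elim/quotW: t => t E.
have : exists u, pi (s * t) = x * u by exists u; rewrite rmorphM.
move=> /fga_x_dvdE[v]; rewrite /fga_coord rmorphM => /psX_prime[H|H]; [left|right];
  exact/fga_x_dvdE.
Qed.

(** Compares constant terms. The case [k = 1] says that [(x)] is a proper ideal, and [k = 2] allows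
    halving in the local ring. *)
Lemma fga_x_dvd_nat k u : k%:R = x * u -> k = 0%N.
Proof.
move=> E; have : exists u, pi k%:R = x * u by exists u; rewrite rmorph_nat.
move=> /fga_x_dvdE[v]; rewrite /fga_coord rmorph_nat => /(congr1 (fun h : P0 => h 1%M)).
rewrite psX_mul_out ?cm1 // -(rmorph_nat (psC 'I_r)) psCE eqxx mulr1 => /eqP.
by rewrite ((pcharf0P R).1 charR) => /eqP.
Qed.

(** A multiple of [y_i] has no linear term in the other [y_j]; for [x_a] these linear coefficients
    are the coordinates of [a], which vanish in characteristic 0 only if the integers do. *)
Lemma fga_x_dvd_x a u : fga_x F a = x * u -> exists k : int, a = e i *~ k.
Proof.
move=> E; have : exists u, pi (psX R a) = x * u by exists u.
move=> /fga_x_dvdE[v]; rewrite fga_coordX => Ea.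
exists (coord a i); rewrite {1}(coordE a) (bigD1 i) //= big1 ?addr0 // => j ji.
suff -> : coord a j = 0 by rewrite mulr0z.
have : (coord a j)%:~R = 0 :> R.
  rewrite -coord_pt_lin /fgpt_lin Ea psX_mul_out //.
  by rewrite cmU (negbTE ji).
case: (coord a j) => n; first by move=> /eqP; rewrite ((pcharf0P R).1 charR) => /eqP ->.
by move=> /eqP; rewrite NegzE rmorphN oppr_eq0 ((pcharf0P R).1 charR).
Qed.

(** Setting [y_i = 0] sends [x_(e i)] to 0, hence [x_(a + k e_i)] and [x_a] to the same series. The
    two continuous morphisms compared below thus agree on the variables. *)
Lemma fga_act_sub_dvd (w : zmod_aut M) : (forall a, exists k : int, w a = a + e i *~ k) ->
  forall s : fga F M, exists u, fga_act w s - s = x * u.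
Proof.
move=> Hw; elim/quotW=> f; rewrite fga_act_pi -raddfB; apply/fga_x_dvdE.
apply: psX_dvd => m mi; rewrite /fga_coord raddfB /= pscoefD pscoefN.
rewrite -(psubst_kill F (psubst coord_pt (ps_act w f)) mi).
rewrite -(psubst_kill F (psubst coord_pt f) mi); apply/eqP; rewrite subr_eq0.
apply/eqP; congr (pscoef _ m).
pose kill := psubst (kill_var i F).
apply: (@continuous_morph_ext _ _ _ (kill \o psubst coord_pt \o ps_act w)
   (kill \o psubst coord_pt)).
- split=> [c|d g H] /=.
    rewrite -[RHS](psubstC (kill_var i F)) -[in RHS](psubstC coord_pt).
    congr (psubst _ (psubst _ _)).
    apply/pseriesP => l; rewrite psCE [LHS]psCE; congr (_ * (_ : bool)%:R).
    by rewrite -!mdeg_eq0 mdeg_act.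
  by do 2 apply: psubst_ge; move=> l lt; apply: H; rewrite mdeg_act.
- split=> [c|d g H] /=; first by rewrite !psubstC.
  by do 2 apply: psubst_ge.
move=> a; have [k Ek] := Hw a; rewrite /= ps_actX Ek !psubstX.
suff H : psubst_pt (kill_var i F) (coord_pt (a + e i *~ k)) =
  psubst_pt (kill_var i F) (coord_pt a) by exact: (congr1 (@maxval _ _) H).
rewrite raddfD raddfMz /= coord_pt_basis raddfD raddfMz /=.
have -> : psubst_pt (kill_var i F) (maxX R i) = 0.
  by apply: val_inj; rewrite /= psubstX /kill_var eqxx.
by rewrite mul0rz addr0.
Qed.

End Coordinates.

(** * Positive roots and length *)

Section SimpleRoots.
Variables (K : realType) (n : nat) (A : cartan_matrix n) (D : root_datum K A).
Notation W := (weyl D).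
Notation H := (hdual D).
Notation al := (fun i => simple_root D i : H).
Implicit Types (u v w t : W) (l : H) (i j k : 'I_n).

Lemma weyl_funD w l1 l2 : weyl_fun w (l1 + l2) = weyl_fun w l1 + weyl_fun w l2.
Proof. exact: (linearD (weyl_end w)). Qed.
Lemma weyl_funN w l : weyl_fun w (- l) = - weyl_fun w l.
Proof. exact: (linearN (weyl_end w)). Qed.
Lemma weyl_funZ w c l : weyl_fun w (c *: l) = c *: weyl_fun w l.
Proof. exact: (linearZ_LR (weyl_end w)). Qed.
Lemma weyl_funMz w l (z : int) : weyl_fun w (l *~ z) = weyl_fun w l *~ z.
Proof. exact: (raddfMz (weyl_end w)). Qed.
Lemma weyl_fun_sum w (T : Type) (r : seq T) (E : T -> H) :
  weyl_fun w (\sum_(i <- r) E i) = \sum_(i <- r) weyl_fun w (E i).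
Proof. exact: (linear_sum (weyl_end w)). Qed.
Lemma weyl_funK w l : weyl_fun w^-1%g (weyl_fun w l) = l.
Proof. by rewrite -weyl_funM mulVg weyl_fun1. Qed.
Lemma weyl_funKV w l : weyl_fun w (weyl_fun w^-1%g l) = l.
Proof. by rewrite -weyl_funM mulgV weyl_fun1. Qed.
Lemma weyl_ext u v : (forall l, weyl_fun u l = weyl_fun v l) -> u = v.
Proof. by move=> E; apply: val_inj; apply/lfunP. Qed.

Lemma sgenE i l : weyl_fun (sgen D i) l = l - l (simple_coroot D i) *: al i.
Proof. by rewrite /weyl_fun /= comp_lfun1r sreflectE. Qed.
Lemma sgen_root i j : weyl_fun (sgen D i) (al j) = al j - al i *~ A i j.
Proof. by rewrite sgenE rd_pairing scaler_int. Qed.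
Lemma sgen_self i : weyl_fun (sgen D i) (al i) = - al i.
Proof. by rewrite sgen_root gcm_diag opprD addrA subrr sub0r. Qed.
Lemma sgenK i : (sgen D i * sgen D i)%g = 1%g.
Proof. by apply: val_inj; rewrite /= !comp_lfun1r sreflectK. Qed.
Lemma sgenV i : (sgen D i)^-1%g = sgen D i.
Proof. by apply: (mulgI (sgen D i)); rewrite mulgV sgenK. Qed.
Lemma word_cons i s : word D (i :: s) = (sgen D i * word D s)%g.
Proof. by apply: val_inj => /=; rewrite comp_lfun1r. Qed.
Lemma word_cat s1 s2 : word D (s1 ++ s2) = (word D s1 * word D s2)%g.
Proof. by apply: val_inj => /=; rewrite word_end_cat. Qed.

Lemma simple_root_indep (z : 'I_n -> K[i]) : \sum_i z i *: al i = 0 -> forall i, z i = 0.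
Proof.
pose X := [tuple al i | i < n].
have fX : free X by have := simple_root_free D; rewrite /X /= /image_mem.
move/freeP: fX => fX E i; apply: fX.
by rewrite -[RHS]E; apply: eq_bigr => j _; rewrite -tnth_nth tnth_mktuple.
Qed.

Lemma simple_root_indepZ (z : 'I_n -> int) : \sum_i al i *~ z i = 0 -> forall i, z i = 0.
Proof.
move=> E i; have := @simple_root_indep (fun i => (z i)%:~R) _ i.
rewrite (eq_bigr (fun i => al i *~ z i)) => [/(_ E)/eqP|j _]; last by rewrite scaler_int.
by rewrite intr_eq0 => /eqP.
Qed.

Lemma simple_root_coefs (z y : 'I_n -> int) : \sum_i al i *~ z i = \sum_i al i *~ y i -> z =1 y.
Proof.
move=> E i; apply/eqP; rewrite -subr_eq0; apply/eqP.
apply: (@simple_root_indepZ (fun i => z i - y i)); apply/eqP.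
rewrite (eq_bigr (fun i => al i *~ z i - al i *~ y i)) => [|j _]; last by rewrite mulrzBr.
by rewrite sumrB E subrr.
Qed.

Lemma simple_rootE i : al i = \sum_j al j *~ (i == j)%:R.
Proof.
rewrite (bigD1 i) //= eqxx big1 ?addr0 // => j; rewrite eq_sym => /negbTE ->.
by rewrite mulr0z.
Qed.

Definition nonneg_root l := exists c : 'I_n -> nat, l = \sum_i al i *+ c i.

Lemma nonneg_simple i : nonneg_root (al i).
Proof.
exists (fun j => i == j); rewrite {1}(simple_rootE i); apply: eq_bigr => j _.
by case: eqP.
Qed.

Lemma nonnegD l1 l2 : nonneg_root l1 -> nonneg_root l2 -> nonneg_root (l1 + l2).
Proof.
move=> [c ->] [d ->]; exists (fun i => c i + d i)%N; rewrite -big_split.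
by apply: eq_bigr => i _; rewrite mulrnDr.
Qed.

Lemma nonnegMz l (z : int) : 0 <= z -> nonneg_root l -> nonneg_root (l *~ z).
Proof.
case: z => // m _ [c ->]; exists (fun i => c i * m)%N.
rewrite -[X in X = _]sumrMnl; apply: eq_bigr => i _; rewrite mulrnA //.
Qed.

Lemma nonneg_antisym l : nonneg_root l -> nonneg_root (- l) -> l = 0.
Proof.
move=> [c Ec] [d Ed]; have : \sum_i al i *~ (c i + d i)%:Z = 0.
  rewrite -[RHS](subrr l) {1}Ec Ed -big_split; apply: eq_bigr => i _.
  by rewrite /= PoszD mulrzDr.
move=> /simple_root_indepZ E; rewrite Ec big1 // => i _.
by have /eqP := E i; rewrite eqz_nat addn_eq0 => /andP[/eqP ->].
Qed.

Lemma weyl_fun_int w i : exists z : 'I_n -> int, weyl_fun w (al i) = \sum_j al j *~ z j.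
Proof.
have [s ->] := weylP w; elim: s => [|k s [z IH]].
  by exists (fun j => (i == j)%:R); rewrite weyl_fun1 -simple_rootE.
exists (fun j => z j - (k == j)%:R * \sum_m A k m * z m).
rewrite word_cons weyl_funM IH weyl_fun_sum.
transitivity (\sum_j (al j *~ z j - al k *~ (A k j * z j))).
  by apply: eq_bigr => j _; rewrite weyl_funMz sgen_root mulrzBl mulrzA.
rewrite sumrB -mulrz_sumr [RHS](eq_bigr (fun j => al j *~ z j -
   al j *~ ((k == j)%:R * \sum_m A k m * z m))); last by move=> j _; rewrite mulrzBr.
rewrite sumrB; congr (_ - _).
rewrite [RHS](bigD1 k) //= eqxx mul1r [X in _ = _ + X]big1 ?addr0 // => j.
rewrite eq_sym => /negbTE ->.
by rewrite mul0r mulr0z.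
Qed.

Lemma weyl_fun_neq0 w i : weyl_fun w (al i) != 0.
Proof.
apply/eqP => E; have : al i = 0 by rewrite -(weyl_funK w (al i)) E [LHS]linear0.
rewrite simple_rootE => /simple_root_indepZ/(_ i) /=.
by rewrite eqxx.
Qed.

Lemma wlength_word s : (wlength (word D s) <= size s)%N.
Proof.
rewrite /wlength; case: ex_minnP => k _ H; apply: H.
by apply/asboolP; exists s.
Qed.
Lemma reducedP w : exists s, reduced_seq s w.
Proof.
rewrite /reduced_seq /wlength; case: ex_minnP => k /asboolP[s sk ws] _.
by exists s.
Qed.
Lemma wlengthM u v : (wlength (u * v)%g <= wlength u + wlength v)%N.
Proof.
have [s [us <-]] := reducedP u; have [r [vr <-]] := reducedP v.
by rewrite us vr -word_cat -size_cat wlength_word.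
Qed.
Lemma wlength_sgen i : (wlength (sgen D i) <= 1)%N.
Proof. exact: (wlength_word [:: i]). Qed.
Lemma wlength_sgenr w i : (wlength w <= (wlength (w * sgen D i)%g).+1)%N.
Proof.
rewrite -{1}(mulg1 w) -(sgenK i) mulgA -addn1.
by apply: leq_trans (wlengthM _ _) _; rewrite leq_add2l wlength_sgen.
Qed.
End SimpleRoots.

(** The step of [dword_state] that applies [s_i], with [u] and [v] the two simple roots; the next
    lemma is the step for [s_j]. *)
Lemma scale_reflect1 (F : comNzRingType) (V : lmodType F) (l u v : V) (x p q : F) (z : int) :
  l - x *: u - p *: (- u) - q *: (v - u *~ z) =
  l - (x - p + (- z)%:~R * q) *: u - q *: v.
Proof.
rewrite scalerN opprK scalerBr -scaler_int scalerA !scalerDl !scaleNr mulrNz mulNr scaleNr.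
by rewrite (mulrC q) !opprD !opprK !addrA -!addrA; do 2 congr (_ + _); rewrite addrCA addrC addrA.
Qed.

Lemma scale_reflect2 (F : comNzRingType) (V : lmodType F) (l u v : V) (y p q : F) (z : int) :
  l - y *: v - p *: (u - v *~ z) - q *: (- v) =
  l - p *: u - (y - q + (- z)%:~R * p) *: v.
Proof.
rewrite scalerN opprK scalerBr -scaler_int scalerA !scalerDl !scaleNr mulrNz mulNr scaleNr.
rewrite (mulrC p) !opprD !opprK !addrA [LHS]addrAC; congr (_ + _).
by congr (_ + _); rewrite addrAC.
Qed.

(** * Rank two: alternating words and braid relations *)

Section Dihedral.
Variables (K : realType) (n : nat) (A : cartan_matrix n) (D : root_datum K A).
Notation W := (weyl D).
Notation H := (hdual D).
Notation al := (fun i => simple_root D i : H).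
Variables (i j : 'I_n) (ij : i != j).

Local Notation a := (- A i j).
Local Notation b := (- A j i).

Definition dletter (c : bool) : 'I_n := if c then i else j.
Definition dword (s : seq bool) : W := word D (map dletter s).

(** Letters alternate and the rightmost one is [c]; words grow on the left, so the root [al i] is
    acted on by one more reflection at each step. *)
Fixpoint altseq (c : bool) (k : nat) : seq bool :=
  if k is k'.+1 then (c (+) odd k') :: altseq c k' else [::].

Lemma altseq_add c k m : exists2 s, altseq c (k + m) = s ++ altseq c m & size s = k.
Proof.
elim: k => [|k [s Es sk]]; first by exists [::].
by exists ((c (+) odd (k + m)) :: s); rewrite /= ?Es ?sk.
Qed.
Lemma altseq_rcons c k : exists2 s, altseq c k.+1 = rcons s c & size s = k.
Proof.
have [s Es sk] := altseq_add c k 1; exists s => //.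
by rewrite -addn1 Es /= addbF cats1.
Qed.

Lemma dword_cons c s : dword (c :: s) = (sgen D (dletter c) * dword s)%g.
Proof. exact: word_cons. Qed.

Fixpoint dcoef (k : nat) : int * int :=
  if k is k'.+1 then
    let: (p, q) := dcoef k' in if odd k' then (- p + a * q, q) else (p, - q + b * p)
  else (1, 0).

Lemma dword_root k : weyl_fun (dword (altseq false k)) (al i) =
  al i *~ (dcoef k).1 + al j *~ (dcoef k).2.
Proof.
elim: k => [|k IH]; first by rewrite weyl_fun1 addr0.
rewrite [altseq _ _]/= dword_cons weyl_funM.
rewrite IH.
rewrite weyl_funD.
rewrite (weyl_funMz _ (al i)) (weyl_funMz _ (al j)).
rewrite [dcoef k.+1]/=.
case: (dcoef k) => p q /=; case: (odd k); rewrite /dletter /= sgen_self sgen_root.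
  rewrite mulNrz mulrzBl mulrzDr mulrNz -!mulrzA mulNr mulrNz.
  by rewrite [al j *~ q - _]addrC addrA.
by rewrite mulNrz mulrzBl mulrzDr mulrNz -!mulrzA mulNr mulrNz -addrA [- _ + - _]addrC.
Qed.

Lemma ge0a : 0 <= a. Proof. by rewrite oppr_ge0 gcm_off. Qed.
Lemma ge0b : 0 <= b. Proof. by rewrite oppr_ge0 gcm_off // eq_sym. Qed.

(** The inequality is the invariant of the induction: multiplied by [a] or [b], and combined with
    [a b >= 4], it bounds the coordinate about to be reflected by half of what is added to it. *)
Lemma dcoef_infinite k : 4 <= a * b ->
  let: (p, q) := dcoef k in
  [/\ 0 <= p, 0 <= q & if odd k then b * p <= 2 * q else a * q <= 2 * p].
Proof.
move=> ab4; have a0 := ge0a; have b0 := ge0b.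
elim: k => [|k] /=; first by rewrite mulr0.
case: (dcoef k) => p q; case: (odd k) => /= -[p0 q0 E].
  have H1 := ler_wpM2l a0 E; have H2 := ler_wpM2r p0 ab4.
  by split; lia.
have H1 := ler_wpM2l b0 E; have H2 := ler_wpM2r q0 ab4.
by split; lia.
Qed.

Section Braid.
Variables (x y : K[i]).

(** The coordinates of [l - w(l)] on the two simple roots, for [w] the word [s], in terms of the
    pairings [x], [y] of [l] with the two coroots. An equality of words in [W] becomes an identity
    that [ring] checks. *)
Fixpoint dstate (s : seq bool) : K[i] * K[i] :=
  if s is c :: s' then
    let: (p, q) := dstate s' in
    if c then (x - p + a%:~R * q, q) else (p, y - q + b%:~R * p)
  else (0, 0).

End Braid.

Lemma dword_state (l : H) s (dstate := dstate (l (simple_coroot D i)) (l (simple_coroot D j))) :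
  weyl_fun (dword s) l = l - (dstate s).1 *: al i - (dstate s).2 *: al j.
Proof.
elim: s => [|c s IH]; first by rewrite weyl_fun1 !scale0r !subr0.
rewrite dword_cons weyl_funM IH !weyl_funD !weyl_funN !weyl_funZ /=.
case: (dstate s) => p q; case: c; rewrite /dletter /= sgenE sgen_self sgen_root.
  exact: scale_reflect1.
exact: scale_reflect2.
Qed.

(** For [a b] = 0, 1, 2, 3 the two alternating words of length [m] = 2, 3, 4, 6 coincide, and the
    finitely many roots below [m] are computed. *)
Lemma dihedral_cases :
  4 <= a * b \/ exists2 m, (0 < m)%N /\ dword (altseq false m) = dword (altseq true m) &
    forall k, (k < m)%N -> 0 <= (dcoef k).1 /\ 0 <= (dcoef k).2.
Proof.
have [ab4|ab3] := leP 4 (a * b); [by left | right].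
have Hw s1 s2 : (forall x y : K[i], dstate x y s1 = dstate x y s2) -> dword s1 = dword s2.
  by move=> E; apply: weyl_ext => l; rewrite !dword_state E.
have A0 := gcm_zero A i j; have a0 := ge0a; have b0 := ge0b.
have : [\/ a = 0 /\ b = 0, a = 1 /\ b = 1, (a = 1 /\ b = 2) \/ (a = 2 /\ b = 1)
       | (a = 1 /\ b = 3) \/ (a = 3 /\ b = 1)].
  (* By [gcm_zero] either both of [a], [b] vanish or neither does, so [a b < 4] leaves only the
     listed pairs. *)
  have [Ea|Na] := eqVneq a 0.
    by constructor 1; split=> //; have /A0 -> : A i j = 0 by lia.
  have Nb : b != 0 by apply: contra_neq Na => Eb; have /A0 -> : A j i = 0 by lia.
  have a3 : a < 4 by nia.
  have b3 : b < 4 by nia.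
  have Ha : a = 1 \/ a = 2 \/ a = 3 by lia.
  have Hb : b = 1 \/ b = 2 \/ b = 3 by lia.
  case: Ha => [|[]] Ea; case: Hb => [|[]] Eb; rewrite Ea Eb in ab3 *;
    try (by lia); [constructor 2|constructor 3; left|constructor 4; left
      |constructor 3; right|constructor 4; right] => //.
move=> [] => [[Ea Eb]|[Ea Eb]|[[Ea Eb]|[Ea Eb]]|[[Ea Eb]|[Ea Eb]]].
- exists 2%N; first by split=> //; apply: Hw => x y; rewrite /= Ea Eb; congr (_, _); ring.
  by do 2 (case; first by rewrite /= ?Ea ?Eb); case.
- exists 3%N; first by split=> //; apply: Hw => x y; rewrite /= Ea Eb; congr (_, _); ring.
  by do 3 (case; first by rewrite /= ?Ea ?Eb); case.
- exists 4%N; first by split=> //; apply: Hw => x y; rewrite /= Ea Eb; congr (_, _); ring.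
  by do 4 (case; first by rewrite /= ?Ea ?Eb); case.
- exists 4%N; first by split=> //; apply: Hw => x y; rewrite /= Ea Eb; congr (_, _); ring.
  by do 4 (case; first by rewrite /= ?Ea ?Eb); case.
- exists 6%N; first by split=> //; apply: Hw => x y; rewrite /= Ea Eb; congr (_, _); ring.
  by do 6 (case; first by rewrite /= ?Ea ?Eb); case.
exists 6%N; first by split=> //; apply: Hw => x y; rewrite /= Ea Eb; congr (_, _); ring.
by do 6 (case; first by rewrite /= ?Ea ?Eb); case.
Qed.
End Dihedral.

Section RootSigns.
Variables (K : realType) (n : nat) (A : cartan_matrix n) (D : root_datum K A).
Notation W := (weyl D).
Notation H := (hdual D).
Notation al := (fun i => simple_root D i : H).
Implicit Types (u v w t : W) (l g : H) (i j k : 'I_n).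

(* Write w = v x with x an alternating word in s_i, s_j ending in s_j, of maximal
   length such that lengths add up. Then v(a_i), v(a_j) >= 0 by induction, and x is
   too short for the braid relation to apply, so x(a_i) is a nonnegative
   combination of a_i and a_j. *)
Lemma wlength_nonneg w i : (wlength w <= wlength (w * sgen D i)%g)%N ->
  nonneg_root (weyl_fun w (al i)).
Proof.
move: {2}(wlength w).+1 (leqnn (wlength w).+1) => d.
elim: d w i => [//|d IH] w i wd le.
have [s [ws sl]] := reducedP w.
elim/last_ind: s ws sl => [|s j _] ws sl.
  by rewrite ws weyl_fun1; apply: nonneg_simple.
have ws' : w = (word D s * sgen D j)%g by rewrite ws -cats1 word_cat.
rewrite size_rcons in sl.
have ij : i != j.
  apply/eqP => ij; move: le; rewrite ws' -mulgA ij sgenK mulg1 -ws' leqNgt.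
  by rewrite -sl ltnS wlength_word.
pose x (k : nat) := dword D i j (altseq false k).
pose P (k : nat) := `[< exists2 v, w = (v * x k)%g & (wlength v + k = wlength w)%N >].
have P1 : P 1%N.
  apply/asboolP; exists (word D s); first by rewrite ws'.
  apply/eqP; rewrite eqn_leq; apply/andP; split.
    by rewrite -sl addn1 ltnS wlength_word.
  rewrite {1}ws'; apply: leq_trans (wlengthM _ _) _.
  by rewrite leq_add2l wlength_sgen.
have Pmax (k : nat) : P k -> (k <= wlength w)%N.
  by move=> /asboolP[v _ <-]; rewrite leq_addl.
case: (ex_maxnP (ex_intro _ 1%N P1) Pmax) => k /asboolP[v wv vk] kmax.
have k0 : (0 < k)%N := kmax _ P1.
have xS (m : nat) : x m.+1 = (sgen D (dletter i j (odd m)) * x m)%g by exact: dword_cons.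
have xl (m : nat) : (wlength (x m) <= m)%N.
  elim: m => [|m IHm]; first exact: (wlength_word D [::]).
  rewrite xS; apply: leq_trans (wlengthM _ _) _.
  by rewrite -add1n leq_add ?wlength_sgen.
(* Neither letter shortens [v]: the one that would prolong the alternation, by maximality of [k];
   the other, which is the first letter of [x k], because it would cancel and give a word for [w]
   that is too short. *)
have Hv c : (wlength v <= wlength (v * sgen D (dletter i j c))%g)%N.
  rewrite leqNgt; apply/negP => lt.
  have [ck|ck] := eqVneq c (odd k).
    suff /kmax : P k.+1 by rewrite ltnn.
    apply/asboolP; exists (v * sgen D (dletter i j c))%g.
      by rewrite xS -ck mulgA -(mulgA v) sgenK mulg1.
    have := wlength_sgenr v (dletter i j c); move: lt vk; lia.
  case: k k0 wv vk ck {kmax} => // k _ wv vk ck.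
  have Ec : c = odd k by move: ck => /=; case: c {lt}; case: (odd k).
  have : (wlength w <= wlength (v * sgen D (dletter i j c))%g + k)%N.
    rewrite wv xS -Ec mulgA; apply: leq_trans (wlengthM _ _) _.
    by rewrite leq_add2l xl.
  by move: lt; lia.
have lv : (wlength v < d)%N by move: wd vk k0; lia.
have vi := IH v i lv (Hv true); have vj := IH v j lv (Hv false).
suff [p0 q0] : 0 <= (dcoef A i j k).1 /\ 0 <= (dcoef A i j k).2.
  rewrite wv weyl_funM dword_root // weyl_funD (weyl_funMz _ (al i)) (weyl_funMz _ (al j)).
  by apply: nonnegD; apply: nonnegMz.
have [ab4|[m [m0 Em] Hm]] := dihedral_cases D ij.
  by have := dcoef_infinite ij k ab4; case: (dcoef _ _ _ _) => p q [].
have [|km] := ltnP k m; first exact: Hm.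
(* For [k >= m] the braid relation makes the last [m] letters of [x k] end in [s_i]. This letter
   cancels in [w s_i], whose length is then at most [wlength v + k - 1], against [le]. *)
have [t Et tk] := altseq_add false (k - m) m.
have [r Er rm] := altseq_rcons true m.-1.
rewrite subnK // in Et; rewrite prednK // in Er.
have dwl q : (wlength (dword D i j q) <= size q)%N.
  by rewrite -(size_map (dletter i j)) wlength_word.
have dwM q1 q2 : dword D i j (q1 ++ q2) = (dword D i j q1 * dword D i j q2)%g.
  by rewrite /dword map_cat word_cat.
have Ew : (w * sgen D i = v * (dword D i j t * dword D i j r))%g.
  rewrite wv /x Et dwM Em Er -cats1 dwM -!mulgA.
  rewrite (_ : dword D i j [:: true] = sgen D i) // sgenK mulg1 //.
exfalso; have := wlengthM v (dword D i j t * dword D i j r)%g; rewrite -Ew.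
have := wlengthM (dword D i j t) (dword D i j r).
by have := dwl t; have := dwl r; rewrite tk rm; move: le vk km m0; lia.
Qed.
End RootSigns.

(** * Reflections and the exchange condition *)

Section Reflections.
Variables (K : realType) (n : nat) (A : cartan_matrix n) (D : root_datum K A).
Notation W := (weyl D).
Notation H := (hdual D).
Notation al := (fun i => simple_root D i : H).
Implicit Types (u v w t y : W) (l g : H) (i j k : 'I_n).

Definition hroot g := exists w i, g = weyl_fun w (al i).
(** A relation, since a root can be written as [w(al i)] in several ways; that [g] determines [t] is
    [hrefl_uniq]. *)
Definition hrefl g t := exists w i, g = weyl_fun w (al i) /\ t = (w * sgen D i * w^-1)%g.

Lemma hroot_simple i : hroot (al i).
Proof. by exists 1%g, i; rewrite weyl_fun1. Qed.
Lemma hroot_act w g : hroot g -> hroot (weyl_fun w g).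
Proof. by move=> [y [i ->]]; exists (w * y)%g, i; rewrite weyl_funM. Qed.
Lemma hrefl_root g t : hrefl g t -> hroot g.
Proof. by move=> [w [i [-> _]]]; exists w, i. Qed.
Lemma hrefl_simple i : hrefl (al i) (sgen D i).
Proof. by exists 1%g, i; rewrite weyl_fun1 mul1g invg1 mulg1. Qed.
Lemma hrefl_conj w g t : hrefl g t -> hrefl (weyl_fun w g) (w * t * w^-1)%g.
Proof.
move=> [y [i [-> ->]]]; exists (w * y)%g, i.
by rewrite weyl_funM invMg !mulgA.
Qed.
Lemma hrefl_opp g t : hrefl g t -> hrefl (- g) t.
Proof.
move=> [y [i [-> ->]]]; exists (y * sgen D i)%g, i.
by rewrite weyl_funM sgen_self weyl_funN invMg sgenV !mulgA -(mulgA y _ (sgen D i)) sgenK mulg1.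
Qed.
Lemma hroot_opp g : hroot g -> hroot (- g).
Proof. by move=> [w [i ->]]; exists (w * sgen D i)%g, i; rewrite weyl_funM sgen_self weyl_funN. Qed.
Lemma hrefl_self g t : hrefl g t -> weyl_fun t g = - g.
Proof.
by move=> [w [i [-> ->]]]; rewrite !weyl_funM weyl_funK sgen_self weyl_funN.
Qed.
Lemma hreflK g t : hrefl g t -> (t * t)%g = 1%g.
Proof.
move=> [w [i [_ ->]]]; rewrite !mulgA mulgKV -(mulgA w _ (sgen D i)) sgenK mulg1.
exact: mulgV.
Qed.
Lemma hreflV g t : hrefl g t -> t^-1%g = t.
Proof. by move=> Ht; apply: (mulgI t); rewrite mulgV (hreflK Ht). Qed.
Lemma hrefl_reflection g t : hrefl g t -> is_reflection t.
Proof. by move=> [w [i [_ ->]]]; exists w, i. Qed.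

Lemma hroot_neq0 g : hroot g -> g != 0.
Proof. by move=> [w [i ->]]; apply: weyl_fun_neq0. Qed.

Lemma hroot_sign g : hroot g -> nonneg_root g \/ nonneg_root (- g).
Proof.
move=> [w [i ->]]; have [le|lt] := leqP (wlength w) (wlength (w * sgen D i)%g).
  by left; apply: wlength_nonneg.
right; rewrite -weyl_funN -sgen_self -weyl_funM; apply: wlength_nonneg.
by rewrite -mulgA sgenK mulg1 ltnW.
Qed.

Lemma hroot_sign_excl g : hroot g -> nonneg_root g -> nonneg_root (- g) -> False.
Proof. by move=> /hroot_neq0/eqP g0 p q; apply: g0; apply: nonneg_antisym. Qed.

(* Some w-translate of the root g is a simple root, with coefficient 1 = z * c. *)
Lemma hroot_indivisible g h (z : int) : hroot g -> hroot h -> g = h *~ z -> z = 1 \/ z = -1.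
Proof.
move=> [w [i ->]] [y [j ->]] /(congr1 (weyl_fun w^-1%g)).
rewrite weyl_funK weyl_funMz -weyl_funM; have [c ->] := weyl_fun_int (w^-1 * y)%g j.
rewrite (simple_rootE D i) mulrz_suml.
rewrite [RHS](eq_bigr (fun k => al k *~ (c k * z))) => [|k _]; last by rewrite mulrzA.
move=> /simple_root_coefs/(_ i); rewrite eqxx => /esym/eqP E.
have : `|z|%N == 1%N.
  have : (`|c i| * `|z|)%N = 1%N by rewrite -abszM (eqP E).
  by move=> /eqP; rewrite muln_eq1 => /andP[].
by case: z {E} => m; rewrite ?abszE /= => /eqP E; [left|right]; lia.
Qed.

(** The coefficient of [al j] is 1, so the root cannot be negative, whatever the complex number
    [c]. *)
Lemma nonneg_off i j (c : K[i]) : j != i -> hroot (al j - c *: al i) ->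
  nonneg_root (al j - c *: al i).
Proof.
move=> ji hr; have [//|[d Ed]] := hroot_sign hr; exfalso.
have := @simple_root_indep _ _ _ D (fun k => (k == j)%:R - c * (k == i)%:R + (d k)%:R) _ j.
rewrite eqxx (negbTE ji) mulr0 subr0 => E.
suff /E/eqP : \sum_k ((k == j)%:R - c * (k == i)%:R + (d k)%:R) *: al k = 0.
  by rewrite -(natrD _ 1%N) pnatr_eq0.
transitivity (al j - c *: al i + - (al j - c *: al i)); last by rewrite subrr.
rewrite Ed; under eq_bigr => k _ do rewrite scalerDl scalerBl -scalerA.
rewrite big_split sumrB /=; congr (_ - _ + _).
- rewrite (bigD1 j) //= eqxx scale1r big1 ?addr0 // => k /negbTE ->.
  by rewrite scale0r.
- rewrite -scaler_sumr (bigD1 i) //= eqxx scale1r big1 ?addr0 // => k /negbTE ->.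
  by rewrite scale0r.
by apply: eq_bigr => k _; rewrite scaler_nat.
Qed.

(** [s_i] changes only the coefficient of [al i]. If the image were negative, all other coefficients
    of [g] would vanish, and indivisibility of roots would give [g = al i]. *)
Lemma sgen_nonneg i g : hroot g -> nonneg_root g -> g <> al i ->
  nonneg_root (weyl_fun (sgen D i) g).
Proof.
move=> hg [c Ec] gi; have hs := hroot_act (sgen D i) hg.
have [//|[d Ed]] := hroot_sign hs; exfalso.
have Z k : k != i -> c k = 0%N.
  move=> ki; have := @simple_root_indep _ _ _ D (fun k => (c k)%:R
     - g (simple_coroot D i) * (k == i)%:R + (d k)%:R) _ k.
  rewrite (negbTE ki) mulr0 subr0 => E.
  suff /E/eqP : \sum_k ((c k)%:R - g (simple_coroot D i) * (k == i)%:R + (d k)%:R)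
    *: al k = 0 by rewrite -natrD pnatr_eq0 addn_eq0 => /andP[/eqP].
  rewrite -[RHS](subrr (weyl_fun (sgen D i) g)) Ed.
  under eq_bigr => m _ do rewrite scalerDl scalerBl -scalerA.
  rewrite big_split sumrB /= sgenE; congr (_ - _ + _).
  - by rewrite Ec; apply: eq_bigr => m _; rewrite scaler_nat.
  - rewrite -scaler_sumr (bigD1 i) //= eqxx scale1r big1 ?addr0 // => m /negbTE ->.
    by rewrite scale0r.
  by apply: eq_bigr => m _; rewrite scaler_nat.
have Eg : g = al i *~ (c i)%:Z.
  rewrite Ec (bigD1 i) //= big1 ?addr0 // => k ki.
  by rewrite Z.
have [c1|c1] := hroot_indivisible hg (hroot_simple i) Eg; last by [].
by apply: gi; rewrite Eg c1.
Qed.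

(** If a reduced word of [w] ends in [s_j], then [w(al j)] is negative; so the word is empty. *)
Lemma weyl_nonneg_eq1 w : (forall i, nonneg_root (weyl_fun w (al i))) -> w = 1%g.
Proof.
move=> Hw; have [s [ws sl]] := reducedP w.
elim/last_ind: s ws sl => [//|s j _] ws sl; exfalso.
have ws' : w = (word D s * sgen D j)%g by rewrite ws -cats1 word_cat.
apply: (hroot_sign_excl (hroot_act w (hroot_simple j))) (Hw j) _.
rewrite ws' weyl_funM sgen_self weyl_funN opprK; apply: wlength_nonneg.
rewrite -ws' -sl size_rcons; apply: leq_trans (leqnSn _).
exact: wlength_word.
Qed.

(* s_i t fixes a_i and changes a_j by a multiple of a_i, so it maps every simple root
   to a positive root. *)
Lemma hrefl_simple_uniq i t : hrefl (al i) t -> t = sgen D i.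
Proof.
move=> Ht; have [y [k [Ei Et]]] := Ht; apply: (mulgI (sgen D i)); rewrite sgenK.
apply: weyl_nonneg_eq1 => j; rewrite weyl_funM.
have [->|ji] := eqVneq j i.
  by rewrite (hrefl_self Ht) weyl_funN sgen_self opprK; apply: nonneg_simple.
have Etj : weyl_fun t (al j) = al j -
    (weyl_fun y^-1%g (al j) : H) (simple_coroot D k) *: al i.
  by rewrite Et !weyl_funM sgenE weyl_funD weyl_funKV weyl_funN weyl_funZ -Ei.
set c := (_ : H) _ in Etj.
have : hroot (weyl_fun (sgen D i) (weyl_fun t (al j))).
  by do 2 apply: hroot_act; apply: hroot_simple.
rewrite Etj weyl_funD weyl_funN weyl_funZ sgen_self sgenE rd_pairing scalerN opprK.
rewrite -addrA -[_ + _ *: _]opprK opprD opprK -scalerBl.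
exact: nonneg_off.
Qed.

Lemma hrefl_uniq g t t' : hrefl g t -> hrefl g t' -> t = t'.
Proof.
move=> [y [i [-> ->]]] /(hrefl_conj y^-1%g); rewrite weyl_funK invgK.
by move=> /hrefl_simple_uniq <-; rewrite !mulgA mulgV mul1g mulgK.
Qed.

(** The strong exchange condition. The root is pushed through the word and stays positive until it
    is the simple root of the current letter, which is deleted. The last clause locates [g] among
    the inversions of the word, which puts [x_g] among the factors of [inversion_prod]. *)
Lemma reflection_deletion s g t : hrefl g t -> nonneg_root g ->
  nonneg_root (- weyl_fun (word D s)^-1%g g) ->
  exists k : nat, [/\ (k < size s)%N,
    (t * word D s)%g = word D (take k s ++ drop k.+1 s)
    & exists2 j, g = weyl_fun (word D (take k s)) (al j) & drop k s = j :: drop k.+1 s].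
Proof.
elim: s g t => [|i s IH] g t Ht g0 N.
  by case: (hroot_sign_excl (hrefl_root Ht) g0); rewrite invg1 weyl_fun1 in N.
have [gi|gi] := pselect (g = al i).
  rewrite gi in Ht *; rewrite (hrefl_simple_uniq Ht); exists 0%N; split=> //.
    by rewrite word_cons mulgA sgenK mul1g /= drop0.
  by exists i; rewrite ?weyl_fun1 /= ?drop0.
have Ht' := hrefl_conj (sgen D i) Ht.
have [|k [ks E [j gj dj]]] := IH _ _ Ht' (sgen_nonneg (hrefl_root Ht) g0 gi).
  by move: N; rewrite word_cons invMg sgenV weyl_funM.
exists k.+1; split=> //.
  by rewrite /= !word_cons -E !mulgA sgenK mul1g sgenV.
exists j => //=; rewrite word_cons weyl_funM -gj -weyl_funM sgenK weyl_fun1 //.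
Qed.

Lemma wlength_refl_lt w g t : hrefl g t -> nonneg_root g ->
  nonneg_root (- weyl_fun w^-1%g g) -> (wlength (t * w)%g < wlength w)%N.
Proof.
move=> Ht g0 N; have [s [ws sl]] := reducedP w; rewrite ws in N *.
have [k [ks -> _]] := reflection_deletion Ht g0 N.
rewrite -ws -sl; apply: leq_ltn_trans (wlength_word _ _) _.
by rewrite size_cat size_take size_drop ks; lia.
Qed.

Lemma wlength_refl_gt w g t : hrefl g t -> nonneg_root g ->
  nonneg_root (weyl_fun w^-1%g g) -> (wlength w < wlength (t * w)%g)%N.
Proof.
move=> Ht g0 N; have := wlength_refl_lt (w := (t * w)%g) Ht g0.
rewrite mulgA (hreflK Ht) mul1g; apply.
by rewrite invMg (hreflV Ht) weyl_funM (hrefl_self Ht) weyl_funN opprK.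
Qed.

Lemma wlength_refl_neq w g t : hrefl g t -> nonneg_root g ->
  (wlength w < wlength (t * w)%g)%N -> nonneg_root (weyl_fun w^-1%g g).
Proof.
move=> Ht g0 lt; have [//|N] := hroot_sign (hroot_act w^-1%g (hrefl_root Ht)).
by have := wlength_refl_lt Ht g0 N; rewrite ltnNge ltnW.
Qed.
End Reflections.

(** * The Bruhat order *)

Section Bruhat.
Variables (K : realType) (n : nat) (A : cartan_matrix n) (D : root_datum K A).
Notation W := (weyl D).
Notation H := (hdual D).
Notation al := (fun i => simple_root D i : H).
Implicit Types (u v w t y : W) (l g : H) (i j k : 'I_n).

Lemma reflection_pos t : is_reflection t -> exists2 g, hrefl g t & nonneg_root g.
Proof.
move=> [w [i Et]]; have Ht : hrefl (weyl_fun w (al i)) t by exists w, i.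
have [p|p] := hroot_sign (hrefl_root Ht); first by eexists; [exact: Ht | ].
by eexists; [exact: (hrefl_opp Ht) | ].
Qed.

Lemma is_reflection_conj w t : is_reflection t -> is_reflection (w * t * w^-1)%g.
Proof. by move=> [y [i ->]]; exists (w * y)%g, i; rewrite invMg !mulgA. Qed.

Lemma bruhat_stepl u v t : bruhat u v -> is_reflection t ->
  (wlength v < wlength (t * v)%g)%N -> bruhat u (t * v)%g.
Proof.
move=> uv Ht lt; have E : (t * v = v * (v^-1 * t * v))%g by rewrite !mulgA mulgV mul1g.
rewrite E; apply: bruhat_step => //; last by rewrite -E.
by rewrite -{2}(invgK v); apply: is_reflection_conj.
Qed.

Lemma bruhat_trans v u w : bruhat u v -> bruhat v w -> bruhat u w.
Proof. by move=> uv; elim=> // v' t _ IH Ht lt; apply: bruhat_step. Qed.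

Lemma bruhat_wlength u v : bruhat u v -> u = v \/ (wlength u < wlength v)%N.
Proof.
elim=> [|v' t _ [-> |IH] Ht lt]; [by left | by right | right].
exact: ltn_trans IH lt.
Qed.

Lemma bruhat_sgen w i : (wlength w < wlength (sgen D i * w)%g)%N -> bruhat w (sgen D i * w)%g.
Proof.
apply: bruhat_stepl; first exact: bruhat_refl.
exact: hrefl_reflection (hrefl_simple D i).
Qed.

(** A step from [v] to [r v] becomes a step from [s_i v] to [s_i r v], still upwards because [s_i]
    keeps the positive root of [r] positive, unless that root is [al i]; in this case
    [r v = s_i v]. *)
Lemma bruhat_lift u w i : bruhat u w ->
  bruhat (sgen D i * u)%g w \/ bruhat (sgen D i * u)%g (sgen D i * w)%g.
Proof.
elim=> [|v t uv IH Ht lt]; first by right; apply: bruhat_refl.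
case: IH => [IH|IH]; first by left; apply: bruhat_step.
pose r := (v * t * v^-1)%g; have Ert : (v * t = r * v)%g by rewrite /r mulgKV.
have [g Hg g0] := reflection_pos (is_reflection_conj v Ht); rewrite -/r in Hg.
rewrite Ert in lt *; have vg := wlength_refl_neq Hg g0 lt.
have [gi|gi] := pselect (g = al i).
  by left; rewrite gi in Hg; rewrite (hrefl_simple_uniq Hg).
right; have Hg' := hrefl_conj (sgen D i) Hg.
have -> : (sgen D i * (r * v) = (sgen D i * r * (sgen D i)^-1) * (sgen D i * v))%g.
  by rewrite -!mulgA mulKg.
apply: bruhat_stepl => //; first exact: hrefl_reflection Hg'.
apply: (wlength_refl_gt Hg'); first exact: sgen_nonneg (hrefl_root Hg) g0 gi.
by rewrite invMg weyl_funM weyl_funK.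
Qed.

Lemma bruhat_up u w i : bruhat u w -> (wlength w < wlength (sgen D i * w)%g)%N ->
  bruhat u (sgen D i * w)%g /\ bruhat (sgen D i * u)%g (sgen D i * w)%g.
Proof.
move=> uw /bruhat_sgen sw; split; first exact: bruhat_trans sw.
by have [H|//] := bruhat_lift i uw; apply: bruhat_trans sw.
Qed.
End Bruhat.

(** * Localization at a root *)

Section LocalizationFacts.
Variables (S : comNzRingType) (X : set S).
Notation Q := (loc X).
Implicit Types (s t d : S) (q r : Q).

Lemma pz_invP q r : q * r = 1 -> pz_inv q = r.
Proof.
move=> E; rewrite /pz_inv; case: xgetP => [r' _ /= E'|/(_ r)//].
by rewrite -[r']mul1r -E mulrAC [q * r']E' mul1r.
Qed.

Lemma denom_unit d : d \in denom X -> exists r, to_loc X d * r = 1.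
Proof.
move=> Hd; exists (mkloc (Frac 1 Hd)).
have -> : to_loc X d * mkloc (Frac 1 Hd) = loc_mul (mkloc (frac_of X d)) (mkloc (Frac 1 Hd)) by [].
by rewrite loc_mulE; apply: mkloc_eq => /=; rewrite !mulr1 !mul1r.
Qed.

Lemma denom_mem d : X d -> d \in denom X.
Proof.
move=> Xd; apply/asboolP; exists [:: d]; last by rewrite big_seq1.
by move=> x; rewrite inE => /eqP ->.
Qed.

Lemma loc_reprE q : q * to_loc X (fden (repr q)) = to_loc X (fnum (repr q)).
Proof.
rewrite -{1}[q]reprK; set p := repr q.
have -> : \pi_Q%qT p * to_loc X (fden p) = loc_mul (mkloc p) (mkloc (frac_of X (fden p))) by [].
by rewrite loc_mulE; apply: mkloc_eq => /=; rewrite !mulr1.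
Qed.

Lemma to_loc_eq s t : to_loc X s = to_loc X t -> exists2 u, u \in denom X & u * s = u * t.
Proof. by move=> /mklocE[u Hu] /=; rewrite !mulr1 => E; exists u. Qed.

Lemma to_loc_inj : (forall x, X x -> forall s, x * s = 0 -> s = 0) -> injective (to_loc X).
Proof.
move=> reg s t /to_loc_eq[u /asboolP[l Hl ->]] E.
apply/eqP; rewrite -subr_eq0; apply/eqP; move: E => /eqP; rewrite -subr_eq0 -mulrBr => /eqP.
elim: l Hl => [|y l IH] Hl; first by rewrite big_nil mul1r.
rewrite big_cons -mulrA => /(reg _ (Hl _ (mem_head _ _))); apply: IH => z zl.
by apply: Hl; rewrite inE zl orbT.
Qed.
End LocalizationFacts.

Lemma unit_cancel (Q : comPzRingType) (u r a b : Q) : u * r = 1 -> u * a = u * b -> a = b.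
Proof. by move=> E H; rewrite -[a]mul1r -[b]mul1r -E mulrAC H mulrAC. Qed.

Lemma ps_actE (R : comNzRingType) (M : zmodType) (w : zmod_aut M) (f : pseries R M) m :
  ps_act w f m = f (cm_act w m).
Proof. by []. Qed.

Lemma fgl_opp_factor (S : comNzRingType) (a b h : S) :
  a + b + a * b * h = 0 -> a = b * (- 1 - a * h).
Proof.
rewrite -addrA => /eqP; rewrite addr_eq0 => /eqP {1}->.
by rewrite mulrBr mulrN1 opprD mulrCA mulrA.
Qed.

Lemma frac_mulE (Q : comPzRingType) (q r d e s t : Q) : q * d = s -> r * e = t ->
  (q * r) * (d * e) = s * t.
Proof. by move=> <- <-; rewrite mulrACA. Qed.

Lemma frac_addE (Q : comPzRingType) (q r d e s t : Q) : q * d = s -> r * e = t ->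
  (q + r) * (d * e) = s * e + t * d.
Proof. by move=> <- <-; rewrite mulrDl mulrA [d * e]mulrC mulrA. Qed.

(** * Weyl group action on the lattice, on [S] and on [Q] *)

Section Setting.
Variables (K : realType) (R : idomainType) (charR : [pchar R] =i pred0) (F : fgl R).
Variables (n : nat) (A : cartan_matrix n) (D : root_datum K A) (L : demazure_lattice D).
Notation W := (weyl D).
Notation S := (dS L F).
Notation Q := (dQ L F).
Notation x := (dx F).
Notation inQ := (@inQ K n A D L R F).
Implicit Types (a b : lattice L) (s : S) (q : Q) (v w t : W) (i : 'I_n).

Lemma lat_actM u v a : lat_act (u * v)%g a = lat_act u (lat_act v a).
Proof. by apply: val_inj; rewrite /= weyl_funM. Qed.
Lemma lat_act1 a : lat_act 1%g a = a.
Proof. by apply: val_inj; rewrite /= weyl_fun1. Qed.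
Lemma lat_sum (T : Type) (r : seq T) (E : T -> lattice L) :
  lat_val (\sum_(j <- r) E j) = \sum_(j <- r) lat_val (E j).
Proof. exact: (raddf_sum (\val : lattice L -> hdual D)). Qed.

Lemma lat_valMz a (z : int) : lat_val (a *~ z) = lat_val a *~ z.
Proof. exact: (raddfMz (\val : lattice L -> hdual D)). Qed.

Lemma is_rootE a : is_root a <-> hroot (lat_val a).
Proof.
split=> [[w [i ->]]|[w [i E]]]; first by exists w, i.
by exists w, i; apply: val_inj.
Qed.
Lemma root_reflectionE a t : root_reflection a t <-> hrefl (lat_val a) t.
Proof.
split=> [[w [i [-> ->]]]|[w [i [E ->]]]]; first by exists w, i.
by exists w, i; split=> //; apply: val_inj.
Qed.
Lemma positiveE a : positive a <-> nonneg_root (lat_val a).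
Proof.
have E c : lat_val (\sum_i aroot L i *+ c i) = \sum_i (simple_root D i : hdual D) *+ c i.
  by rewrite lat_sum; apply: eq_bigr => i _; apply: (raddfMn (\val : lattice L -> hdual D)).
by split=> -[c Ec]; exists c; [rewrite Ec E | apply: val_inj; rewrite /= E].
Qed.

Lemma is_root_act w a : is_root a -> is_root (lat_act w a).
Proof. by move=> [y [i ->]]; exists (w * y)%g, i; rewrite lat_actM. Qed.
Lemma is_root_opp a : is_root a -> is_root (- a).
Proof. by move=> /is_rootE Ha; apply/is_rootE; apply: hroot_opp. Qed.
Lemma is_root_sign a : is_root a -> positive a \/ positive (- a).
Proof.
by move=> /is_rootE/hroot_sign[H|H]; [left|right]; apply/positiveE.
Qed.
Lemma is_root_simple i : is_root (aroot L i).
Proof. by exists 1%g, i; rewrite lat_act1. Qed.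
Lemma root_reflection_root a t : root_reflection a t -> is_root a.
Proof. by move=> [w [i [-> _]]]; exists w, i. Qed.
Lemma root_reflection_ex a : is_root a -> exists t, root_reflection a t.
Proof. by move=> [w [i ->]]; exists (w * sgen D i * w^-1)%g, w, i. Qed.

Lemma act_SM u v s : act_S (u * v)%g s = act_S u (act_S v s).
Proof.
rewrite /act_S; elim/quotW: s => f.
rewrite [fga_act (lat_aut L v) _]fga_act_pi !fga_act_pi; congr (\pi_(fga F (lattice L))%qT _).
apply/pseriesP => m.
suff E : cm_act (lat_aut L (u * v)%g) m = cm_act (lat_aut L v) (cm_act (lat_aut L u) m).
  by rewrite !ps_actE E.
by apply/eqP/cmP => a; rewrite !cm_actE /= lat_actM.
Qed.
Lemma act_S1 s : act_S 1%g s = s.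
Proof.
rewrite /act_S; elim/quotW: s => f; rewrite fga_act_pi; congr (\pi_(fga F (lattice L))%qT _).
apply/pseriesP => m; suff E : cm_act (lat_aut L 1%g) m = m by rewrite ps_actE E.
by apply/eqP/cmP => a; rewrite cm_actE /= lat_act1.
Qed.
Lemma act_SB w : {morph @act_S _ _ _ _ L _ F w : s t / s - t}.
Proof. exact: fga_act_zmod. Qed.
Lemma act_SMul w : {morph @act_S _ _ _ _ L _ F w : s t / s * t}.
Proof. exact: (fga_act_monoid _ _).2. Qed.
Lemma act_S_1 w : act_S w (1 : S) = 1.
Proof. exact: (fga_act_monoid _ _).1. Qed.
Lemma act_S_0 w : act_S w (0 : S) = 0.
Proof. exact: (rmorph0 (fga_act (lat_aut L w))). Qed.
Lemma act_SD w : {morph @act_S _ _ _ _ L _ F w : s t / s + t}.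
Proof. exact: (rmorphD (fga_act (lat_aut L w))). Qed.
Lemma act_S_nat w k : act_S w (k%:R : S) = k%:R.
Proof. exact: (rmorph_nat (fga_act (lat_aut L w))). Qed.
Lemma act_SX w a : act_S w (x a) = x (lat_act w a).
Proof. exact: fga_actX. Qed.
Lemma act_SK w s : act_S w^-1%g (act_S w s) = s.
Proof. by rewrite -act_SM mulVg act_S1. Qed.
Lemma act_SKV w s : act_S w (act_S w^-1%g s) = s.
Proof. by rewrite -act_SM mulgV act_S1. Qed.

Definition xdvd a s := exists u, s = x a * u.

Lemma xdvd_act w a s : xdvd (lat_act w a) s <-> xdvd a (act_S w^-1%g s).
Proof.
split=> [[u ->]|[u E]].
  exists (act_S w^-1%g u); rewrite act_SMul act_SX -lat_actM.
  by rewrite mulVg lat_act1.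
by exists (act_S w u); rewrite -(act_SKV w s) E act_SMul act_SX.
Qed.

(** Every root is [w(al i)], so facts about [x_a] reduce, through the action of [w^-1], to a simple
    root; this basis then makes [x_a] a coordinate of [S]. *)
Lemma simple_basis i : exists r (e : 'I_r -> lattice L) j,
  (forall a, exists! c : {ffun 'I_r -> int}, a = \sum_k e k *~ c k) /\ e j = aroot L i.
Proof.
have [r [e [[eL eB] [j ej]]]] := dl_ext L i.
pose e' k := Lattice (eL k); exists r, e', j; split; last by apply: val_inj.
have E (c : {ffun 'I_r -> int}) : lat_val (\sum_k e' k *~ c k) = \sum_k e k *~ c k.
  rewrite lat_sum; apply: eq_bigr => k _.
  exact: lat_valMz.
move=> a; have [c [Ec U]] := eB _ (latP a); exists c; split.
  by apply: val_inj; rewrite /= E.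
by move=> c' Ec'; apply: U; rewrite Ec' E.
Qed.

Lemma x_reg a s : is_root a -> x a * s = 0 -> s = 0.
Proof.
move=> [w [i ->]] E; have [r [e [j [B ej]]]] := simple_basis i.
have := fga_x_reg (F := F) B (i := j) (s := act_S w^-1%g s); rewrite ej => H.
rewrite -(act_SKV w s) H ?act_S_0 //.
by rewrite -[fga_x F _](act_SK w) act_SX -act_SMul E act_S_0.
Qed.

Lemma x_prime a (s t : S) : is_root a -> xdvd a (s * t) -> xdvd a s \/ xdvd a t.
Proof.
move=> [w [i ->]] /xdvd_act; rewrite act_SMul => -[u E].
have [r [e [j [B ej]]]] := simple_basis i.
have := fga_x_prime (F := F) B (i := j) (s := act_S w^-1%g s) (t := act_S w^-1%g t) (u := u).
by rewrite ej => /(_ E)[]; [left|right]; apply/xdvd_act.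
Qed.

Lemma x_dvd_nat a k : is_root a -> xdvd a k%:R -> k = 0%N.
Proof.
move=> [w [i ->]] /xdvd_act; rewrite act_S_nat => -[u E].
have [r [e [j [B ej]]]] := simple_basis i.
by apply: (fga_x_dvd_nat charR B (i := j) (u := u)); rewrite ej.
Qed.

Lemma x_dvd_x a b : is_root a -> is_root b -> xdvd a (x b) -> b = a \/ b = - a.
Proof.
move=> ra rb; case: (ra) => w [i Ea]; rewrite Ea => /xdvd_act; rewrite act_SX => -[u E].
have [r [e [j [B ej]]]] := simple_basis i; rewrite -ej in E.
have [k Ek] := fga_x_dvd_x charR B E; rewrite ej in Ek.
have Eb : lat_val b = lat_val a *~ k.
  move: Ek => /(congr1 (@lat_val _ _ _ _ _)); rewrite lat_valMz /=.
  move=> /(congr1 (weyl_fun w)); rewrite weyl_funKV weyl_funMz => ->.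
  by rewrite Ea.
have /is_rootE hb := rb; have /is_rootE ha := ra.
have [k1|k1] := hroot_indivisible hb ha Eb; [left|right]; apply: val_inj => /=.
  by rewrite Eb k1 mulr1z Ea.
by rewrite Eb k1 mulrN1z Ea.
Qed.

(** For a simple root, [s_i] moves each lattice element by an integral multiple of [al i], which is
    invisible modulo [x_a]. *)
Lemma x_act_dvd a t s : root_reflection a t -> xdvd a (act_S t s - s).
Proof.
move=> [w [i [-> ->]]]; apply/xdvd_act; rewrite act_SB -!act_SM !mulgA mulVg mul1g act_SM.
set s' := act_S w^-1%g s.
have [r [e [j [B ej]]]] := simple_basis i.
have [|u E] := @fga_act_sub_dvd _ F _ _ _ B j (lat_aut L (sgen D i)) _ s'; last first.
  by exists u; rewrite /dx -ej.
move=> b; have [z Ez] := dl_int (latP b) i; exists (- z); apply: val_inj.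
rewrite [RHS](raddfD (\val : lattice L -> hdual D)) [X in _ = _ + X]lat_valMz ej /=.
by rewrite sgenE Ez mulrNz scaler_int.
Qed.

Lemma x_oppE a : exists H : S, x a + x (- a) + x a * x (- a) * H = 0.
Proof. exact: fga_xN. Qed.

Lemma x_opp_dvd a : exists u, x a = x (- a) * u.
Proof.
have [H E] := x_oppE a; exists (- 1 - x a * H).
exact: fgl_opp_factor E.
Qed.

Lemma x_unit a : is_root a -> exists r : Q, inQ (x a) * r = 1.
Proof.
move=> ra; have U b : is_root b -> positive b -> exists r : Q, inQ (x b) * r = 1.
  by move=> rb pb; apply/denom_unit/denom_mem; exists b.
have [pa|pa] := is_root_sign ra; first exact: U.
have [r Er] := U _ (is_root_opp ra) pa; have [u Eu] := x_opp_dvd (- a).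
exists (inQ u * r); rewrite mulrA -[inQ (x a) * _](rmorphM (to_loc _)).
by rewrite opprK in Eu; rewrite -Eu.
Qed.

Lemma xV_root a : is_root a -> inQ (x a) * pz_inv (inQ (x a)) = 1.
Proof. by move=> /x_unit[r E]; rewrite (pz_invP E). Qed.

Lemma inQ_inj : injective inQ.
Proof. by apply: to_loc_inj => _ [a [ra [_ ->]]] s; apply: x_reg. Qed.

Lemma denomP d : d \in denom [set s : S | exists a, is_root a /\ positive a /\ s = x a]%classic ->
  exists2 l : seq (lattice L), (forall a, a \in l -> is_root a /\ positive a)
    & d = \prod_(a <- l) x a.
Proof.
move=> /asboolP[l Hl ->]; elim: l Hl => [|y l IH] Hl; first by exists [::]; rewrite ?big_nil.
have [|k Hk Ek] := IH; first by move=> z zl; apply: Hl; rewrite inE zl orbT.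
have [a [ra [pa Ey]]] := Hl _ (mem_head _ _); exists (a :: k).
  by move=> b; rewrite inE => /orP[/eqP ->|/Hk].
by rewrite !big_cons Ek Ey.
Qed.

Lemma fracP q : exists s (l : seq (lattice L)),
  (forall a, a \in l -> is_root a /\ positive a) /\ q * inQ (\prod_(a <- l) x a) = inQ s.
Proof.
have [l Hl El] := denomP (fdenP (repr q)); exists (fnum (repr q)), l; split=> //.
by rewrite -El; apply: loc_reprE.
Qed.

Lemma act_S_denom_unit w (l : seq (lattice L)) : (forall a, a \in l -> is_root a) ->
  exists r, inQ (act_S w (\prod_(a <- l) x a)) * r = 1.
Proof.
elim: l => [|a l IH] Hl.
  by exists 1; rewrite big_nil act_S_1 mulr1; apply: (rmorph1 (to_loc _)).
have [|r Er] := IH; first by move=> b bl; apply: Hl; rewrite inE bl orbT.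
have [r' Er'] := x_unit (is_root_act w (Hl _ (mem_head _ _))).
exists (r' * r); rewrite big_cons act_SMul act_SX [inQ _](rmorphM (to_loc _)).
by rewrite mulrACA [_ * r']Er' [_ * r]Er mulr1.
Qed.

Lemma inQM (s t : S) : inQ (s * t) = inQ s * inQ t. Proof. exact: (rmorphM (to_loc _)). Qed.
Lemma inQD (s t : S) : inQ (s + t) = inQ s + inQ t. Proof. exact: (rmorphD (to_loc _)). Qed.
Lemma inQB (s t : S) : inQ (s - t) = inQ s - inQ t. Proof. exact: (rmorphB (to_loc _)). Qed.
Lemma inQN s : inQ (- s) = - inQ s. Proof. exact: (rmorphN (to_loc _)). Qed.
Lemma inQ0 : inQ 0 = 0. Proof. exact: (rmorph0 (to_loc _)). Qed.
Lemma inQ1 : inQ 1 = 1. Proof. exact: (rmorph1 (to_loc _)). Qed.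

(** [act_Q] is defined on a chosen representative; injectivity of [inQ] allows any fraction whose
    denominator is a product of [x_a]. *)
Lemma act_QE w q s (l : seq (lattice L)) : (forall a, a \in l -> is_root a) ->
  q * inQ (\prod_(a <- l) x a) = inQ s ->
  act_Q w q * inQ (act_S w (\prod_(a <- l) x a)) = inQ (act_S w s).
Proof.
move=> Hl E; set d := \prod_(_ <- _) _ in E *.
have [l' Hl' El'] := denomP (fdenP (repr q)).
have E' : q * inQ (fden (repr q)) = inQ (fnum (repr q)) by apply: loc_reprE.
rewrite /act_Q; move: (fden _) (fnum _) El' E' => d' s' -> E'.
have [|r Er] := act_S_denom_unit w (l := l'); first by move=> a /Hl'[].
rewrite (pz_invP Er); set d0 := \prod_(_ <- _) _ in E' Er.
have Es : s' * d = s * d0 by apply: inQ_inj; rewrite !inQM -E -E'; exact: mulrAC.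
rewrite mulrAC -inQM -act_SMul Es act_SMul inQM -mulrA Er; exact: mulr1.
Qed.

Lemma act_Q_uniq w q s (l : seq (lattice L)) r : (forall a, a \in l -> is_root a) ->
  q * inQ (\prod_(a <- l) x a) = inQ s ->
  r * inQ (act_S w (\prod_(a <- l) x a)) = inQ (act_S w s) -> act_Q w q = r.
Proof.
move=> Hl /(act_QE w Hl) E E'; have [u Eu] := act_S_denom_unit w Hl.
by apply: (unit_cancel Eu); rewrite mulrC E mulrC.
Qed.

Lemma act_Q_inQ w s : act_Q w (inQ s) = inQ (act_S w s).
Proof.
by apply: (@act_Q_uniq w _ s [::]) => //; rewrite big_nil ?act_S_1 inQ1 mulr1.
Qed.

Lemma act_QD w : {morph @act_Q _ _ _ _ L _ F w : q r / q + r}.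
Proof.
move=> q r; have [s [l [Hl E]]] := fracP q; have [t [k [Hk E']]] := fracP r.
have Hlr a : a \in l -> is_root a by move=> /Hl[].
have Hkr a : a \in k -> is_root a by move=> /Hk[].
have G := act_QE w Hlr E; have G' := act_QE w Hkr E'.
set dl := \prod_(_ <- l) _ in E G; set dk := \prod_(_ <- k) _ in E' G'.
apply: (@act_Q_uniq w _ (s * dk + t * dl) (l ++ k)).
- by move=> a; rewrite mem_cat => /orP[/Hl[]|/Hk[]].
- by rewrite big_cat inQD !inQM; exact: frac_addE.
by rewrite big_cat act_SD !act_SMul inQD !inQM; exact: frac_addE.
Qed.

Lemma act_QM w : {morph @act_Q _ _ _ _ L _ F w : q r / q * r}.
Proof.
move=> q r; have [s [l [Hl E]]] := fracP q; have [t [k [Hk E']]] := fracP r.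
have Hlr a : a \in l -> is_root a by move=> /Hl[].
have Hkr a : a \in k -> is_root a by move=> /Hk[].
have G := act_QE w Hlr E; have G' := act_QE w Hkr E'.
set dl := \prod_(_ <- l) _ in E G; set dk := \prod_(_ <- k) _ in E' G'.
apply: (@act_Q_uniq w _ (s * t) (l ++ k)).
- by move=> a; rewrite mem_cat => /orP[/Hl[]|/Hk[]].
- by rewrite big_cat !inQM; exact: frac_mulE.
by rewrite big_cat !act_SMul !inQM; exact: frac_mulE.
Qed.

Lemma act_Q1 w : act_Q w (1 : Q) = 1.
Proof. by rewrite -inQ1 act_Q_inQ act_S_1. Qed.
Lemma act_Q0 w : act_Q w (0 : Q) = 0.
Proof. by rewrite -inQ0 act_Q_inQ act_S_0. Qed.
Lemma act_Q_id q : act_Q 1%g q = q.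
Proof.
have [s [l [Hl E]]] := fracP q; apply: (act_Q_uniq _ E); first by move=> a /Hl[].
by rewrite !act_S1.
Qed.
Lemma act_Q_comp u v q : act_Q (u * v)%g q = act_Q u (act_Q v q).
Proof.
have [s [l [Hl E]]] := fracP q; have Hlr a : a \in l -> is_root a by move=> /Hl[].
apply: (act_Q_uniq Hlr E); have G := act_QE v Hlr E.
have Ea w : act_S w (\prod_(a <- l) x a) = \prod_(a <- map (lat_act w) l) x a.
  rewrite big_map (big_morph (act_S w) (act_SMul w) (act_S_1 w)).
  apply: eq_bigr => a _; exact: act_SX.
rewrite !act_SM Ea in G *; apply: act_QE => // a /mapP[b /Hlr rb ->].
exact: is_root_act.
Qed.
End Setting.

Section AbstractIdentities.
Variable (Q : comPzRingType).
Implicit Types (q r s t x y u h : Q).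

Lemma clear_denomE q t x d : t * (q * (x * d)) = x * (q * t * d).
Proof. by ring. Qed.

(* For tq = t(q): q and tq have denominators s, ts = s + x u and numerators s', ts' = s' + x u' *)
Lemma quotient_diffE q tq s ts s' ts' x y u u' :
  q * s = s' -> tq * ts = ts' -> ts - s = x * u -> ts' - s' = x * u' -> x * y = 1 ->
  y * (tq - q) * (s * ts) = u' * s - s' * u.
Proof.
move=> E E' Eu Eu' Exy.
have -> : y * (tq - q) * (s * ts) = y * (s * (tq * ts) - (q * s) * ts) by ring.
rewrite E E'; have -> : s * ts' - s' * ts = x * (u' * s - s' * u).
  have -> : ts' = s' + x * u' by rewrite -Eu' addrC subrK.
  have -> : ts = s + x * u by rewrite -Eu addrC subrK.
  by ring.
by rewrite mulrA [y * x]mulrC Exy mul1r.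
Qed.

(* For tq = t(q), x' = t(x) and t(x q) = x q + x r. *)
Lemma reflect_sumE q tq x x' xi xi' u h r :
  x * xi = 1 -> x' * xi' = 1 -> x = x' * u -> x + x' + x * x' * h = 0 ->
  x' * tq = x * q + x * r -> q + tq = (x * q) * - h + u * r.
Proof.
move=> Ex Ex' Eu Eh Et.
have -> : tq = xi' * (x * q + x * r) by rewrite -Et mulrA [xi' * _]mulrC Ex' mul1r.
have -> : q = xi * (x * q) by rewrite mulrA [xi * _]mulrC Ex mul1r.
have -> : u = xi' * x by rewrite Eu mulrA [xi' * _]mulrC Ex' mul1r.
have -> : - h = xi + xi'.
  have -> : h = (x * xi) * (x' * xi') * h by rewrite Ex Ex' !mul1r.
  have -> : (x * xi) * (x' * xi') * h = xi * xi' * (x * x' * h) by ring.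
  have -> : x * x' * h = - (x + x') by apply/eqP; rewrite -addr_eq0 addrC Eh.
  have -> : - (xi * xi' * - (x + x')) = xi' * (x * xi) + xi * (x' * xi') by ring.
  by rewrite Ex Ex' !mulr1 addrC.
rewrite (mulrA x xi) Ex mul1r; ring.
Qed.

Lemma pair_sumE q q' s s' x g : s - s' = x * g -> q * s + q' * s' = (x * q) * g + (q + q') * s'.
Proof.
move=> E; have -> : x * q * g = q * (x * g) by ring.
by rewrite -E; ring.
Qed.
End AbstractIdentities.

Section LocalRings.
Variables (K : realType) (R : idomainType) (charR : [pchar R] =i pred0) (F : fgl R).
Variables (n : nat) (A : cartan_matrix n) (D : root_datum K A) (L : demazure_lattice D).
Notation W := (weyl D).
Notation S := (dS L F).
Notation Q := (dQ L F).
Notation x := (dx F).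
Notation inQ := (@inQ K n A D L R F).
Notation xi a := (pz_inv (inQ (x a))).
Implicit Types (a b : lattice L) (s : S) (q r : Q) (v w t : W) (i : 'I_n).

(* q lies in the localization of S at the prime ideal (x_a). *)
Definition locat a q := exists s s' : S, ~ xdvd a s /\ q * inQ s = inQ s'.

Lemma locat_inQ a s : is_root a -> locat a (inQ s).
Proof.
move=> ra; exists 1, s; split; last by rewrite inQ1; exact: mulr1.
by move=> /(x_dvd_nat charR (k := 1) ra).
Qed.

Lemma xdvdM a (s t : S) : is_root a -> ~ xdvd a s -> ~ xdvd a t -> ~ xdvd a (s * t).
Proof. by move=> ra Hs Ht /(x_prime ra)[]. Qed.

Lemma locatM a q r : is_root a -> locat a q -> locat a r -> locat a (q * r).
Proof.
move=> ra [s [s' [Hs E]]] [t [t' [Ht E']]]; exists (s * t), (s' * t').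
split; first exact: xdvdM.
by rewrite !inQM; exact: frac_mulE.
Qed.

Lemma locatD a q r : is_root a -> locat a q -> locat a r -> locat a (q + r).
Proof.
move=> ra [s [s' [Hs E]]] [t [t' [Ht E']]]; exists (s * t), (s' * t + t' * s).
split; first exact: xdvdM.
by rewrite inQD !inQM; exact: frac_addE.
Qed.

Lemma locatN a q : is_root a -> locat a q -> locat a (- q).
Proof.
move=> ra [s [s' [Hs E]]]; exists s, (- s'); split=> //.
by rewrite inQN -E; exact: mulNr.
Qed.

Lemma locatB a q r : is_root a -> locat a q -> locat a r -> locat a (q - r).
Proof. by move=> ra Hq Hr; apply: locatD => //; apply: locatN. Qed.

Lemma locat_sum a (T : Type) (l : seq T) (E : T -> Q) : is_root a ->
  (forall j, locat a (E j)) -> locat a (\sum_(i <- l) E i).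
Proof.
move=> ra H; elim: l => [|i l IH]; first by rewrite big_nil -inQ0; apply: locat_inQ.
by rewrite big_cons; apply: locatD.
Qed.

Lemma locat_half a q : is_root a -> locat a (q + q) -> locat a q.
Proof.
move=> ra [s [s' [Hs E]]]; exists (2%:R * s), s'; split.
  by apply: xdvdM => // /(x_dvd_nat charR ra).
rewrite -E inQM; have -> : inQ 2%:R = 1 + 1 :> Q by rewrite inQD inQ1.
by rewrite mulrDl mul1r mulrDr mulrDl.
Qed.

Lemma locat_inv a b : is_root a -> is_root b -> b <> a -> b <> - a -> locat a (xi b).
Proof.
move=> ra rb N N'; exists (x b), 1; split.
  by move=> /(x_dvd_x charR ra rb)[].
by rewrite inQ1 mulrC; apply: xV_root.
Qed.

Lemma locat_act w a q : locat a q -> locat (lat_act w a) (act_Q w q).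
Proof.
move=> [s [s' [Hs E]]]; exists (act_S w s), (act_S w s'); split.
  by move=> /xdvd_act; rewrite act_SK.
by rewrite -!act_Q_inQ -E act_QM.
Qed.

Lemma xdvd_opp a s : xdvd (- a) s -> xdvd a s.
Proof.
move=> [u ->]; have [u' Eu'] := x_opp_dvd F (- a); rewrite opprK in Eu'.
by exists (u' * u); rewrite Eu'; exact: esym (mulrA _ _ _).
Qed.

Lemma locat_opp a q : locat a q -> locat (- a) q.
Proof.
move=> [s [s' [Hs E]]]; exists s, s'; split; last exact: E.
by move=> /xdvd_opp.
Qed.

Lemma xdvd_reflect a t s : root_reflection a t -> xdvd a (act_S t s) -> xdvd a s.
Proof.
move=> Ht [u Eu]; have [u' Eu'] := x_act_dvd s Ht; exists (u - u').
by rewrite mulrBr -Eu -Eu' opprB addrC subrK.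
Qed.

(** [t] preserves the ideal [(x_a)] and acts trivially on [S] modulo it; both properties pass to the
    localization. *)
Lemma locat_reflect a t q : root_reflection a t -> locat a q ->
  exists2 r, locat a r & act_Q t q - q = inQ (x a) * r.
Proof.
move=> Ht [s [s' [Hs E]]]; have ra := root_reflection_root Ht.
have [u Eu] := x_act_dvd s Ht; have [u' Eu'] := x_act_dvd s' Ht.
have Et : act_Q t q * inQ (act_S t s) = inQ (act_S t s') by rewrite -!act_Q_inQ -E act_QM.
exists (xi a * (act_Q t q - q)); last first.
  by rewrite mulrA xV_root // mul1r.
exists (s * act_S t s), (u' * s - s' * u); split.
  by apply: xdvdM => // /(xdvd_reflect Ht).
rewrite inQB !inQM; apply: quotient_diffE E Et _ _ (xV_root F ra); rewrite -inQB -inQM.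
  by rewrite Eu.
by rewrite Eu'.
Qed.

(** The factors of a denominator are removed one by one: if [t q = t'] with [t] outside [(x_a)],
    then [x_a] divides [t] times the numerator, hence the numerator, as [(x_a)] is prime. *)
Lemma locat_global q : (forall a, is_root a -> positive a -> locat a q) -> exists s, q = inQ s.
Proof.
move=> H; have [s [l [Hl E]]] := fracP q.
elim: l s Hl E => [|a l IH] s Hl E.
  by exists s; rewrite -E big_nil inQ1 mulr1.
have [ra pa] := Hl _ (mem_head _ _); have [t [t' [Ht Et]]] := H a ra pa.
rewrite big_cons inQM in E; set d := \prod_(_ <- _) _ in E.
have Ets : t * s = x a * (t' * d).
  apply: (@inQ_inj _ _ F _ _ _ L); rewrite !inQM -E -Et.
  exact: clear_denomE.
have [//|[u Eu]] := x_prime ra (ex_intro _ _ Ets).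
apply: (IH u) => [b bl|]; first by apply: Hl; rewrite inE bl orbT.
apply: (unit_cancel (xV_root F ra)); rewrite -inQM -Eu -E.
exact: mulrCA.
Qed.
End LocalRings.

(** * The twisted group algebra *)

(* Otherwise failing unification problems unfold the quotients defining S and Q. *)
Opaque act_Q act_S dx inQ.

Lemma sum_indicator (Q : comPzRingType) (T : eqType) (l : seq T) (E : T -> Q) y :
  uniq l -> (y \notin l -> E y = 0) -> \sum_(v <- l) E v * (v == y)%:R = E y.
Proof.
move=> ul H; have [yl|yl] := boolP (y \in l).
  rewrite (big_rem y) //= eqxx mulr1 big_seq big1 ?addr0 // => v.
  by rewrite mem_rem_uniq // inE => /andP[/negbTE -> _]; rewrite mulr0.
rewrite (H yl) big_seq big1 // => v vl.
by case: eqP => [E1|]; [rewrite -E1 vl in yl | rewrite mulr0].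
Qed.

Lemma sub_reflect_sum (V : zmodType) (q p r c : V) : q - (r + c - p) + (r - q - p) = - c.
Proof.
have -> : r - q - p = (r + c - p) - c - q by rewrite (addrAC r c) addrK addrAC.
by move: (r + c - p) => y; rewrite -(addrA y) (addrA (q - y)) subrK addrC subrK.
Qed.

(* Locked, since unification would unfold it when comparing coefficients. *)
HB.lock Definition left_delta (K : realType) (R : comNzRingType) (F : fgl R) (n : nat)
    (A : cartan_matrix n) (D : root_datum K A) (L : demazure_lattice D)
    (v : weyl D) (g : QW L F) : QW L F :=
  \sum_(w <- msupp g) act_Q v g@_w *: delta L F (v * w)%g.

Section TwistedGroupAlgebra.
Variables (K : realType) (R : idomainType) (F : fgl R).
Variables (n : nat) (A : cartan_matrix n) (D : root_datum K A) (L : demazure_lattice D).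
Notation W := (weyl D).
Notation Q := (dQ L F).
Notation QW := (QW L F).
Notation delta := (@delta K n A D L R F).
Notation lact := (@left_delta K R F n A D L).
Implicit Types (f g h : QW) (q r : Q) (u v w : W).

Lemma QW_coefZ q f w : (q *: f)@_w = q * f@_w.
Proof. exact: QW_scaleE. Qed.
Lemma QW_coefD f g w : (f + g)@_w = f@_w + g@_w.
Proof. exact: mcoeffD. Qed.
Lemma QW_coefB f g w : (f - g)@_w = f@_w - g@_w.
Proof. exact: mcoeffB. Qed.
Lemma QW_coef_sum (T : Type) (l : seq T) (E : T -> QW) w :
  (\sum_(i <- l) E i)@_w = \sum_(i <- l) (E i)@_w.
Proof. exact: raddf_sum. Qed.
Lemma delta_coef v w : (delta v)@_w = (v == w)%:R.
Proof. exact: mcoeffU. Qed.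

Section LinearExtension.
Variables (V : lmodType Q) (T : W -> V).

Definition lin_ext f : V := \sum_(v <- msupp f) f@_v *: T v.

Lemma lin_extw (d : {fset W}) f : (msupp f `<=` d)%fset ->
  lin_ext f = \sum_(v <- d) f@_v *: T v.
Proof.
move=> le; apply: big_fset_incl => // v _ /mcoeff_outdom ->.
by rewrite scale0r.
Qed.

Fact lin_ext_linear : linear lin_ext.
Proof.
move=> c p q; pose d := (msupp p `|` msupp q `|` msupp (c *: p + q)%R)%fset.
rewrite (@lin_extw d) ?fsubsetUr // (@lin_extw d p); last first.
  by rewrite /d -fsetUA fsubsetUl.
rewrite (@lin_extw d q); last by rewrite /d (fsetUC (msupp p)) -fsetUA fsubsetUl.
rewrite scaler_sumr -big_split; apply: eq_bigr => v _ /=.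
by rewrite QW_coefD QW_coefZ scalerDl scalerA.
Qed.
HB.instance Definition _ := GRing.isLinear.Build Q QW V *:%R lin_ext lin_ext_linear.

Lemma lin_ext_delta v : lin_ext (delta v) = T v.
Proof.
rewrite (@lin_extw [fset v]%fset) ?msuppU_le // big_seq_fset1 delta_coef eqxx.
exact: scale1r.
Qed.
End LinearExtension.

Lemma QW_decomp f : f = lin_ext delta f.
Proof.
rewrite {1}(monalgE f); apply: eq_bigr => v _; apply/malgP => w.
by rewrite mcoeffU QW_coefZ delta_coef mulr_natr.
Qed.

Lemma lact_coef v g w : (lact v g)@_w = act_Q v (g@_(v^-1 * w)%g).
Proof.
rewrite left_delta.unlock QW_coef_sum.
transitivity (\sum_(u <- msupp g) act_Q v g@_u * (u == (v^-1 * w)%g)%:R).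
  apply: eq_bigr => u _; rewrite QW_coefZ delta_coef; congr (_ * (_ : bool)%:R).
  by apply/eqP/eqP => [<-|->]; rewrite ?mulKg ?mulKVg.
apply: (@sum_indicator Q W _ (fun u => act_Q v g@_u)) => [|N]; first exact: fset_uniq.
by rewrite (mcoeff_outdom N) act_Q0.
Qed.

Lemma lact0 v : lact v (0 : QW) = 0.
Proof. by rewrite left_delta.unlock msupp0 big_seq_fset0. Qed.

(** With right multiplication by [g] seen as a linear extension, linearity on the left is immediate
    and associativity reduces to the [delta_v]. *)
Lemma QW_mulE f g : QW_mul f g = lin_ext (fun v => lact v g) f.
Proof.
apply: eq_bigr => v _; rewrite left_delta.unlock scaler_sumr; apply: eq_bigr => w _.
by rewrite scalerA.
Qed.

Lemma lactD v : {morph lact v : f g / f + g}.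
Proof.
by move=> f g; apply/malgP => w; rewrite QW_coefD !lact_coef QW_coefD act_QD.
Qed.
Lemma lact_sum v (T : Type) (l : seq T) (E : T -> QW) :
  lact v (\sum_(i <- l) E i) = \sum_(i <- l) lact v (E i).
Proof. exact: (big_morph _ (lactD v) (lact0 v)). Qed.
Lemma lactZ v q f : lact v (q *: f) = act_Q v q *: lact v f.
Proof.
apply/malgP => w; rewrite QW_coefZ (lact_coef v (q *: f)) (lact_coef v f).
by rewrite QW_coefZ act_QM.
Qed.
Lemma lactM u v f : lact (u * v)%g f = lact u (lact v f).
Proof.
apply/malgP => w; apply: etrans (lact_coef _ _ _) _.
apply: etrans (esym (lact_coef _ _ _)); rewrite (lact_coef v f).
by rewrite act_Q_comp invMg mulgA.
Qed.
Lemma lact1 f : lact 1%g f = f.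
Proof. by apply/malgP => w; rewrite lact_coef invg1 mul1g act_Q_id. Qed.
Lemma lact_delta v w : lact v (delta w) = delta (v * w)%g.
Proof.
apply/malgP => u; rewrite lact_coef !delta_coef.
have -> : (w == (v^-1 * u)%g) = ((v * w)%g == u).
  by apply/eqP/eqP => [->|<-]; rewrite ?mulKVg ?mulKg.
by case: eqP => _; [exact: act_Q1 | exact: act_Q0].
Qed.

Lemma QW_mulDl f f' g : QW_mul (f + f') g = QW_mul f g + QW_mul f' g.
Proof. by rewrite !QW_mulE linearD. Qed.
Lemma QW_mulBl f f' g : QW_mul (f - f') g = QW_mul f g - QW_mul f' g.
Proof. by rewrite !QW_mulE linearB. Qed.
Lemma QW_mulZl q f g : QW_mul (q *: f) g = q *: QW_mul f g.
Proof. by rewrite !QW_mulE linearZ_LR. Qed.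
Lemma QW_mul_delta v g : QW_mul (delta v) g = lact v g.
Proof. by rewrite QW_mulE lin_ext_delta. Qed.
Lemma QW_mul1 f : QW_mul f (delta 1%g) = f.
Proof.
rewrite QW_mulE [RHS]QW_decomp; apply: eq_bigr => v _.
by rewrite lact_delta mulg1.
Qed.

Lemma QW_mulA f g h : QW_mul (QW_mul f g) h = QW_mul f (QW_mul g h).
Proof.
rewrite !QW_mulE; pose phi := lin_ext (fun v => lact v h).
apply: etrans (linear_sum phi _ _ _) _; apply: eq_bigr => v _.
rewrite (linearZ_LR phi); congr (_ *: _).
rewrite {1}(QW_decomp g) /lin_ext !lact_sum (linear_sum phi); apply: eq_bigr => w _.
rewrite !lactZ (linearZ_LR phi); congr (_ *: _).
by rewrite lact_delta [LHS]lin_ext_delta lactM.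
Qed.
End TwistedGroupAlgebra.

(** * Elements of [Q_W] with controlled poles *)

Section RegularElements.
Variables (K : realType) (R : idomainType) (charR : [pchar R] =i pred0) (F : fgl R).
Variables (n : nat) (A : cartan_matrix n) (D : root_datum K A) (L : demazure_lattice D).
Notation W := (weyl D).
Notation S := (dS L F).
Notation Q := (dQ L F).
Notation QW := (QW L F).
Notation delta := (@delta K n A D L R F).
Notation lact := (@left_delta K R F n A D L).
Notation x := (dx F).
Notation inQ := (@inQ K n A D L R F).
Notation xi a := (pz_inv (inQ (x a))).
Implicit Types (f g h : QW) (q r : Q) (u v w t : W) (a b : lattice L) (i : 'I_n).

(* At x_a the coefficients have simple poles, with opposite residues at w and s_a w. *)
Definition reg_at a t f := forall w,
  locat a (inQ (x a) * f@_w) /\ locat a (f@_w + f@_(t * w)%g).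
Definition QWreg f := forall a t, root_reflection a t -> reg_at a t f.

Lemma QWregD f g : QWreg f -> QWreg g -> QWreg (f + g).
Proof.
move=> Hf Hg a t Ht w; have ra := root_reflection_root Ht.
have [f1 f2] := Hf a t Ht w; have [g1 g2] := Hg a t Ht w.
rewrite !QW_coefD mulrDr addrACA; split; exact: locatD.
Qed.

Lemma QWregZ s f : QWreg f -> QWreg (inQ s *: f).
Proof.
move=> Hf a t Ht w; have ra := root_reflection_root Ht.
have [f1 f2] := Hf a t Ht w.
rewrite !QW_coefZ mulrCA -mulrDr; split; apply: locatM => //; exact: locat_inQ.
Qed.

Lemma QWregB f g : QWreg f -> QWreg g -> QWreg (f - g).
Proof.
move=> Hf Hg; have -> : f - g = f + inQ (- 1) *: g by rewrite inQN inQ1 scaleN1r.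
by apply: QWregD => //; apply: QWregZ.
Qed.

Lemma QWreg_delta v : QWreg (delta v).
Proof.
move=> a t Ht w; have ra := root_reflection_root Ht.
have H u : locat a ((delta v)@_u).
  rewrite delta_coef; case: eqP => _; first by rewrite -[true%:R]inQ1; apply: locat_inQ.
  by rewrite -[false%:R]inQ0; apply: locat_inQ.
by split; [apply: locatM => //; apply: locat_inQ | apply: locatD].
Qed.

Lemma reg_at_opp a t f : root_reflection a t -> reg_at a t f -> reg_at (- a) t f.
Proof.
move=> Ht H w; have ra := root_reflection_root Ht; have [H1 H2] := H w.
split; last exact: locat_opp.
apply: locat_opp; have [u Eu] := x_opp_dvd F (- a); rewrite opprK in Eu.
by rewrite Eu inQM [inQ _ * _]mulrC -mulrA; apply: locatM => //; apply: locat_inQ.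
Qed.

Lemma act_QB w q r : act_Q w (q - r) = act_Q w q - act_Q w r.
Proof. by apply: (addIr (act_Q w r)); rewrite -act_QD !subrK. Qed.

Lemma Xel_coef a t f w :
  (QW_mul (Xel F a t) f)@_w = xi a * (f@_w - act_Q t f@_(t^-1 * w)%g).
Proof.
have -> : QW_mul (Xel F a t) f = xi a *: (f - lact t f).
  apply: etrans (QW_mulZl _ _ _) _; congr (_ *: _); apply: etrans (QW_mulBl _ _ _) _.
  congr (_ - _); first exact: etrans (QW_mul_delta _ _) (lact1 f).
  exact: QW_mul_delta.
by rewrite QW_coefZ QW_coefB lact_coef.
Qed.

Lemma root_reflectionV a t : root_reflection a t -> t^-1%g = t.
Proof. by move=> /root_reflectionE; apply: hreflV. Qed.
Lemma root_reflectionK a t w : root_reflection a t -> (t * (t * w))%g = w.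
Proof. by move=> /root_reflectionE Ht; rewrite mulgA (hreflK Ht) mul1g. Qed.
Lemma root_reflection_self a t : root_reflection a t -> lat_act t a = - a.
Proof. by move=> /root_reflectionE Ht; apply: val_inj; apply: hrefl_self. Qed.
Lemma root_reflection_conj w a t : root_reflection a t ->
  root_reflection (lat_act w a) (w * t * w^-1)%g.
Proof. by move=> /root_reflectionE Ht; apply/root_reflectionE; apply: hrefl_conj. Qed.
Lemma root_reflection_uniq a t t' : root_reflection a t -> root_reflection a t' -> t = t'.
Proof. by move=> /root_reflectionE H /root_reflectionE; apply: hrefl_uniq. Qed.
Lemma root_reflection_opp a t : root_reflection a t -> root_reflection (- a) t.
Proof. by move=> /root_reflectionE H; apply/root_reflectionE; apply: hrefl_opp. Qed.

(** Let [q], [q'] be the coefficients at [w], [t w] and [r = q + q']. The new ones are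
    [(q - t(q'))/x_a] and [(q' - t(q))/x_a]; their sum [(r - t(r))/x_a] is regular because [t] is
    trivial modulo [x_a]. Poles are simple because [q - t(q') = q + t(q) - t(r)], where [q + t(q)]
    is regular: [x_(-a) t(q) = t(x_a q)] is congruent to [x_a q], and [1/x_a + 1/x_(-a)] lies in
    [S]. *)
Lemma Xel_reg_self a t f : root_reflection a t -> QWreg f -> reg_at a t (QW_mul (Xel F a t) f).
Proof.
move=> Ht Hf w; have ra := root_reflection_root Ht.
rewrite !Xel_coef (root_reflectionV Ht) (root_reflectionK _ Ht).
have [H1 H2] := Hf a t Ht w; set q := f@_w in H1 H2 *; set q' := f@_(t * w)%g in H1 H2 *.
set r := q + q' in H2; have Eq' : q' = r - q by rewrite /r addrC addKr.
have [r2 Hr2 Er2] := locat_reflect Ht H2.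
have [r1 Hr1 Er1] := locat_reflect Ht H1.
have [u Eu] := x_opp_dvd F a; have [h Eh] := x_oppE F a.
have Esum : q + act_Q t q = (inQ (x a) * q) * - inQ h + inQ u * r1.
  apply: (reflect_sumE (xV_root F ra) (xV_root F (is_root_opp ra))).
  - by rewrite -inQM -Eu.
  - by rewrite -!inQM -!inQD Eh inQ0.
  have E2 : inQ (x (- a)) * act_Q t q = act_Q t (inQ (x a) * q).
    by rewrite act_QM act_Q_inQ act_SX (root_reflection_self Ht).
  apply: etrans E2 _; rewrite -Er1; exact: esym (subrKC _ _).
have Ht' : act_Q t q' = r + inQ (x a) * r2 - act_Q t q.
  by rewrite -Er2 subrKC Eq' act_QB.
split.
  rewrite mulrA xV_root // mul1r Ht'.
  have -> : q - (r + inQ (x a) * r2 - act_Q t q) = (q + act_Q t q) - (r + inQ (x a) * r2).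
    by rewrite opprB addrA.
  rewrite Esum; apply: locatB => //.
    apply: locatD => //; apply: locatM => //; last exact: locat_inQ.
    by rewrite -inQN; apply: locat_inQ.
  by apply: locatD => //; apply: locatM => //; apply: locat_inQ.
rewrite -mulrDr Ht' Eq'.
have -> : q - (r + inQ (x a) * r2 - act_Q t q) + (r - q - act_Q t q) = - (inQ (x a) * r2).
  exact: sub_reflect_sum.
by rewrite mulrN mulrA (mulrC (xi a)) xV_root // mul1r; apply: locatN.
Qed.

(** When [a] is neither [b] nor [- b], [1/x_b] is regular at [x_a], and [t] carries the condition on
    [f] at the root [t(a)] to the one needed at [a]. *)
Lemma Xel_reg b t f : root_reflection b t -> QWreg f -> QWreg (QW_mul (Xel F b t) f).
Proof.
move=> Ht Hf a ta Hta; have ra := root_reflection_root Hta; have rb := root_reflection_root Ht.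
have [Eab|Nab] := pselect (a = b).
  by subst a; rewrite (root_reflection_uniq Hta Ht); apply: Xel_reg_self.
have [Eab|Nab'] := pselect (a = - b).
  rewrite Eab; apply: reg_at_opp.
    by have := root_reflection_opp Hta; rewrite Eab opprK.
  have -> : ta = t.
    by apply: root_reflection_uniq (root_reflection_opp Ht); rewrite -Eab.
  exact: Xel_reg_self.
have Hxi : locat a (xi b).
  apply: locat_inv => //; first by move=> E; apply: Nab.
  by move=> E; apply: Nab'; rewrite E opprK.
move=> w; rewrite !Xel_coef (root_reflectionV Ht).
have Ht' := root_reflection_conj t Hta; rewrite (root_reflectionV Ht) in Ht'.
set a' := lat_act t a in Ht'; set t' := (t * ta * t)%g in Ht'.
have Ea : lat_act t a' = a by rewrite -{1}(root_reflectionV Ht) lat_actK.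
have [H1 H2] := Hf _ _ Hta w; have [G1 G2] := Hf _ _ Ht' (t * w)%g.
have Etw : (t' * (t * w) = t * (ta * w))%g.
  by rewrite /t' -!mulgA (root_reflectionK _ Ht).
have Ga1 := locat_act t G1; have Ga2 := locat_act t G2; rewrite Ea in Ga1 Ga2.
split.
  rewrite mulrCA; apply: locatM => //; rewrite mulrBr; apply: locatB => //.
  by move: Ga1; rewrite act_QM act_Q_inQ act_SX Ea.
rewrite -mulrDr; apply: locatM => //.
rewrite addrACA -opprD; apply: locatB => //.
by move: Ga2; rewrite act_QD Etw.
Qed.

(** Stability under left multiplication passes to products by associativity, which bare membership
    in [QWreg] would not; [g = delta 1] then gives [DF_QWreg]. *)
Lemma DF_reg f : DF f -> forall g, QWreg g -> QWreg (QW_mul f g).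
Proof.
elim=> [s|a t Ht|f1 f2 _ IH1 _ IH2|f1 f2 _ IH1 _ IH2] g Hg.
- have -> : QW_mul (inQ s *: delta 1%g) g = inQ s *: g.
    apply: etrans (QW_mulZl _ _ _) _; congr (_ *: _).
    exact: etrans (QW_mul_delta _ _) (lact1 g).
  exact: QWregZ.
- exact: Xel_reg.
- by rewrite QW_mulDl; apply: QWregD; auto.
by rewrite QW_mulA; auto.
Qed.

Lemma DF_QWreg f : DF f -> QWreg f.
Proof. by move=> /DF_reg/(_ _ (QWreg_delta 1%g)); rewrite QW_mul1. Qed.

Lemma Yel_coef i f w : (QW_mul (Yel L F i) f)@_w =
  xi (- aroot L i) * f@_w + xi (aroot L i) * act_Q (sgen D i) f@_(sgen D i * w)%g.
Proof.
have -> : QW_mul (Yel L F i) f = xi (- aroot L i) *: f + xi (aroot L i) *: lact (sgen D i) f.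
  apply: etrans (QW_mulDl _ _ _) _.
  congr (_ + _); apply: etrans (QW_mulZl _ _ _) _; congr (_ *: _).
    exact: etrans (QW_mul_delta _ _) (lact1 f).
  exact: QW_mul_delta.
by rewrite QW_coefD !QW_coefZ lact_coef sgenV.
Qed.
End RegularElements.

Lemma kappaE (Q : comPzRingType) (x x' xi xi' h : Q) : x * xi = 1 -> x' * xi' = 1 ->
  x + x' + x * x' * h = 0 -> xi' = - h - xi.
Proof.
move=> Ex Ex' Eh; have E : (xi * xi') * (x + x' + x * x' * h) = 0 by rewrite Eh mulr0.
have E2 : (xi * xi') * (x + x' + x * x' * h) =
  (x * xi) * xi' + (x' * xi') * xi + (x * xi) * (x' * xi') * h by ring.
move: E; rewrite E2 Ex Ex' !mul1r => /eqP; rewrite -addrA addr_eq0 => /eqP ->.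
by rewrite opprD addrC.
Qed.

Lemma scale_kappaE (Q : comPzRingType) (V : lmodType Q) (d1 ds : V) (y y' h : Q) :
  y' = - h - y -> y' *: d1 + y *: ds = - h *: d1 - y *: (d1 - ds).
Proof.
move=> ->; rewrite scalerBl scalerBr opprB -addrA; congr (_ + _); exact: addrC.
Qed.

Lemma lincomb00 (Q : comPzRingType) (y z : Q) : y * 0 + z * 0 = 0.
Proof. by rewrite !mulr0 addr0. Qed.

Lemma lead_stepE (Q : comPzRingType) (y z x xi b c : Q) :
  z = 0 -> x * xi = 1 -> b * c = 1 -> (y * z + xi * b) * (x * c) = 1.
Proof. by move=> -> E E'; rewrite mulr0 add0r mulrACA [xi * x]mulrC E E' mulr1. Qed.

Lemma mul_unit_eq0 (Q : comPzRingType) (c y z : Q) : y * z = 1 -> 0 = c * y -> c = 0.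
Proof. by move=> E E0; rewrite -[c]mulr1 -E mulrA -E0 mul0r. Qed.

Lemma unit_zero_trivial (Q : comPzRingType) (y z : Q) : y * z = 1 -> y = 0 -> 0 = 1 :> Q.
Proof. by move=> E E0; rewrite -E E0 mul0r. Qed.

Lemma seq_bounded (T : eqType) (E : T -> nat) (l : seq T) :
  exists d, forall u, u \in l -> (E u < d)%N.
Proof.
elim: l => [|v l [d Hd]]; first by exists 0%N.
exists (maxn (E v).+1 d) => u; rewrite inE leq_max => /orP[/eqP ->|/Hd ->].
  by rewrite leqnn.
by rewrite orbT.
Qed.

(** * Supports and leading terms of the [Y_I] *)

Section DemazureWords.
Variables (K : realType) (R : idomainType) (charR : [pchar R] =i pred0) (F : fgl R).
Variables (n : nat) (A : cartan_matrix n) (D : root_datum K A) (L : demazure_lattice D).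
Notation W := (weyl D).
Notation S := (dS L F).
Notation Q := (dQ L F).
Notation QW := (QW L F).
Notation delta := (@delta K n A D L R F).
Notation lact := (@left_delta K R F n A D L).
Notation x := (dx F).
Notation inQ := (@inQ K n A D L R F).
Notation xi a := (pz_inv (inQ (x a))).
Implicit Types (f g h : QW) (q r : Q) (u v w t : W) (a b : lattice L) (i j : 'I_n).

Lemma Yel_reg i f : QWreg f -> QWreg (QW_mul (Yel L F i) f).
Proof.
move=> Hf; set a := aroot L i; have ra := is_root_simple L i.
have Ht : root_reflection a (sgen D i).
  by apply/root_reflectionE; apply: hrefl_simple.
have [H EH] := x_oppE F a.
(* Here [- H] is [kappa_i], so this is [Y_i = kappa_i - X_i]. *)
have EY : Yel L F i = inQ (- H) *: delta 1%g - Xel F a (sgen D i).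
  rewrite inQN; apply: scale_kappaE.
  apply: kappaE (xV_root F ra) (xV_root F (is_root_opp ra)) _.
  by rewrite -!inQM -!inQD EH inQ0.
have -> : QW_mul (Yel L F i) f = inQ (- H) *: f - QW_mul (Xel F a (sgen D i)) f.
  rewrite EY; apply: etrans (QW_mulBl _ _ _) _; congr (_ - _).
  apply: etrans (QW_mulZl _ _ _) _; congr (_ *: _).
  exact: etrans (QW_mul_delta _ _) (lact1 f).
apply: QWregB; [exact: charR | | exact: (Xel_reg charR Ht Hf)].
exact: (QWregZ charR _ Hf).
Qed.

Lemma Yword_reg s : QWreg (Yword L F s).
Proof.
by elim: s => [|i s IH]; [exact: (QWreg_delta charR) | exact: Yel_reg].
Qed.

Lemma reduced_cons i s w : reduced_seq (i :: s) w ->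
  [/\ reduced_seq s (word D s), w = (sgen D i * word D s)%g
    & (wlength (word D s) < wlength (sgen D i * word D s)%g)%N].
Proof.
move=> [ws /= sl]; have Ew : w = (sgen D i * word D s)%g by rewrite ws word_cons.
have E : size s = wlength (word D s).
  apply/eqP; rewrite eqn_leq wlength_word andbT -ltnS sl Ew.
  apply: leq_trans (wlengthM _ _) _.
  by rewrite -add1n leq_add2r wlength_sgen.
by split=> //; rewrite -E -Ew -sl.
Qed.

Lemma Yword_supp s w v : reduced_seq s w -> (Yword L F s)@_v != 0 -> bruhat v w.
Proof.
elim: s w v => [|i s IH] w v.
  move=> [-> _] /=; rewrite delta_coef; have [<- _|_] := eqVneq (1%g : W) v.
    exact: bruhat_refl.
  by rewrite eqxx.
move=> /reduced_cons[rs -> lt]; rewrite /= Yel_coef.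
have H1 := IH _ v rs; have H2 := IH _ (sgen D i * v)%g rs.
move: (Yword L F s)@_(sgen D i * v)%g H2 => y2 H2; move: (Yword L F s)@_v H1 => y1 H1.
have [E1|/H1 N1] := eqVneq y1 0; last by move=> _; have [] := bruhat_up N1 lt.
have [E2|/H2 N2] := eqVneq y2 0.
  by rewrite E1 E2 act_Q0 lincomb00 eqxx.
move=> _; have [_] := bruhat_up N2 lt.
by rewrite mulgA sgenK mul1g.
Qed.

(* The denominator of the leading coefficient: the product of the x_b over the
   inversions b of the word *)
Fixpoint inversion_prod (s : seq 'I_n) : S :=
  if s is i :: s' then x (aroot L i) * act_S (sgen D i) (inversion_prod s') else 1.

(** The identity term of [Y_i] does not contribute at [w], which is longer than every element in the
    support of the tail; only the [delta_(s_i)] term does. *)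
Lemma Yword_lead s w : reduced_seq s w ->
  (Yword L F s)@_w * inQ (inversion_prod s) = 1.
Proof.
elim: s w => [|i s IH] w.
  by move=> [-> _] /=; rewrite inQ1 delta_coef eqxx mulr1.
move=> /reduced_cons[rs -> lt]; rewrite [Yword _ _ _]/= Yel_coef [inversion_prod _]/= inQM.
have Ess : (sgen D i * (sgen D i * word D s))%g = word D s by rewrite mulgA sgenK mul1g.
rewrite Ess; apply: lead_stepE.
- apply/eqP; apply: contraT => /(Yword_supp rs)/bruhat_wlength[E|lt'].
    by rewrite E ltnn in lt.
  by have := ltn_trans lt lt'; rewrite ltnn.
- exact/xV_root/is_root_simple.
by rewrite -act_Q_inQ -act_QM IH // act_Q1.
Qed.

Lemma inversion_prod_dvd s k j : drop k s = j :: drop k.+1 s ->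
  xdvd (lat_act (word D (take k s)) (aroot L j)) (inversion_prod s).
Proof.
elim: s k => [|i s IH] [|k] //=.
  rewrite lat_act1 => -[-> _]; by exists (act_S (sgen D j) (inversion_prod s)).
move=> /IH[u Eu]; exists (x (aroot L i) * act_S (sgen D i) u).
by rewrite Eu act_SMul act_SX -lat_actM -word_cons; exact: mulrCA.
Qed.

(* At a positive root a, either x_a divides the inversion product, or s_a w > w and
   f has no coefficient at s_a w, hence no pole at x_a. *)
Lemma lead_regular s w f : reduced_seq s w -> QWreg f ->
  (forall v, f@_v != 0 -> (wlength v <= wlength w)%N) ->
  exists c, f@_w * inQ (inversion_prod s) = inQ c.
Proof.
move=> rs Hf Hl; apply: (locat_global (F := F)) => a ra pa.
have [t Ht] := root_reflection_ex ra; have [H1 H2] := Hf a t Ht w.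
have /root_reflectionE Ht' := Ht; have /positiveE pa' := pa.
have [N|N] := hroot_sign (hroot_act w^-1%g (hrefl_root Ht')).
  have E : f@_(t * w)%g = 0.
    apply/eqP; apply: contraT => /Hl; rewrite leqNgt.
    by rewrite (wlength_refl_gt Ht' pa' N).
  by rewrite E addr0 in H2; apply: locatM => //; apply: locat_inQ.
have [ws _] := rs; rewrite ws in N.
have [k [_ _ [j Ea dk]]] := reflection_deletion Ht' pa' N.
have Eaj : a = lat_act (word D (take k s)) (aroot L j) by apply: val_inj.
have [u ->] := inversion_prod_dvd dk; rewrite -Eaj inQM mulrA [_ * inQ (x a)]mulrC.
by apply: locatM => //; apply: locat_inQ.
Qed.

Section Basis.
Variables (I : W -> seq 'I_n) (redI : forall w, reduced_seq (I w) w).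
Notation Y := (fun v => Yword L F (I v)).
Notation comb := (lin_ext Y).

(** Supports are finite even if [W] is not; this bound is the measure of the inductions on leading
    terms. *)
Lemma QW_bounded f : exists d, forall u, f@_u != 0 -> (wlength u < d)%N.
Proof.
have [d Hd] := seq_bounded (@wlength K n A D) (msupp f : seq W).
by exists d => u; rewrite mcoeff_neq0 => /Hd.
Qed.

Lemma comb_coef c v : (comb c)@_v = \sum_(u <- msupp c) c@_u * (Y u)@_v.
Proof. by rewrite QW_coef_sum; apply: eq_bigr => u _; rewrite QW_coefZ. Qed.

Lemma Y_coef_eq0 u v : u != v -> (wlength u <= wlength v)%N -> (Y u)@_v = 0.
Proof.
move=> uv le; apply/eqP; apply: contraT => /(Yword_supp (redI u))/bruhat_wlength[E|lt].
  by rewrite E eqxx in uv.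
by rewrite leqNgt lt in le.
Qed.

Lemma comb_top c v : (forall u, c@_u != 0 -> (wlength u <= wlength v)%N) ->
  (comb c)@_v = c@_v * (Y v)@_v.
Proof.
move=> H; rewrite comb_coef.
transitivity (\sum_(u <- msupp c) (c@_u * (Y v)@_v) * (u == v)%:R).
  rewrite big_seq [RHS]big_seq; apply: eq_bigr => u; rewrite -mcoeff_neq0 => uc.
  have [-> |uv] := eqVneq u v; first by rewrite mulr1.
  by rewrite Y_coef_eq0 ?H // !mulr0.
apply: (@sum_indicator Q W _ (fun u => c@_u * (Y v)@_v)) => [|N]; first exact: fset_uniq.
by rewrite (mcoeff_outdom N) mul0r.
Qed.

Lemma comb_eq0 c : comb c = 0 -> c = 0.
Proof.
move=> E; have [d] := QW_bounded c; elim: d => [|d IH] Hd.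
  by apply/malgP => u; rewrite mcoeff0; apply/eqP; apply: contraT => /Hd.
apply: IH => u uc; have := Hd u uc; rewrite ltnS leq_eqVlt => /orP[/eqP Eu|//].
have := comb_top (c := c) (v := u); rewrite Eu E mcoeff0 => /(_ Hd) E0.
case/eqP: uc; have := Yword_lead (redI u) => E1.
exact: mul_unit_eq0 E1 E0.
Qed.

Lemma comb_inj c c' : comb c = comb c' -> c = c'.
Proof.
by move=> E; apply/eqP; rewrite -subr_eq0; apply/eqP/comb_eq0; rewrite linearB /= E subrr.
Qed.

Lemma delta_expand w : exists c : QW,
  (forall v, c@_v != 0 -> bruhat v w) /\ delta w = comb c.
Proof.
move: {2}(wlength w).+1 (leqnn (wlength w).+1) => d; elim: d w => [//|d IH] w wd.
(* Expansions are chosen for all shorter elements at once, with 0 as filler elsewhere; [delta w] is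
   then solved from the triangular expansion of [Y w]. *)
have [C HC] : exists C : W -> QW, forall v, (wlength v < wlength w)%N ->
    (forall u, (C v)@_u != 0 -> bruhat u v) /\ delta v = comb (C v).
  have H v : exists c : QW, (wlength v < wlength w)%N ->
      (forall u, c@_u != 0 -> bruhat u v) /\ delta v = comb c.
    have [lt|] := ltnP (wlength v) (wlength w); last by exists 0.
    by have [c Hc] := IH v (leq_trans lt wd); exists c.
  by exists (fun v => projT1 (cid (H v))) => v; apply: projT2 (cid (H v)).
set z := inQ (inversion_prod (I w)).
set l := [seq v <- msupp (Y w) | v != w].
have Hl v : v \in l -> bruhat v w /\ (wlength v < wlength w)%N.
  rewrite mem_filter => /andP[vw]; rewrite -mcoeff_neq0 => /(Yword_supp (redI w)) vb.
  split=> //; have [E|//] := bruhat_wlength vb; by rewrite E eqxx in vw.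
exists (z *: (delta w - \sum_(v <- l) (Y w)@_v *: C v)); split.
  move=> u; rewrite QW_coefZ QW_coefB QW_coef_sum delta_coef.
  have [-> _|wu] := eqVneq w u; first exact: bruhat_refl.
  move=> N; have [v vl Nv] : exists2 v, v \in l & (C v)@_u != 0.
    apply: contrapT => Hn; case/eqP: N; rewrite big_seq big1 ?subr0 ?mulr0 // => v vl.
    rewrite QW_coefZ; have [-> |nz] := eqVneq (C v)@_u 0; first by rewrite mulr0.
    by case: Hn; exists v.
  by have [vw lt] := Hl v vl; apply: bruhat_trans vw; apply: (HC v lt).1.
rewrite linearZ_LR linearB /= lin_ext_delta (linear_sum comb) /=.
transitivity (z *: (Y w - \sum_(v <- l) (Y w)@_v *: delta v)); last first.
  congr (_ *: (_ - _)); rewrite big_seq [RHS]big_seq; apply: eq_bigr => v vl.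
  by rewrite linearZ_LR /= -(HC v (Hl v vl).2).2.
have Elead := Yword_lead (redI w); rewrite -/z in Elead.
(* An invertible coefficient is nonzero only if [Q] is not the zero ring, which follows from the
   injectivity of [inQ]. *)
have wY : w \in msupp (Y w).
  rewrite -mcoeff_neq0; apply/eqP => E0.
  have : inQ 0 = inQ 1 := etrans (inQ0 _ _) (etrans (unit_zero_trivial Elead E0) (esym (inQ1 _ _))).
  by move=> /(@inQ_inj _ _ F _ _ _ L)/esym/eqP; rewrite oner_eq0.
have -> : Y w - \sum_(v <- l) (Y w)@_v *: delta v = (Y w)@_w *: delta w.
  rewrite {1}(QW_decomp (Y w)) /lin_ext (bigD1_seq w) ?fset_uniq //= big_filter.
  by rewrite addrK.
by rewrite scalerA mulrC Elead scale1r.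
Qed.
End Basis.
End DemazureWords.

Lemma fsbig_fset_eq (V : nmodType) (T : choiceType) (P : set T) (A : {fset T}) (E : T -> V) :
  (forall i, P i -> i \notin A -> E i = 0) -> (forall i, i \in A -> ~ P i -> E i = 0) ->
  \sum_(i \in P) E i = \sum_(i <- A) E i.
Proof.
move=> H1 H2; rewrite fsbig_mkcond (@fsbigTE _ _ _ _ A) => [|i iA]; last first.
  by rewrite /functions.patch; case: ifPn => //; rewrite inE => /H1; apply.
rewrite big_seq [RHS]big_seq; apply: eq_bigr => i iA.
by rewrite /functions.patch; case: ifPn => //; rewrite notin_setE => /(H2 _ iA).
Qed.

Lemma solve_leading (Q : comPzRingType) (b y p r z : Q) :
  b * y = 1 -> z = b * p + r -> p = y * (z - r).
Proof. by move=> E ->; rewrite addrK mulrA [y * b]mulrC E mul1r. Qed.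

Lemma cancel_leading (Q : comPzRingType) (y z c l : Q) : y * z = c -> l * z = 1 -> c * l = y.
Proof. by move=> <- E; rewrite -mulrA [z * l]mulrC E mulr1. Qed.

Lemma mul_diffE (Q : comPzRingType) (y1 y2 z1 z2 d e x : Q) :
  y1 - y2 = x * d -> z1 - z2 = x * e -> y1 * z1 - y2 * z2 = x * (y1 * e + d * z2).
Proof.
move=> E E'; have -> : y1 * z1 - y2 * z2 = y1 * (z1 - z2) + (y1 - y2) * z2 by ring.
by rewrite E E'; ring.
Qed.

Lemma div_diffE (Q : comPzRingType) (y z x xi s : Q) :
  x * xi = 1 -> xi * (y - z) = s -> y - z = x * s.
Proof. by move=> E <-; rewrite mulrA E mul1r. Qed.

(** * The dual basis and its products *)

Section DualBasis.
Variables (K : realType) (R : idomainType) (charR : [pchar R] =i pred0) (F : fgl R).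
Variables (n : nat) (A : cartan_matrix n) (D : root_datum K A) (L : demazure_lattice D).
Notation W := (weyl D).
Notation S := (dS L F).
Notation Q := (dQ L F).
Notation QW := (QW L F).
Notation delta := (@delta K n A D L R F).
Notation lact := (@left_delta K R F n A D L).
Notation x := (dx F).
Notation inQ := (@inQ K n A D L R F).
Notation xi a := (pz_inv (inQ (x a))).
Notation QWdual := {linear QW -> Q^o}.
Implicit Types (f g h : QW) (q r : Q) (u v w t : W) (a b : lattice L).

(** Integrality on all of [QWreg] and not only on [DF]: [QWreg] is given by conditions at each root,
    so stability under products can be checked root by root. *)
Definition reg_dual (phi : QWdual) := forall h, QWreg h -> exists s, phi h = inQ s.

Lemma reg_dual_DFdual phi : reg_dual phi -> in_DFdual phi.
Proof. by move=> H g /(DF_QWreg charR)/H. Qed.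

(** The quotient by [x_a] of the difference is the value of [phi] at [X_a delta_w], which is
    regular. *)
Lemma reg_dual_diff phi a t w : reg_dual phi -> root_reflection a t ->
  exists s, phi (delta w) - phi (delta (t * w)%g) = inQ (x a) * inQ s.
Proof.
move=> Hphi Ht; have ra := root_reflection_root Ht.
have [s Es] := Hphi _ (Xel_reg charR Ht (QWreg_delta (L := L) charR F w)).
exists s; apply: (div_diffE (xV_root F ra)); rewrite -Es.
have -> : QW_mul (Xel F a t) (delta w) = xi a *: (delta w - delta (t * w)%g).
  apply: etrans (QW_mulZl _ _ _) _; congr (_ *: _); apply: etrans (QW_mulBl _ _ _) _.
  congr (_ - _); first exact: etrans (QW_mul_delta _ _) (lact1 _).
  apply: etrans (QW_mul_delta _ _) _; exact: lact_delta.
by rewrite linearZ_LR linearB.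
Qed.

(* Adding the sum to its reindexing by w |-> s_a w, each pair of terms is regular at
   x_a; and 2 is invertible there. *)
Lemma dual_mul_reg phi psi : reg_dual phi -> reg_dual psi -> reg_dual (dual_mul phi psi).
Proof.
move=> Hphi Hpsi h Hh; apply: (locat_global (F := F)) => a ra pa.
have [t Ht] := root_reflection_ex ra.
pose th w : Q := phi (delta w) * psi (delta w).
(* The support is enlarged to a set stable under [w |-> t w], so that the sum can be reindexed. *)
pose d : {fset W} := (msupp h `|` [fset (t * w)%g | w in msupp h])%fset.
have dt w : ((t * w)%g \in d) = (w \in d).
  have H v : v \in d -> (t * v)%g \in d.
    rewrite !in_fsetU => /orP[vh|/imfsetP[v' vh ->]].
      by apply/orP; right; apply/imfsetP; exists v.
    by rewrite (root_reflectionK _ Ht) vh.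
  by apply/idP/idP => [/H|/H //]; rewrite (root_reflectionK _ Ht).
have Ed : dual_mul phi psi h = \sum_(w <- d) h@_w * th w.
  exact: dual_mul_funE (fsubsetUl _ _).
have Et : \sum_(w <- d) h@_w * th w = \sum_(w <- d) h@_(t * w)%g * th (t * w)%g.
  have P : perm_eq d (map (fun w => t * w)%g (enum_fset d)).
    apply: uniq_perm; rewrite ?map_inj_uniq ?fset_uniq //; first exact: mulgI.
    move=> w; apply/idP/mapP => [wd|[v vd ->]]; last by rewrite dt.
    by exists (t * w)%g; rewrite ?(root_reflectionK _ Ht) //; have := dt w; rewrite wd.
  by apply: etrans (perm_big _ P) _; exact: big_map.
have Hth w : exists s, th w = inQ s.
  have [s1 E1] := Hphi _ (QWreg_delta (L := L) charR F w).
  have [s2 E2] := Hpsi _ (QWreg_delta charR F w).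
  by exists (s1 * s2); rewrite inQM -E1 -E2.
rewrite Ed; apply: (locat_half charR ra).
have -> : \sum_(w <- d) h@_w * th w + \sum_(w <- d) h@_w * th w =
    \sum_(w <- d) (h@_w * th w + h@_(t * w)%g * th (t * w)%g).
  exact: etrans (congr1 (+%R _) Et) (esym (big_split _ _ _ _ _)).
apply: (locat_sum charR _ ra) => w.
have [s1 E1] := reg_dual_diff w Hphi Ht; have [s2 E2] := reg_dual_diff w Hpsi Ht.
rewrite (pair_sumE _ _ (mul_diffE E1 E2)); have [H1 H2] := Hh a t Ht w.
have [z1 Ez1] := Hphi _ (QWreg_delta (L := L) charR F w).
have [z2 Ez2] := Hpsi _ (QWreg_delta charR F (t * w)%g).
apply: (locatD ra (locatM ra H1 _) (locatM ra H2 _)).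
  by rewrite Ez1 Ez2 -!inQM -inQD; apply: (locat_inQ charR _ ra).
have [s Es] := Hth (t * w)%g; have Hs := locat_inQ charR s ra.
by rewrite -Es in Hs.
Qed.

Section Basis.
Variables (I : W -> seq 'I_n) (redI : forall w, reduced_seq (I w) w).
Notation Y := (fun v => Yword L F (I v)).
Notation comb := (lin_ext Y).

Definition delta_coords w : QW := projT1 (cid (delta_expand F L redI w)).
Lemma delta_coords_supp w v : (delta_coords w)@_v != 0 -> bruhat v w.
Proof. exact: (projT2 (cid (delta_expand F L redI w))).1. Qed.
Lemma delta_coordsE w : delta w = comb (delta_coords w).
Proof. exact: (projT2 (cid (delta_expand F L redI w))).2. Qed.

Definition coords : QW -> QW := lin_ext delta_coords.
HB.instance Definition _ := GRing.Linear.on coords.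

Lemma coords_delta w : coords (delta w) = delta_coords w.
Proof. exact: lin_ext_delta. Qed.

Lemma coordsK f : comb (coords f) = f.
Proof.
rewrite [RHS]QW_decomp /coords; apply: etrans (linear_sum comb _ _ _) _.
by apply: eq_bigr => w _; rewrite (linearZ_LR comb) /= -delta_coordsE.
Qed.

Lemma coords_comb c : coords (comb c) = c.
Proof. by apply: (comb_inj redI); rewrite coordsK. Qed.

Definition from_S q := exists s, q = inQ s.

Lemma from_S_sum (T : Type) (l : seq T) (E : T -> Q) :
  (forall i, from_S (E i)) -> from_S (\sum_(i <- l) E i).
Proof.
move=> H; elim: l => [|i l [s Es]]; first by exists 0; rewrite big_nil inQ0.
by have [s' Es'] := H i; exists (s' + s); rewrite big_cons Es Es' inQD.
Qed.

Lemma QWreg_sum (T : Type) (l : seq T) (E : T -> QW) :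
  (forall i, QWreg (E i)) -> QWreg (\sum_(i <- l) E i).
Proof.
move=> H; elim: l => [|i l IH].
  rewrite big_nil -(scale0r (delta 1%g)) -inQ0; apply: (QWregZ charR).
  exact: (QWreg_delta charR).
by rewrite big_cons; exact: QWregD (H i) IH.
Qed.

Lemma regular_expand f : QWreg f -> exists2 c : QW, (forall v, from_S c@_v) & f = comb c.
Proof.
have [d] := QW_bounded f; elim: d f => [|d IH] f Hd Hf.
  exists 0; first by move=> v; exists 0; rewrite mcoeff0 inQ0.
  rewrite linear0; apply/malgP => v; rewrite mcoeff0.
  by apply/eqP; apply: contraT => /Hd.
(* The length condition sits under the existential, so that [e] below is a total function, with 0 as
   filler at other lengths. *)
have He u : exists s, wlength u = d -> f@_u * inQ (inversion_prod F L (I u)) = inQ s.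
  have [Eu|Nu] := pselect (wlength u = d); last by exists 0.
  have [|s Es] := lead_regular charR (redI u) Hf; last by exists s.
  by move=> v /Hd; rewrite ltnS Eu.
pose e u := projT1 (cid (He u)).
have Ee u : wlength u = d -> f@_u * inQ (inversion_prod F L (I u)) = inQ (e u).
  exact: projT2 (cid (He u)).
set l := [seq u <- msupp f | wlength u == d].
(* The whole top layer is subtracted at once: among elements of length [d], each [Y u] has a
   coefficient only at [u], where [inQ (e u) *: Y u] has coefficient [f@_u]. *)
have [||c' Hc' Ec'] := IH (f - \sum_(u <- l) inQ (e u) *: Y u).
- move=> v; apply: contraNT; rewrite -leqNgt => dv; apply/eqP.
  rewrite QW_coefB QW_coef_sum; apply/eqP; rewrite subr_eq0; apply/eqP/esym.
  transitivity (\sum_(u <- l) f@_u * (u == v)%:R).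
    rewrite big_seq [RHS]big_seq; apply: eq_bigr => u.
    rewrite mem_filter => /andP[/eqP ud _]; rewrite QW_coefZ.
    have [<-|uv] := eqVneq u v.
      apply: etrans (esym (mulr1 _)).
      exact: cancel_leading (Ee u ud) (Yword_lead F L (redI u)).
    rewrite (Y_coef_eq0 F L redI uv) ?ud //.
    exact: etrans (mulr0 _) (esym (mulr0 _)).
  apply: (@sum_indicator Q W _ (fun u => f@_u)) => [|].
    by rewrite filter_uniq ?fset_uniq.
  rewrite mem_filter negb_and => /orP[vd|/mcoeff_outdom //].
  apply/eqP; apply: contraT => /Hd; rewrite ltnS => vd'.
  by case/eqP: vd; apply/eqP; rewrite eqn_leq vd' dv.
- apply: (QWregB charR) => //; apply: QWreg_sum => u; apply: (QWregZ charR).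
  exact: (Yword_reg charR).
exists (\sum_(u <- l) inQ (e u) *: delta u + c').
  move=> v; rewrite QW_coefD QW_coef_sum; have [s ->] := Hc' v.
  have [u|s' ->] := @from_S_sum _ l (fun u => (inQ (e u) *: delta u)@_v).
    rewrite QW_coefZ delta_coef; case: (u == v).
      by exists (e u); exact: mulr1.
    by exists 0; rewrite inQ0; exact: mulr0.
  by exists (s' + s); rewrite inQD.
rewrite linearD /= -Ec' (linear_sum comb).
rewrite (eq_bigr (fun u => inQ (e u) *: Y u)) => [|u _]; first by rewrite subrKC.
by rewrite linearZ_LR /= lin_ext_delta.
Qed.

Lemma coords_reg f v : QWreg f -> from_S (coords f)@_v.
Proof. by move=> /regular_expand[c Hc ->]; rewrite coords_comb. Qed.

Fact Ystar_fun_linear w : linear (fun f => (coords f)@_w : Q^o).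
Proof. by move=> q f g; rewrite linearP QW_coefD QW_coefZ. Qed.

(** [Ystar] is the zero functional unless a dual functional exists; the coordinate function at [w]
    is one. *)
Lemma Ystar_spec w : is_Ystar I w (Ystar L F I w).
Proof.
rewrite /Ystar; case: pselect => [H|N]; first exact: projT2 (cid H).
exfalso; apply: N.
pose m := GRing.isLinear.Build Q QW Q^o *:%R (fun f => (coords f)@_w : Q^o) (Ystar_fun_linear w).
pose phi : QWdual := HB.pack (fun f => (coords f)@_w : Q^o) m.
exists phi => v; have -> : phi (Yword L F (I v)) = (coords (Y v))@_w by [].
have -> : Y v = comb (delta v) by rewrite lin_ext_delta.
by rewrite coords_comb delta_coef.
Qed.

Lemma YstarE w f : Ystar L F I w f = (coords f)@_w.
Proof.
have HY := Ystar_spec w; move: (Ystar L F I w) HY => phi HY.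
rewrite -{1}(coordsK f); set c := coords f.
apply: etrans (linear_sum phi _ _ _) _.
transitivity (\sum_(v <- msupp c) c@_v * (v == w)%:R).
  by apply: eq_bigr => v _; rewrite (linearZ_LR phi) /= HY.
apply: (@sum_indicator Q W _ (fun v => c@_v)) => [|]; first exact: fset_uniq.
exact: mcoeff_outdom.
Qed.

Lemma Ystar_reg w : reg_dual (Ystar L F I w).
Proof. by move=> h Hh; rewrite YstarE; apply: coords_reg. Qed.

(** [bY] picks some expansion of [delta w]; independence of the [Y v] makes it the one constructed
    here. *)
Lemma bYE w v : bY L F I w v = (delta_coords w)@_v.
Proof.
rewrite /bY; case: xgetP => [c _ [_ Ec]|/(_ (delta_coords w))[]].
  suff -> : c = delta_coords w by [].
  by apply: (comb_inj redI); rewrite -delta_coordsE Ec.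
by split; [exact: delta_coords_supp | exact: delta_coordsE].
Qed.

Lemma bY_lead w : bY L F I w w * (Y w)@_w = 1.
Proof.
rewrite bYE -(comb_top redI) => [|u /delta_coords_supp/bruhat_wlength[-> //|/ltnW //]].
by rewrite -delta_coordsE delta_coef eqxx.
Qed.

Lemma Ystar_delta w t : Ystar L F I w (delta t) = bY L F I t w.
Proof.
apply: etrans (YstarE _ _) _; apply: (etrans _ (esym (bYE t w))).
by rewrite coords_delta.
Qed.

Section Product.
Variables u v : W.
Let phi := dual_mul (Ystar L F I u) (Ystar L F I v).

Lemma dual_mul_delta w : phi (delta w) = bY L F I w u * bY L F I w v.
Proof.
rewrite [LHS](dual_mul_funE _ _ (d := [fset w]%fset)); last exact: msuppU_le.
rewrite big_seq_fset1 delta_coef eqxx; apply: etrans (mul1r _) _.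
exact: (congr2 *%R (Ystar_delta _ _) (Ystar_delta _ _)).
Qed.

(** [phi (Y w)] is a combination of the [bY t u * bY t v] for [t] in the support of [Y w]; a nonzero
    one requires [u, v <= t <= w]. *)
Lemma dual_mul_Y_supp w : phi (Y w) != 0 -> bruhat u w /\ bruhat v w.
Proof.
move=> N; have [t tY Nt] : exists2 t, t \in msupp (Y w) &
    bY L F I t u * bY L F I t v != 0.
  apply: contrapT => H; case/eqP: N.
  rewrite [LHS](dual_mul_funE _ _ (fsubset_refl _)) big_seq big1 // => t tY.
  have [E|nz] := eqVneq (bY L F I t u * bY L F I t v) 0; last by case: H; exists t.
  have E' := etrans (congr2 *%R (Ystar_delta u t) (Ystar_delta v t)) E.
  exact: etrans (congr1 (GRing.mul _) E') (mulr0 _).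
have tw : bruhat t w by move: tY; rewrite -mcoeff_neq0; apply: Yword_supp.
split; apply: bruhat_trans tw; apply: delta_coords_supp; rewrite -bYE.
  by apply: contraNneq Nt => ->; apply/eqP; exact: mul0r.
by apply: contraNneq Nt => ->; apply/eqP; exact: mulr0.
Qed.

Lemma dual_mul_comb c : phi (comb c) = \sum_(w <- msupp c) c@_w * phi (Y w).
Proof.
apply: etrans (linear_sum phi _ _ _) _.
by apply: eq_bigr => w _; rewrite (linearZ_LR phi).
Qed.

Variable p : W -> S.
Hypothesis pE : forall w, phi (Y w) = inQ (p w).

Lemma dual_mul_coef_eq0 w : ~ (bruhat u w /\ bruhat v w) -> inQ (p w) = 0.
Proof.
by move=> N; rewrite -pE; apply/eqP; apply: contraT => /dual_mul_Y_supp/N.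
Qed.

Lemma dual_mul_formal_sum :
  formal_sum phi [set w | bruhat u w /\ bruhat v w]%classic p (fun w => Ystar L F I w).
Proof.
move=> q; have H w : w \notin msupp (coords q) -> Ystar L F I w q = 0.
  by move=> /mcoeff_outdom; rewrite YstarE.
split.
  apply: sub_finite_set (finite_fset (msupp (coords q))) => w [_ nz] /=.
  by apply: contraNT nz => /H ->.
rewrite (@fsbig_fset_eq _ _ _ (msupp (coords q))).
- rewrite -{1}(coordsK q) dual_mul_comb; apply: eq_bigr => w _.
  by rewrite pE YstarE; exact: mulrC.
- by move=> w _ /H ->; exact: mulr0.
by move=> w _ /dual_mul_coef_eq0 ->; exact: mul0r.
Qed.

Lemma dual_mul_recursion w :
  inQ (p w) = pz_inv (bY L F I w w) * (bY L F I w u * bY L F I w v -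
    \sum_(t \in [set t | bruhat u t /\ bruhat v t /\ bruhat t w /\ t <> w]%classic)
       inQ (p t) * bY L F I w t).
Proof.
rewrite (pz_invP (bY_lead w)); apply: solve_leading (bY_lead w) _.
rewrite -dual_mul_delta delta_coordsE dual_mul_comb.
set c := delta_coords w.
have wc : w \in msupp c.
  rewrite -mcoeff_neq0 -bYE; apply/eqP => E0.
  have : inQ 0 = inQ 1 :=
    etrans (inQ0 _ _) (etrans (unit_zero_trivial (bY_lead w) E0) (esym (inQ1 _ _))).
  by move=> /(@inQ_inj _ _ F _ _ _ L)/esym/eqP; rewrite oner_eq0.
(* The term of index [w] is isolated; the others form the sum over [t < w], those with [t] not above
   both [u] and [v] being zero. *)
rewrite (big_fsetD1 w) //= pE -bYE; congr (_ + _).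
rewrite (@fsbig_fset_eq _ _ _ (msupp c `\ w)%fset).
- by apply: eq_bigr => t _; rewrite pE bYE; exact: mulrC.
- move=> t [_ [_ [_ tw]]]; rewrite in_fsetD1 negb_and negbK => /orP[/eqP //|].
  move=> /mcoeff_outdom E; rewrite bYE -/c E; exact: mulr0.
move=> t; rewrite in_fsetD1 => /andP[/eqP tw]; rewrite -mcoeff_neq0 => /delta_coords_supp tb N.
rewrite (@dual_mul_coef_eq0 t); first exact: mul0r.
by move=> [ut vt]; apply: N.
Qed.
End Product.
End Basis.
End DualBasis.

Theorem lemma7p2 (K : realType) (R : idomainType) (charR : [pchar R] =i pred0)
    (F : fgl R) (n : nat) (A : cartan_matrix n) (D : root_datum K A)
    (L : demazure_lattice D) (I : weyl D -> seq 'I_n)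
    (redI : forall w, reduced_seq (I w) w) :
  let b := bY L F I in
  let Y := Ystar L F I in
  (forall w, in_DFdual (Y w)) /\
  exists p : weyl D -> weyl D -> weyl D -> dS L F,
  forall u v,
    [/\ in_DFdual (dual_mul (Y u) (Y v)),
        formal_sum (dual_mul (Y u) (Y v))
          [set w | bruhat u w /\ bruhat v w]%classic (p u v) Y
      & forall w, bruhat u w -> bruhat v w ->
          inQ (p u v w) = pz_inv (b w w) *
            (b w u * b w v -
             \sum_(t \in [set t | bruhat u t /\ bruhat v t /\
                                  bruhat t w /\ t <> w]%classic)
                inQ (p u v t) * b w t)].
Proof.
move=> b Y; have regY w : reg_dual (Y w) by apply: Ystar_reg.
split=> [w|]; first by apply/(reg_dual_DFdual charR)/regY.
have regYY u v : reg_dual (dual_mul (Y u) (Y v)) := dual_mul_reg charR (regY u) (regY v).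
have Hp u v w := regYY u v _ (Yword_reg (L := L) charR F (I w)).
pose p u v w := projT1 (cid (Hp u v w)).
have pE u v w : dual_mul (Y u) (Y v) (Yword L F (I w)) = inQ (p u v w).
  exact: projT2 (cid (Hp u v w)).
exists p => u v; split.
- exact/(reg_dual_DFdual charR)/regYY.
- exact: (dual_mul_formal_sum redI (pE u v)).
move=> w _ _; exact: (dual_mul_recursion redI (pE u v)).
Qed.
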